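(* Let $\mathcal A=[\underline\alpha,\bar\alpha]\subset(1,+\infty)$ and $L=1$. Let $n,p\to\infty$ and assume that $$p\cdot\Big(\frac{\rho_{n,p}}{n\sqrt p}\Big)^{\frac2{4\underline\alpha+1}}\to+\infty\qquad\text{and}\qquad\frac{\ln p}n\to0 .$$ Then the test $$\Delta^*_{ad}=\max_{r=1,\dots,N}\mathbf 1\big(\widehat{\mathcal D}_{n,r}>\mathcal C^*t_r\big)$$ with constant $\mathcal C^*>0$ large enough satisfies $$\gamma\Big(\Delta^*_{ad},\ \bigcup_{\alpha\in\mathcal A}Q(\alpha,L,\mathcal C\psi_\alpha)\Big)\to0$$ for all $\mathcal C>\mathcal C^*+\dfrac1{C(\underline\alpha,\bar\alpha)}$, where $\psi_\alpha=\big(\rho_{n,p}/(n\sqrt p)\big)^{\frac{2\alpha}{4\alpha+1}}$ and $C(\underline\alpha,\bar\alpha)=\exp\big(-8(\bar\alpha-\underline\alpha)/(4\underline\alpha+1)\big)$.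
   Context: Model: $X_1,\dots,X_n$ are i.i.d. $p$-dimensional Gaussian vectors $\mathcal N_p(0,\Sigma)$, $X_k=(X_{k,1},\dots,X_{k,p})^\top$, where $\Sigma=[\sigma_{ij}]_{1\le i,j\le p}$ is a covariance matrix with $\sigma_{ii}=1$ for all $i$. $\mathbb E_\Sigma$ denotes the corresponding expectation; $I$ is the $p\times p$ identity matrix. All asymptotics are as $n\to\infty$ and $p\to\infty$. Classes: $\mathcal F(\alpha,L)$ is the set of $p\times p$ symmetric non-negative definite matrices $\Sigma$ with $\sigma_{ii}=1$ for all $i$ and $\frac1p\sum_{1\le i<j\le p}\sigma_{ij}^2|i-j|^{2\alpha}\le L$. For $\varphi>0$, $Q(\alpha,L,\varphi)=\{\Sigma\in\mathcal F(\alpha,L):\ \frac1p\sum_{1\le i<j\le p}\sigma_{ij}^2\ge\varphi^2\}$. Adaptive test: $\rho_{n,p}=\sqrt{\ln\ln(n\sqrt p)}$, $N=\lceil\ln(n\sqrt p)\rceil$, and $\alpha_r=\underline\alpha+\frac{\bar\alpha-\underline\alpha}{N}\,r$ for $r=1,\dots,N$. With the constants $$C_T(\alpha,L)=((4\alpha+1)L)^{\frac1{2\alpha}},\quad C_\lambda(\alpha,L)=\frac{2\alpha+1}{2\alpha}((4\alpha+1)L)^{-\frac1{2\alpha}},\quad C(\alpha,L)=\frac{2\alpha+1}{(4\alpha+1)^{1+1/(2\alpha)}}L^{-\frac1{2\alpha}},$$ set, for each $r$, $$T_r=\lfloor C_T(\alpha_r,L)\,\psi_{\alpha_r}^{-1/\alpha_r}\rfloor,\quad\lambda_r=C_\lambda(\alpha_r,L)\,\psi_{\alpha_r}^{(2\alpha_r+1)/\alpha_r},\quad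 b_r=C^{1/2}(\alpha_r,L)\,\psi_{\alpha_r}^{2+\frac1{2\alpha_r}},$$ $$w^*_{ij,r}=\frac{\lambda_r}{b_r}\Big(1-\Big(\frac{|i-j|}{T_r}\Big)^{2\alpha_r}\Big)_+,\qquad\widehat{\mathcal D}_{n,r}=\frac1{n(n-1)p}\sum_{1\le k\ne l\le n}\ \sum_{1\le i<j\le p}w^*_{ij,r}X_{k,i}X_{k,j}X_{l,i}X_{l,j},$$ and $t_r=C_{\lambda_r}\,\rho_{n,p}/(n\sqrt p)$ with $C_{\lambda_r}=C_\lambda(\alpha_r,L)$. Error probabilities: for a test $\Delta$ (measurable function of the observations with values in $[0,1]$) and a set $Q$ of covariance matrices, $\gamma(\Delta,Q)=\mathbb E_I(\Delta)+\sup_{\Sigma\in Q}\mathbb E_\Sigma(1-\Delta)$. *)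

(* Defs.v *)
From HB Require Import structures.
From mathcomp Require Import all_boot all_order all_algebra.
From mathcomp Require Import all_classical all_reals all_analysis.
From mathcomp Require Import measurable_realfun lra.

Set Implicit Arguments.
Unset Strict Implicit.
Unset Printing Implicit Defensive.

Import Order.TTheory GRing.Theory Num.Theory.
Import numFieldNormedType.Exports.

Local Open Scope classical_set_scope.
Local Open Scope ring_scope.

Section product_law.
Context d (T : measurableType d) (R : realType).

Definition cons_tuple n (x : T * n.-tuple T) : n.+1.-tuple T :=
  [tuple of x.1 :: x.2].

Lemma measurable_cons_tuple n : measurable_fun setT (@cons_tuple n).
Proof. exact: (@measurable_cons _ _ _ _ _ _ snd). Qed.

HB.instance Definition _ n :=
  isMeasurableFun.Build _ _ _ _ (@cons_tuple n) (@measurable_cons_tuple n).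

Fixpoint iid_law (P : probability T R) (n : nat) : probability (n.-tuple T) R :=
  match n with
  | 0 => \d_ [tuple]
  | m.+1 => distribution (P \x iid_law P m)%E (@cons_tuple m)
  end.

End product_law.

Section gaussian.
Context {R : realType}.

Definition psd p (S : 'M[R]_p) : Prop :=
  S^T = S /\ forall x : 'rV[R]_p, 0 <= (x *m S *m x^T) 0 0.

Definition cov_root p (S : 'M[R]_p) : 'M[R]_p :=
  xget 0 [set A : 'M[R]_p | A *m A^T = S].

Lemma psd_factor p (S : 'M[R]_p) : psd S -> exists A : 'M[R]_p, A *m A^T = S.
Proof.
elim: p S => [S _|p IH S].
  by exists 0; apply/matrixP => -[].
rewrite -[S](@submxK _ 1 p 1 p).
move: (ulsubmx _) (ursubmx _) (dlsubmx _) (drsubmx _) => a b c S'.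
rewrite -[p.+1]/(1 + p)%N => -[].
rewrite tr_block_mx => /eq_block_mx[_ cb bc S'sym] Sge0.
have Sge x (y : 'rV[R]_p) : 0 <= x ^+ 2 * a 0 0 +
    (x * (y *m c) 0 0) *+ 2 + (y *m S' *m y^T) 0 0.
  have := Sge0 (row_mx x%:M y).
  rewrite mul_row_block tr_row_mx mul_row_col !mulmxDl -bc.
  rewrite tr_scalar_mx !mul_scalar_mx !mul_mx_scalar -scalemxAl.
  rewrite [b *m _](_ : _ = (y *m b^T)^T) ; last by rewrite trmx_mul trmxK.
  move: (y *m b^T) (y *m S' *m y^T) => u v.
  by rewrite !mxE => h; lra.
have a0 : 0 <= a 0 0.
  by have := Sge 1 0; rewrite !mul0mx !mxE; lra.
pose s := Num.sqrt (a 0 0).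
pose l : 'cV[R]_p := s^-1 *: c.
have sl : s *: l = c.
  have [az|az] := eqVneq (a 0 0) 0; last first.
    by rewrite scalerA divff ?scale1r// sqrtr_eq0 -ltNge lt_def az.
  rewrite scalerA /s az sqrtr0 invr0 mul0r scale0r; apply/esym.
  have yc (y : 'rV[R]_p) : (y *m c) 0 0 = 0.
    set q := (y *m S' *m y^T) 0 0; set t := (y *m c) 0 0.
    have h x : 0 <= x * t *+ 2 + q by have := Sge x y; rewrite az -/q -/t mulr0 add0r.
    apply/eqP/contraT => tn0; have := h (- (q + 1) / t).
    by rewrite divfK//; have := h 0; lra.
  apply/matrixP => i j; rewrite ord1 [RHS]mxE -[RHS](yc (delta_mx 0 i)) -rowE.
  by rewrite mxE.
have [|A' A'E] := IH (S' - l *m l^T).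
  split=> [|y].
    by rewrite linearB/= trmx_mul trmxK S'sym.
  have -> : (y *m (S' - l *m l^T) *m y^T) 0 0 =
      (y *m S' *m y^T) 0 0 - ((y *m l) 0 0) ^+ 2.
    have -> : y *m (S' - l *m l^T) *m y^T = y *m S' *m y^T - (y *m l) *m (y *m l)^T.
      by rewrite mulmxBr mulmxBl trmx_mul !mulmxA.
    move: (y *m l) (y *m S' *m y^T) => v w.
    by rewrite !mxE big_ord1 !mxE expr2.
  set u := (y *m l) 0 0.
  have cE : (y *m c) 0 0 = s * u by rewrite -sl -scalemxAr mxE.
  have s2 : s ^+ 2 = a 0 0 by rewrite sqr_sqrtr.
  have [sz|sn0] := eqVneq s 0.
    have -> : u = 0 by rewrite /u /l sz invr0 scale0r mulmx0 mxE.
    by have := Sge 0 y; rewrite expr0n/= !mul0r; lra.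
  have := Sge (- u / s) y.
  rewrite -s2 cE exprMn exprVn mulfVK ?expf_neq0// [s * u]mulrC mulrA mulrAC mulfVK//.
  by rewrite sqrrN -mulNr; lra.
exists (block_mx s%:M 0 l A').
rewrite tr_block_mx mulmx_block !mul0mx !trmx0 !mulmx0 !addr0 A'E.
rewrite tr_scalar_mx !mul_scalar_mx !mul_mx_scalar sl addrC subrK.
congr block_mx; last by rewrite -cb -sl; apply/matrixP => i j; rewrite !mxE.
apply/matrixP => i j; rewrite !ord1 !mxE.
by rewrite eqxx mulr1n -expr2 sqr_sqrtr.
Qed.

Lemma cov_rootP p (S : 'M[R]_p) : psd S -> cov_root S *m (cov_root S)^T = S.
Proof.
by move=> /psd_factor[A AS]; apply: (xgetPex 0 (P := [set A | A *m A^T = S])); exists A.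
Qed.

(* The standard normal law lives on [measurableTypeR R], a copy of [R]. *)
Definition mul_tuple p (A : 'M[R]_p) (z : p.-tuple (measurableTypeR R))
    : p.-tuple R :=
  [tuple \sum_(j < p) A i j * (tnth z j : R) | i < p].

Lemma measurable_mul_tuple p (A : 'M[R]_p) : measurable_fun setT (mul_tuple A).
Proof.
apply/measurable_fun_tnthP => i.
rewrite (_ : _ \o _ = fun z : p.-tuple (measurableTypeR R) =>
    \sum_(j < p) A i j * (tnth z j : R)); last first.
  by apply/funext => z; rewrite /= tnth_mktuple.
apply: measurable_sum => j; apply: measurable_funM; first exact: measurable_cst.
exact: (@measurable_tnth _ (measurableTypeR R) p j).
Qed.

HB.instance Definition _ p (A : 'M[R]_p) :=
  isMeasurableFun.Build _ _ _ _ (mul_tuple A) (@measurable_mul_tuple p A).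

(* N_p(0, S) is the law of A Z, where Z has i.i.d. N(0, 1) entries and
   A A^T = S; it is defined for singular S as well. *)
Definition gaussian_law p (S : 'M[R]_p) : probability (p.-tuple R) R :=
  distribution (iid_law (normal_prob (0 : R) 1) p) (mul_tuple (cov_root S)).

Definition sample_law n p (S : 'M[R]_p) : probability (n.-tuple (p.-tuple R)) R :=
  iid_law (gaussian_law S) n.

End gaussian.

Section testing.
Context {R : realType}.

Definition dist p (i j : 'I_p) : R := `|i%:R - j%:R|.

Definition Fclass p (alpha L : R) : set 'M[R]_p := [set S |
  [/\ psd S, forall i, S i i = 1 &
   p%:R^-1 * (\sum_(i < p) \sum_(j < p | (i < j)%N)
      S i j ^+ 2 * dist i j `^ (2 * alpha)) <= L]].

Definition Qclass p (alpha L phi : R) : set 'M[R]_p := [set S |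
  Fclass alpha L S /\
  phi ^+ 2 <= p%:R^-1 * (\sum_(i < p) \sum_(j < p | (i < j)%N) S i j ^+ 2)].

Definition gamma n p (Delta : n.-tuple (p.-tuple R) -> R) (Q : set 'M[R]_p)
    : \bar R :=
  ('E_(sample_law n 1%:M)[Delta] +
   ereal_sup [set 'E_(sample_law n S)[fun X => (1 - Delta X)%R] | S in Q])%E.

Definition rho (n p : nat) : R := Num.sqrt (ln (ln (n%:R * Num.sqrt p%:R))).

Definition rate (n p : nat) : R := rho n p / (n%:R * Num.sqrt p%:R).

Definition psi n p (alpha : R) : R :=
  rate n p `^ (2 * alpha / (4 * alpha + 1)).

Definition C_T (alpha L : R) : R :=
  ((4 * alpha + 1) * L) `^ (1 / (2 * alpha)).

Definition C_lambda (alpha L : R) : R :=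
  (2 * alpha + 1) / (2 * alpha) * ((4 * alpha + 1) * L) `^ (- (1 / (2 * alpha))).

Definition C_b (alpha L : R) : R :=
  (2 * alpha + 1) / (4 * alpha + 1) `^ (1 + 1 / (2 * alpha)) *
  L `^ (- (1 / (2 * alpha))).

Definition T_ n p (alpha L : R) : R :=
  (Num.floor (C_T alpha L * psi n p alpha `^ (- (1 / alpha))))%:~R.

Definition lambda_ n p (alpha L : R) : R :=
  C_lambda alpha L * psi n p alpha `^ ((2 * alpha + 1) / alpha).

Definition b_ n p (alpha L : R) : R :=
  Num.sqrt (C_b alpha L) * psi n p alpha `^ (2 + 1 / (2 * alpha)).

Definition wstar n p (alpha L : R) (i j : 'I_p) : R :=
  lambda_ n p alpha L / b_ n p alpha L *
  Num.max (1 - (dist i j / T_ n p alpha L) `^ (2 * alpha)) 0.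

Definition Dhat n p (alpha L : R) (X : n.-tuple (p.-tuple R)) : R :=
  let x k i := tnth (tnth X k) i in
  (n%:R * (n%:R - 1) * p%:R)^-1 *
  \sum_(k < n) \sum_(l < n | k != l) \sum_(i < p) \sum_(j < p | (i < j)%N)
    wstar n alpha L i j * x k i * x k j * x l i * x l j.

Definition threshold n p (alpha L : R) : R := C_lambda alpha L * rate n p.

(* The ceiling is nonnegative as soon as 1 <= n and 1 <= p. *)
Definition grid_size n p : nat := `|Num.ceil (ln (n%:R * Num.sqrt p%:R) : R)|%N.

Definition grid n p (al au : R) (r : nat) : R :=
  al + (au - al) / (grid_size n p)%:R * r%:R.

Definition adaptive_test n p (al au L Cstar : R) (X : n.-tuple (p.-tuple R)) : R :=
  \big[Num.max/0]_(1 <= r < (grid_size n p).+1)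
    \1_[set Y | Cstar * threshold n p (grid n p al au r) L
                < Dhat (grid n p al au r) L Y] X.

Definition C_adapt (al au : R) : R := expR (- (8 * (au - al) / (4 * al + 1))).

End testing.

(* Main.v *)
(* Let U_r be the U-statistic in the r-th test. Under the null hypothesis it is
   a martingale in the sample index: given the other observations, the
   contribution of one observation is a centred Gaussian quadratic form, whose
   matrix has zero diagonal. The exponential moments of Gaussian quadratic
   forms give an exponential supermartingale, hence a Gaussian tail for U_r,
   on the event that the conditional variances have the size of their means;
   by Chebyshev's inequality that event has probability
   1 - O(1/n) - O(rate^c) for some c > 0. For a large threshold constant the
   tail at t_r is at most exp(-2 rho^2) = (ln (n sqrt p))^-2. The N grid
   points, N being of order ln (n sqrt p), contribute a vanishing sum, since
   ln p = o(n).

   Under an alternative of smoothness a', take the smallest grid point a >= a'.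
   Since a - a' <= (au - al) / N and ln (1 / rate) <= N, passing from a' to a
   costs only the constant factor 1 / C_adapt, and the mean of U_r exceeds its
   threshold by a factor. By the Hoeffding decomposition the variance of U_r
   is controlled by sums of products of squared entries of S, which are
   bounded because S has unit diagonal and decay exponent a' > 1. Chebyshev's
   inequality then bounds the second-kind error by a constant over rho. *)

Require Import Defs.
From mathcomp Require Import all_boot all_order all_algebra.
From mathcomp Require Import all_classical all_reals all_analysis.
From mathcomp Require Import measurable_realfun ring lra.
Import Order.TTheory GRing.Theory Num.Theory.
Import numFieldNormedType.Exports.

Set Implicit Arguments.
Unset Strict Implicit.
Unset Printing Implicit Defensive.

Local Open Scope classical_set_scope.
Local Open Scope ring_scope.

(** * Integrals against probability measures *)

Section expectation_bounds.
Context d (T : measurableType d) (R : realType) (P : probability T R).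

(** Quadratic forms are never diagonalised. The i.i.d. laws grow by one factor in front, so each
    moment bound is an induction that integrates the front coordinate or observation with the others
    fixed and passes on an upper bound. The one integral computed from the density is that of exp(a
    Z^2 + b Z); moments of Z follow from it. The numerical constants record the slack of these
    inductions.

    The obstacle under the null is that the conditional variances of the martingale are random. They
    are quadratic in the past, with the squared weights in place of the weights: a diagonal part,
    which is a sum of i.i.d. terms, and an off-diagonal part, again a degenerate U-statistic, to
    which the variance bound of the first one applies. Its variance is smaller because the largest
    weight tends to 0. These two parts give the two polynomial error terms.

    Under an alternative, truncating the weights at T loses at most [Cs * slack] of the signal
    [C ^+ 2] (in units of psi^2), where [slack ^+ 2] is 1 / [C_adapt]; as (Cs + slack)^2 >= Cs^2 +
    Cs slack, the condition on [C] leaves [Cs ^+ 2]. *)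

Lemma integral_le_cst (f : T -> R) (c : R) : measurable_fun setT f ->
  (forall x, 0 <= f x) -> (forall x, f x <= c) ->
  (\int[P]_x (f x)%:E <= c%:E)%E.
Proof.
move=> mf f0 fc; have -> : c%:E = (\int[P]_x (cst c%:E) x)%E.
  by rewrite integral_cst//= [X in (_ * X)%E]probability_setT mule1.
apply: ge0_le_integral => //=.
- by move=> x _; rewrite lee_fin.
- exact/measurable_EFinP.
- by move=> x _; rewrite lee_fin.
Qed.

Lemma integral_le_mono (f g : T -> R) : measurable_fun setT f ->
  measurable_fun setT g -> (forall x, 0 <= f x) -> (forall x, f x <= g x) ->
  (\int[P]_x (f x)%:E <= \int[P]_x (g x)%:E)%E.
Proof.
move=> mf mg f0 fg; apply: ge0_le_integral => //=.
- by move=> x _; rewrite lee_fin.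
- exact/measurable_EFinP.
- exact/measurable_EFinP.
- by move=> x _; rewrite lee_fin.
Qed.

Lemma integral_EFinD_cst (f : T -> R) (c : R) : measurable_fun setT f ->
  (forall x, 0 <= f x) -> 0 <= c ->
  (\int[P]_x (f x + c)%:E = \int[P]_x (f x)%:E + c%:E)%E.
Proof.
move=> mf f0 c0; under eq_integral do rewrite EFinD.
rewrite ge0_integralD//=; first last.
- exact/measurable_EFinP.
- by move=> x _; rewrite lee_fin.
by rewrite integral_cst//= [X in (_ * X)%E]probability_setT mule1.
Qed.

Lemma integral_EFinD (f g : T -> R) : measurable_fun setT f ->
  measurable_fun setT g -> (forall x, 0 <= f x) -> (forall x, 0 <= g x) ->
  (\int[P]_x (f x + g x)%:E = \int[P]_x (f x)%:E + \int[P]_x (g x)%:E)%E.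
Proof.
move=> mf mg f0 g0; under eq_integral do rewrite EFinD.
rewrite ge0_integralD//=.
- by move=> x _; rewrite lee_fin.
- exact/measurable_EFinP.
- by move=> x _; rewrite lee_fin.
- exact/measurable_EFinP.
Qed.

Lemma integral_EFinZl (f : T -> R) (c : R) : measurable_fun setT f ->
  (forall x, 0 <= f x) -> 0 <= c ->
  (\int[P]_x (c * f x)%:E = c%:E * \int[P]_x (f x)%:E)%E.
Proof.
move=> mf f0 c0; under eq_integral do rewrite EFinM.
by rewrite ge0_integralZl//=; [exact/measurable_EFinP|move=> x _; rewrite lee_fin].
Qed.

Lemma integral_sum_le (I : finType) (f : I -> T -> R) (c : I -> R) :
  (forall i, measurable_fun setT (f i)) -> (forall i x, 0 <= f i x) ->
  (forall i, \int[P]_x (f i x)%:E <= (c i)%:E)%E ->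
  (\int[P]_x (\sum_i f i x)%:E <= (\sum_i c i)%:E)%E.
Proof.
move=> mf f0 fc; under eq_integral do rewrite -sumEFin.
rewrite ge0_integral_sum//=.
- by rewrite -sumEFin; apply: lee_sum => i _.
- by move=> i; exact/measurable_EFinP.
- by move=> i x _; rewrite lee_fin.
Qed.

Lemma markov_real (f : T -> R) (a c : R) : measurable_fun setT f ->
  (forall x, 0 <= f x) -> 0 < a -> (\int[P]_x (f x)%:E <= c%:E)%E ->
  (P [set x | (a <= f x)%R] <= (c / a)%:E)%E.
Proof.
move=> mf f0 a0 fc.
have mA : measurable [set x | a <= f x].
  by rewrite -[X in measurable X]setTI; exact: measurable_fun_le.
have : (\int[P]_x (a * \1_[set x | a <= f x] x)%:E <= c%:E)%E.
  apply: le_trans fc; apply: integral_le_mono => //.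
  - by apply: measurable_funM => //; exact: measurable_indic.
  - by move=> x; rewrite mulr_ge0// ltW.
  - move=> x; rewrite indicE; case: (boolP (_ \in _)); last by rewrite mulr0.
    by rewrite inE /= mulr1.
rewrite integral_EFinZl; [|exact: measurable_indic|by move=> x; rewrite indicE|exact: ltW].
rewrite integral_indic//= setIT => h.
by rewrite mulrC EFinM lee_pdivlMl.
Qed.

(** The shift [c] stands for what the variables not yet integrated contribute; without a cross term,
    variances add up in the inductions below. *)
Lemma centered_sq_le (f : T -> R) (v c : R) : measurable_fun setT f ->
  (\int[P]_x (f x)%:E = 0)%E -> (\int[P]_x (f x ^+ 2)%:E <= v%:E)%E ->
  (\int[P]_x ((f x + c) ^+ 2)%:E <= (v + c ^+ 2)%:E)%E.
Proof.
move=> mf f0 fv.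
have if2 : P.-integrable setT (EFin \o (fun x => f x ^+ 2)).
  apply/integrableP; split; first exact/measurable_EFinP/measurable_funX.
  apply: le_lt_trans (ltry v); apply: le_trans fv.
  under eq_integral do rewrite /= ger0_norm ?sqr_ge0//.
  by [].
(* Integrability comes from the second moment, through |f| <= 1 + f^2. *)
have if1 : P.-integrable setT (EFin \o f).
  have : P.-integrable setT (EFin \o (fun x => 1 + f x ^+ 2)).
    have := integrableD measurableT (finite_measure_integrable_cst P 1 measurableT) if2.
    by apply: eq_integrable => // x _ /=.
  apply: le_integrable => //; first exact/measurable_EFinP.
  move=> x _ /=; rewrite lee_fin [leRHS]ger0_norm ?addr_ge0 ?sqr_ge0//.
  rewrite -(real_normK (num_real (f x))).
  by have := normr_ge0 (f x); have := sqr_ge0 (`|f x| - 1); nra.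
have -> : (\int[P]_x ((f x + c) ^+ 2)%:E =
   \int[P]_x (f x ^+ 2)%:E + (2 * c)%:E * \int[P]_x (f x)%:E + (c ^+ 2)%:E)%E.
  rewrite -integralZl//.
  have -> : (c ^+ 2)%:E = (\int[P]_x (cst (c ^+ 2)%:E) x)%E.
    by rewrite integral_cst//= [X in (_ * X)%E]probability_setT mule1.
  rewrite -integralD//=; last exact: integrableZl.
  rewrite -integralD//=.
  - apply: eq_integral => x _; rewrite -EFinM -!EFinD; congr (_%:E); ring.
  - by apply: integrableD => //; exact: integrableZl.
  - exact: finite_measure_integrable_cst.
by rewrite f0 mule0 adde0 EFinD leeD2r.
Qed.

End expectation_bounds.

(** * Integration against a product law, one factor at a time *)

Section iid.
Context d (T : measurableType d) (R : realType) (P : probability T R).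

Lemma measurable_cons_fst n (f : n.+1.-tuple T -> R) (t : n.-tuple T) :
  measurable_fun setT f -> measurable_fun setT (fun x => f [tuple of x :: t]).
Proof.
move=> mf; apply: measurableT_comp => //.
exact: (@measurable_cons _ _ _ _ id n (cst t)).
Qed.

Lemma integral_iid_cons n (f : n.+1.-tuple T -> R) : measurable_fun setT f ->
  (forall t, 0 <= f t) ->
  (\int[iid_law P n.+1]_t (f t)%:E =
   \int[iid_law P n]_t \int[P]_x (f [tuple of x :: t])%:E)%E.
Proof.
move=> mf f0 /=.
rewrite ge0_integral_distribution//=; last first.
- exact/measurable_EFinP.
rewrite fubini_tonelli2//.
- apply/measurable_EFinP; apply: measurableT_comp => //.
- by move=> x /=; rewrite lee_fin.
Qed.

(* Only an upper bound of the inner integral is needed, so that the inner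
   integral itself never has to be known. *)
Lemma integral_iid_cons_le n (f : n.+1.-tuple T -> R) (g : n.-tuple T -> R) (c : R) :
  measurable_fun setT f -> (forall t, 0 <= f t) ->
  measurable_fun setT g ->
  (forall t : n.-tuple T, (\int[P]_x (f [tuple of x :: t])%:E <= (g t)%:E)%E) ->
  (\int[iid_law P n]_t (g t)%:E <= c%:E)%E ->
  (\int[iid_law P n.+1]_t (f t)%:E <= c%:E)%E.
Proof.
move=> mf f0 mg fg; apply: le_trans; rewrite integral_iid_cons//.
apply: ge0_le_integral => //=.
- by move=> t _; apply: integral_ge0 => x _; rewrite lee_fin.
- apply: (@measurable_fun_fubini_tonelli_G _ _ _ _ _ P
    (fun z : T * n.-tuple T => (f [tuple of z.1 :: z.2])%:E)).
    apply/measurable_EFinP; apply: measurableT_comp => //.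
    exact: measurable_cons_tuple.
  by move=> z; rewrite lee_fin.
- exact/measurable_EFinP.
Qed.

Lemma measurable_sum_tnth n (f : T -> R) : measurable_fun setT f ->
  measurable_fun setT (fun t : n.-tuple T => \sum_(k < n) f (tnth t k)).
Proof.
move=> mf; apply: measurable_sum => k.
by apply: measurableT_comp => //; exact: measurable_tnth.
Qed.

Lemma sum_tnth_cons n (V : nmodType) (f : T -> V) (x : T) (t : n.-tuple T) :
  \sum_(k < n.+1) f (tnth [tuple of x :: t] k) = f x + \sum_(k < n) f (tnth t k).
Proof.
rewrite big_ord_recl tnth0; congr (_ + _).
by apply: eq_bigr => k _; rewrite tnthS.
Qed.

(** Asking for the bound at every shift encodes at once that [f] is centred and that its variance is
    at most [v], and it is the form that the induction reproduces. *)
Lemma sq_sum_iid_le n (f : T -> R) (v c : R) : measurable_fun setT f ->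
  (forall c, (\int[P]_x ((f x + c) ^+ 2)%:E <= (v + c ^+ 2)%:E)%E) ->
  (\int[iid_law P n]_t ((\sum_(k < n) f (tnth t k) + c) ^+ 2)%:E
     <= (n%:R * v + c ^+ 2)%:E)%E.
Proof.
move=> mf fv; elim: n => [|n IH].
  apply: integral_le_cst => [|t|t].
  - by apply: measurable_funX; apply: measurable_funD => //; exact: measurable_sum_tnth.
  - exact: sqr_ge0.
  - by rewrite big_ord0 add0r mul0r add0r.
have v0 : 0 <= v.
  have := fv 0; rewrite expr0n addr0 -lee_fin; apply: le_trans => /=.
  by apply: integral_ge0 => x _; rewrite lee_fin sqr_ge0.
apply: (@integral_iid_cons_le _ _ (fun t => (\sum_(k < n) f (tnth t k) + c) ^+ 2 + v)).
- by apply: measurable_funX; apply: measurable_funD => //; exact: measurable_sum_tnth.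
- by move=> t; exact: sqr_ge0.
- apply: measurable_funD => //; apply: measurable_funX.
  by apply: measurable_funD => //; exact: measurable_sum_tnth.
- move=> t; under eq_integral do rewrite sum_tnth_cons -addrA.
  by rewrite [leRHS](_ : _ = (v + (\sum_(k < n) f (tnth t k) + c) ^+ 2)%:E) // addrC.
- rewrite integral_EFinD_cst//.
  + rewrite (_ : n.+1%:R * v + c ^+ 2 = n%:R * v + c ^+ 2 + v); last first.
      by rewrite -nat1r; ring.
    by rewrite EFinD; exact: leeD2r.
  + apply: measurable_funX; apply: measurable_funD => //; exact: measurable_sum_tnth.
  + by move=> t; exact: sqr_ge0.
Qed.

End iid.

Section finite_sums.
Context {R : realType}.

(** Lagrange's identity: twice the difference of the two sides is the sum of the squares of
    [a i * b j - a j * b i]. *)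
Lemma cauchy_schwarz_sum (I : finType) (a b : I -> R) :
  (\sum_i a i * b i) ^+ 2 <= (\sum_i a i ^+ 2) * (\sum_i b i ^+ 2).
Proof.
have h : 0 <= \sum_i \sum_j (a i * b j - a j * b i) ^+ 2.
  by do 2 (apply: sumr_ge0 => ? _); exact: sqr_ge0.
have E1 : (\sum_i a i ^+ 2) * (\sum_i b i ^+ 2) =
    \sum_i \sum_j a i ^+ 2 * b j ^+ 2 by rewrite big_distrlr.
have E2 : (\sum_i a i ^+ 2) * (\sum_i b i ^+ 2) =
    \sum_i \sum_j a j ^+ 2 * b i ^+ 2 by rewrite E1 exchange_big.
have E3 : (\sum_i a i * b i) ^+ 2 = \sum_i \sum_j (a i * b i) * (a j * b j).
  by rewrite expr2 big_distrlr.
have : \sum_i \sum_j (a i * b j - a j * b i) ^+ 2 =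
   (\sum_i a i ^+ 2) * (\sum_i b i ^+ 2) + (\sum_i a i ^+ 2) * (\sum_i b i ^+ 2)
   - 2 * (\sum_i a i * b i) ^+ 2.
  rewrite {1}E1 E2 E3 -big_split mulr_sumr -sumrB/=; apply: eq_bigr => i _.
  rewrite -big_split mulr_sumr -sumrB/=; apply: eq_bigr => j _.
  by ring.
by move=> E; rewrite E in h; lra.
Qed.

End finite_sums.

(** * The standard normal law *)

Section standard_normal.
Context {R : realType}.
Notation mu := (@lebesgue_measure R).
Notation N01 := (normal_prob (0 : R) 1).

(** The Radon-Nikodym derivative agrees almost everywhere with the density, because both have the
    same integral over every measurable set. *)
Lemma integral_normal_prob (m s : R) (f : R -> \bar R) :
  measurable_fun setT f -> (forall x, 0 <= f x)%E ->
  (\int[normal_prob m s]_x f x = \int[mu]_x (f x * (normal_pdf m s x)%:E))%E.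
Proof.
move=> mf f0; have dom := normal_prob_dominates m s.
rewrite -(Radon_Nikodym_SigmaFinite.change_of_variables dom f0 measurableT mf).
have mRN := Radon_Nikodym_SigmaFinite.f_integrable dom.
apply: ae_eq_integral => //.
- by apply: emeasurable_funM => //; exact: measurable_int mRN.
- apply: emeasurable_funM => //; apply/measurable_EFinP.
  exact: measurable_normal_pdf.
- apply: ae_eqe_mul2l; apply: integral_ae_eq => //.
  + apply/measurable_EFinP; exact: measurable_normal_pdf.
  + move=> A _ mA; rewrite -Radon_Nikodym_SigmaFinite.f_integral//.
Qed.

(** Completing the square turns the integrand into a multiple of the density of the normal law with
    mean b / k and variance 1 / k, where k = 1 - 2 a. *)
Lemma normal_mgf_quadratic (a b : R) : a < 1 / 2 ->
  (\int[N01]_z (expR (a * z ^+ 2 + b * z))%:E =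
   ((Num.sqrt (1 - 2 * a))^-1 * expR (b ^+ 2 / (2 * (1 - 2 * a))))%:E)%E.
Proof.
move=> a2; set k := 1 - 2 * a.
have k0 : 0 < k by rewrite /k; lra.
pose s := (Num.sqrt k)^-1.
have s0 : 0 < s by rewrite invr_gt0 sqrtr_gt0.
have s2 : s ^+ 2 = k^-1 by rewrite exprVn sqr_sqrtr// ltW.
have mexp : measurable_fun setT (fun z : R => expR (a * z ^+ 2 + b * z)).
  apply: measurableT_comp => //; apply: measurable_funD; apply: measurable_funM => //.
rewrite integral_normal_prob; first last.
- by move=> x; rewrite lee_fin expR_ge0.
- exact/measurable_EFinP.
have E z : ((expR (a * z ^+ 2 + b * z))%:E * (normal_pdf 0 1 z)%:E)%E =
   ((s * expR (b ^+ 2 / (2 * k)))%:E * (normal_pdf (b / k) s z)%:E)%E.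
  rewrite -!EFinM; congr (_%:E).
  rewrite !normal_pdfE ?oner_neq0 ?gt_eqF// /normal_peak /normal_fun.
  rewrite expr1n mul1r s2 subr0.
  have -> : Num.sqrt (k^-1 * pi *+ 2) = s * Num.sqrt (pi *+ 2).
    by rewrite -mulrnAr sqrtrM ?invr_ge0 ?ltW// sqrtrV// ltW.
  set Q := Num.sqrt (pi *+ 2).
  have EE : expR (a * z ^+ 2 + b * z) * expR (- z ^+ 2 / (1 *+ 2)) =
      expR (b ^+ 2 / (2 * k)) * expR (- (z - b / k) ^+ 2 / (k^-1 *+ 2)).
    rewrite -!expRD; congr expR; rewrite (_ : a = (1 - k) / 2); last by rewrite /k; field.
    by field; rewrite gt_eqF.
  rewrite [LHS](_ : _ = Q^-1 * (expR (a * z ^+ 2 + b * z) * expR (- z ^+ 2 / (1 *+ 2)))); last by rewrite mulrCA.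
  rewrite EE; have Q0 : Q != 0 by rewrite gt_eqF// sqrtr_gt0 mulrn_wgt0// pi_gt0.
  by field; rewrite Q0 gt_eqF.
under eq_integral do rewrite E.
rewrite ge0_integralZl//.
- by rewrite integral_normal_pdf mule1.
- apply/measurable_EFinP; exact: measurable_normal_pdf.
- by move=> x _; rewrite lee_fin normal_pdf_ge0.
- by rewrite lee_fin mulr_ge0 ?expR_ge0// ltW.
Qed.

(** Replaces differentiation under the integral sign: 1 + b f <= exp(b f) gives b (c - m) <= 3 b^2
    for the true mean [c] and all small [b] of either sign, which forces c = m. *)
Lemma mean_from_mgf d (T : measurableType d) (P : probability T R)
    (f : T -> R) (m : R) : P.-integrable setT (EFin \o f) ->
  (forall b, `|b| <= 1 / 8 ->
     (\int[P]_x (expR (b * f x))%:E <= (1 + b * m + 3 * b ^+ 2)%:E)%E) ->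
  (\int[P]_x (f x)%:E = m%:E)%E.
Proof.
move=> intf fE; have mf : measurable_fun setT f by apply/measurable_EFinP; exact: measurable_int intf.
have fin : (\int[P]_x (f x)%:E)%E \is a fin_num by exact: integrable_fin_num.
rewrite -(fineK fin); set c := fine _; congr (_%:E).
have key b : `|b| <= 1 / 8 -> b * (c - m) <= 3 * b ^+ 2.
  move=> /fE hb; have E : (\int[P]_x (1 + b * f x)%:E = (1 + b * c)%:E)%E.
    under eq_integral do rewrite EFinD EFinM.
    rewrite integralD//=; [|exact: finite_measure_integrable_cst|exact: integrableZl].
    rewrite integralZl// -(fineK fin) -/c.
    by rewrite integral_cst//= [X in (_ * X)%E]probability_setT mule1.
  have mexp : measurable_fun setT (fun x => expR (b * f x)).
    by apply: measurableT_comp => //; exact: measurable_funM.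
  have : (\int[P]_x (1 + b * f x)%:E <= \int[P]_x (expR (b * f x))%:E)%E.
    apply: le_integral => //.
    - under eq_fun do rewrite EFinD EFinM.
      by apply: integrableD => //; [exact: finite_measure_integrable_cst|exact: integrableZl].
    - apply/integrableP; split; first exact/measurable_EFinP.
      under eq_integral do rewrite /= ger0_norm ?expR_ge0//.
      exact: le_lt_trans hb (ltry _).
    - by move=> x _; rewrite lee_fin expR_ge1Dx.
  by rewrite E => /le_trans/(_ hb); rewrite lee_fin; lra.
have [//|] := eqVneq c m; rewrite -subr_eq0 => cm; exfalso.
set e := c - m in key cm; have e0 := normr_ge0 e.
(* This [b] has the sign of [e], is at most 1/8 in absolute value, and is so small that b e > 3
   b^2. *)
pose b := e / (8 * (1 + `|e|)).
have d0 : 0 < 8 * (1 + `|e|) by lra.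
have := key b; rewrite /b normrM normfV (gtr0_norm d0).
have -> : `|e| / (8 * (1 + `|e|)) <= 1 / 8 by rewrite ler_pdivrMr//; lra.
move=> /(_ isT); apply/negP; rewrite -ltNge.
have e2 : 0 < e ^+ 2 by rewrite exprn_even_gt0.
rewrite [ltRHS](_ : _ = e ^+ 2 * (8 * (1 + `|e|)) / (8 * (1 + `|e|)) ^+ 2); last first.
  by field; rewrite gt_eqF//; lra.
rewrite exprMn exprVn mulrA ltr_pM2r ?invr_gt0 ?exprn_gt0//.
by rewrite mulrC ltr_pM2l//; lra.
Qed.

Lemma sqrtV_le (x y : R) : 0 < x -> 0 <= y -> 1 <= y ^+ 2 * x -> (Num.sqrt x)^-1 <= y.
Proof.
move=> x0 y0 h; have s0 : 0 < Num.sqrt x by rewrite sqrtr_gt0.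
rewrite -[leLHS]mul1r ler_pdivrMr// -[X in X * _](ger0_norm y0) -sqrtr_sqr.
by rewrite -sqrtrM ?sqr_ge0// -[leLHS]sqrtr1 ler_wsqrtr.
Qed.

(** The polynomials of degree at most 4 needed here are dominated by exp(z^2 / 4), whose integral is
    given by the moment generating function. The second-order term of that exponential is z^4 /
    32. *)
Lemma expR_quarter_sq (z : R) : 16 + 4 * z ^+ 2 <= 16 * expR (z ^+ 2 / 4) /\
  (z ^+ 2 - 1) ^+ 2 <= 33 * expR (z ^+ 2 / 4).
Proof.
have u0 : 0 <= z ^+ 2 / 4 by rewrite mulr_ge0 ?sqr_ge0.
have := expR_ge1Dx (z ^+ 2 / 4); have := expR_ge1Dxn 1 u0.
rewrite (_ : (2)`!%:R = 2)//; have -> : (z ^+ 2 / 4) ^+ 2 / 2 = (z ^+ 2) ^+ 2 / 32 by field.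
by have := sqr_ge0 z; set w := z ^+ 2 => *; split; nra.
Qed.

Lemma integral_expR_quarter_sq : (\int[N01]_z (expR (z ^+ 2 / 4))%:E <= 2%:E)%E.
Proof.
have E (z : R) : z ^+ 2 / 4 = 1 / 4 * z ^+ 2 + 0 * z by ring.
under eq_integral do rewrite E.
rewrite normal_mgf_quadratic; last by lra.
rewrite expr0n mul0r expR0 mulr1 lee_fin.
by apply: sqrtV_le; lra.
Qed.

Lemma measurable_expR_quarter_sq : measurable_fun setT (fun z : R => expR (z ^+ 2 / 4)).
Proof. by apply: measurableT_comp => //; apply: measurable_funM => //; exact: measurable_funX. Qed.

Lemma normal_integrable (f : R -> R) : measurable_fun setT f ->
  (forall z, `|f z| <= 33 * expR (z ^+ 2 / 4)) -> N01.-integrable setT (EFin \o f).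
Proof.
move=> mf fle; apply/integrableP; split; first exact/measurable_EFinP.
apply: (@le_lt_trans _ _ (33%:E * 2%:E)%E); last by rewrite -EFinM ltry.
apply: (@le_trans _ _ (\int[N01]_z (33 * expR (z ^+ 2 / 4))%:E)%E).
  change (\int[N01]_z (`|f z|)%:E <= \int[N01]_z (33 * expR (z ^+ 2 / 4))%:E)%E.
  apply: integral_le_mono => //.
  - exact: measurableT_comp.
  - by apply: measurable_funM => //; exact: measurable_expR_quarter_sq.
rewrite integral_EFinZl//; last exact: measurable_expR_quarter_sq.
by apply: lee_pmul => //; [apply: integral_ge0 => z _; rewrite lee_fin expR_ge0|exact: integral_expR_quarter_sq].
Qed.

Lemma normal_integrable_id : N01.-integrable setT (EFin \o (fun z : R => z)).
Proof.
apply: normal_integrable => // z; have [+ _] := expR_quarter_sq z.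
rewrite -(real_normK (num_real z)); have := normr_ge0 z; have := sqr_ge0 (`|z| - 1).
by set w := `|z|; set e := expR _; nra.
Qed.

Lemma normal_integrable_sq : N01.-integrable setT (EFin \o (fun z : R => z ^+ 2)).
Proof.
apply: normal_integrable => [|z]; first exact: measurable_funX.
by rewrite ger0_norm ?sqr_ge0//; have [+ _] := expR_quarter_sq z; have := sqr_ge0 z; lra.
Qed.

Lemma normal_mean : (\int[N01]_z z%:E = 0)%E.
Proof.
apply: (mean_from_mgf normal_integrable_id) => b b8.
have E (z : R) : b * z = 0 * z ^+ 2 + b * z by ring.
under eq_integral do rewrite E.
rewrite normal_mgf_quadratic; last by lra.
rewrite !mulr0 subr0 sqrtr1 invr1 mul1r mulr1 addr0 lee_fin.
have b2 : b ^+ 2 <= 1 / 64.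
  by rewrite -(real_normK (num_real b)); have := normr_ge0 b; nra.
have := expR_ge1Dx (- (b ^+ 2 / 2)); rewrite expRN.
have := expR_gt0 (b ^+ 2 / 2); set e := expR _ => e0.
have eV : e * e^-1 = 1 by rewrite divff// gt_eqF.
by have := sqr_ge0 b; nra.
Qed.

Lemma normal_second_moment : (\int[N01]_z (z ^+ 2)%:E = 1%:E)%E.
Proof.
apply: (mean_from_mgf normal_integrable_sq) => b; rewrite ler_norml => /andP[b1 b2].
have E (z : R) : b * z ^+ 2 = b * z ^+ 2 + 0 * z by ring.
under eq_integral do rewrite E.
rewrite normal_mgf_quadratic; last by lra.
rewrite expr0n mul0r expR0 mulr1 lee_fin.
apply: sqrtV_le; [by lra|by nra|].
have -> : (1 + b * 1 + 3 * b ^+ 2) ^+ 2 * (1 - 2 * b) =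
  1 + b ^+ 2 * (3 - 8 * b - 3 * b ^+ 2 - 18 * b * b ^+ 2) by ring.
rewrite lerDl; apply: mulr_ge0; first exact: sqr_ge0.
have w : b ^+ 2 <= 1 / 64 by nra.
by have := sqr_ge0 b; nra.
Qed.

(** The one-dimensional step of all variance bounds. Here 132 = 2 * 33 * 2: the first 2 and the
    coefficient of [b ^+ 2] come from (x - y)^2 <= 2 x^2 + 2 y^2, then 33 from the domination and 2
    from the integral of exp(z^2 / 4). *)
Lemma normal_quadratic_centered (m b c : R) :
  (\int[N01]_z ((m * (z ^+ 2 - 1) + b * z + c) ^+ 2)%:E
    <= (132 * m ^+ 2 + 2 * b ^+ 2 + c ^+ 2)%:E)%E.
Proof.
apply: centered_sq_le.
- by apply: measurable_funD; apply: measurable_funM => //; apply: measurable_funB => //; exact: measurable_funX.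
- transitivity (\int[N01]_z (m%:E * ((z ^+ 2)%:E - 1%:E) + b%:E * z%:E))%E; first by apply: eq_integral => z _.
  have i1 := normal_integrable_id; have i2 := normal_integrable_sq.
  have i3 : N01.-integrable setT (fun z : R => ((z ^+ 2)%:E - 1%:E)%E).
    by apply: integrableB => //; exact: finite_measure_integrable_cst.
  have i4 := integrableZl measurableT m i3; have i5 := integrableZl measurableT b i1.
  rewrite integralD// integralZl// integralZl// normal_mean mule0 adde0 integralB//; last exact: finite_measure_integrable_cst.
  rewrite normal_second_moment integral_cst//= [X in (_ - _ * X)%E]probability_setT mule1.
  by rewrite -EFinB subrr mule0.
- apply: (@le_trans _ _ (\int[N01]_z (66 * m ^+ 2 * expR (z ^+ 2 / 4) + 2 * b ^+ 2 * z ^+ 2)%:E)%E).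
    apply: integral_le_mono.
    + apply: measurable_funX; apply: measurable_funD; apply: measurable_funM => //; apply: measurable_funB => //; exact: measurable_funX.
    + apply: measurable_funD; apply: measurable_funM => //; exact: measurable_expR_quarter_sq.
    + by move=> z; exact: sqr_ge0.
    + move=> z; have [_ h] := expR_quarter_sq z.
      apply: (@le_trans _ _ (2 * m ^+ 2 * (z ^+ 2 - 1) ^+ 2 + 2 * b ^+ 2 * z ^+ 2)).
        rewrite -subr_ge0 [X in _ <= X](_ : _ = (m * (z ^+ 2 - 1) - b * z) ^+ 2); last by ring.
        exact: sqr_ge0.
      rewrite lerD2r (_ : 66 * m ^+ 2 * expR (z ^+ 2 / 4) = 2 * m ^+ 2 * (33 * expR (z ^+ 2 / 4))); last by ring.
      by apply: ler_wpM2l => //; rewrite mulr_ge0 ?sqr_ge0.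
  rewrite integral_EFinD.
  + rewrite integral_EFinZl; [|exact: measurable_expR_quarter_sq|by move=> z; exact: expR_ge0|by rewrite mulr_ge0 ?sqr_ge0].
    rewrite integral_EFinZl; [|exact: measurable_funX|by move=> z; exact: sqr_ge0|by rewrite mulr_ge0 ?sqr_ge0].
    rewrite normal_second_moment mule1 EFinD; apply: leeD2r.
    rewrite (_ : 132 * m ^+ 2 = 66 * m ^+ 2 * 2); last by ring.
    rewrite [leRHS]EFinM; apply: lee_pmul => //; [by rewrite lee_fin mulr_ge0 ?sqr_ge0| |exact: integral_expR_quarter_sq].
    by apply: integral_ge0 => z _; rewrite lee_fin expR_ge0.
  + by apply: measurable_funM => //; exact: measurable_expR_quarter_sq.
  + by apply: measurable_funM => //; exact: measurable_funX.
  + by move=> z; rewrite mulr_ge0 ?expR_ge0// mulr_ge0 ?sqr_ge0.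
  + by move=> z; rewrite mulr_ge0 ?sqr_ge0// mulr_ge0 ?sqr_ge0.
Qed.

End standard_normal.

(** * Gaussian quadratic forms *)

Section quadratic_forms.
Context {R : realType}.
Notation N01 := (normal_prob (0 : R) 1).
Notation gauss p := (iid_law N01 p).
Notation RT := (measurableTypeR R).

Definition qform p (N : 'M[R]_p) (z : 'I_p -> R) : R :=
  \sum_i \sum_j N i j * (z i * z j).

Definition frob2 p (N : 'M[R]_p) : R := \sum_i \sum_j N i j ^+ 2.

Lemma frob2_ge0 p (N : 'M[R]_p) : 0 <= frob2 N.
Proof. by do 2 (apply: sumr_ge0 => ? _); exact: sqr_ge0. Qed.

Definition coords p (z : p.-tuple RT) (i : 'I_p) : R := tnth z i.

Lemma measurable_coords p (i : 'I_p) : measurable_fun setT (fun z : p.-tuple RT => coords z i).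
Proof. exact: (@measurable_tnth _ RT p i). Qed.

Lemma measurable_qform p (N : 'M[R]_p) :
  measurable_fun setT (fun z : p.-tuple RT => qform N (coords z)).
Proof.
apply: measurable_sum => i; apply: measurable_sum => j.
by apply: measurable_funM => //; apply: measurable_funM; exact: measurable_coords.
Qed.

(** Coefficient of the product of the front coordinate with another one. [N] is not assumed
    symmetric, hence both entries. *)
Let ex p (N : 'M[R]_p.+1) (j : 'I_p) := N ord0 (lift ord0 j) + N (lift ord0 j) ord0.
Let sub p (N : 'M[R]_p.+1) : 'M[R]_p := \matrix_(i, j) N (lift ord0 i) (lift ord0 j).

Let qform_cons p (N : 'M[R]_p.+1) (x : RT) (z : p.-tuple RT) :
  qform N (coords [tuple of x :: z]) =
    N ord0 ord0 * (x : R) ^+ 2 + (\sum_j ex N j * coords z j) * x + qform (sub N) (coords z).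
Proof.
rewrite /qform big_ord_recl big_ord_recl -!addrA; congr (_ + _).
rewrite /coords tnth0 mulr_suml.
under [in LHS]eq_bigr do rewrite tnthS.
under [X in _ + X = _]eq_bigr => i _ do rewrite big_ord_recl tnth0 !tnthS.
rewrite big_split/= !addrA -big_split/=; congr (_ + _).
  by apply: eq_bigr => j _; rewrite /ex; ring.
apply: eq_bigr => i _; apply: eq_bigr => j _.
by rewrite /sub mxE !tnthS.
Qed.

Let frob2_cons p (N : 'M[R]_p.+1) :
  frob2 N = N ord0 ord0 ^+ 2 + \sum_j (N ord0 (lift ord0 j) ^+ 2 + N (lift ord0 j) ord0 ^+ 2)
            + frob2 (sub N).
Proof.
rewrite /frob2 big_ord_recl big_ord_recl -!addrA; congr (_ + _).
under [X in _ + X = _]eq_bigr => i _ do rewrite big_ord_recl.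
rewrite !big_split/= -!addrA; congr (_ + (_ + _)).
by apply: eq_bigr => i _; apply: eq_bigr => j _; rewrite /sub mxE.
Qed.

Let tr_cons p (N : 'M[R]_p.+1) : \tr N = N ord0 ord0 + \tr (sub N).
Proof.
rewrite /mxtrace big_ord_recl; congr (_ + _).
by apply: eq_bigr => i _; rewrite mxE.
Qed.

Lemma gauss_linear_sq p (b : 'I_p -> R) :
  (\int[gauss p]_z ((\sum_i b i * coords z i) ^+ 2)%:E <= (2 * \sum_i b i ^+ 2)%:E)%E.
Proof.
have mlin q (e : 'I_q -> R) : measurable_fun setT (fun z : q.-tuple RT => \sum_i e i * coords z i).
  by apply: measurable_sum => i; apply: measurable_funM => //; exact: measurable_coords.
elim: p b => [b|p IH b].
  apply: integral_le_cst => [|z|z].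
  - by apply: measurable_funX; exact: mlin.
  - exact: sqr_ge0.
  - by rewrite !big_ord0 mulr0 expr0n.
apply: (@integral_iid_cons_le _ _ _ _ _ _
  (fun z => (\sum_i b (lift ord0 i) * coords z i) ^+ 2 + 2 * b ord0 ^+ 2)).
- by apply: measurable_funX; exact: mlin.
- by move=> t; exact: sqr_ge0.
- by apply: measurable_funD => //; apply: measurable_funX; exact: mlin.
- move=> z; have := normal_quadratic_centered 0 (b ord0) (\sum_i b (lift ord0 i) * coords z i).
  rewrite expr0n mulr0 add0r addrC; apply: le_trans; rewrite le_eqVlt; apply/orP; left; apply/eqP.
  apply: eq_integral => x _; rewrite mul0r add0r big_ord_recl /coords tnth0.
  by under eq_bigr do rewrite tnthS.
- rewrite integral_EFinD_cst.
  + by rewrite big_ord_recl mulrDr [X in (_ <= X%:E)%E]addrC [leRHS]EFinD; apply: leeD2r; exact: IH.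
  + by apply: measurable_funX; exact: mlin.
  + by move=> z; exact: sqr_ge0.
  + by rewrite mulr_ge0 ?sqr_ge0.
Qed.

(** Given the others, the front coordinate x adds the centred term N_00 (x^2 - 1) + l x, where l is
    linear in the others. The mean of 2 l^2 is at most 8 times the squared entries of the first row
    and column, well below the 132 available. *)
Lemma gauss_qform_centered p (N : 'M[R]_p) (c : R) :
  (\int[gauss p]_z ((qform N (coords z) - \tr N + c) ^+ 2)%:E
     <= (132 * frob2 N + c ^+ 2)%:E)%E.
Proof.
have mq q (M : 'M[R]_q) e : measurable_fun setT
    (fun z : q.-tuple RT => (qform M (coords z) - \tr M + e) ^+ 2).
  apply: measurable_funX; apply: measurable_funD => //.
  by apply: measurable_funB => //; exact: measurable_qform.
have mlin q (e : 'I_q -> R) : measurable_fun setT (fun z : q.-tuple RT => \sum_i e i * coords z i).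
  by apply: measurable_sum => i; apply: measurable_funM => //; exact: measurable_coords.
elim: p N => [N|p IH N].
  apply: integral_le_cst => [|z|z]; [exact: mq|exact: sqr_ge0|].
  by rewrite /qform /frob2 /mxtrace !big_ord0 mulr0 subr0 !add0r.
apply: (@integral_iid_cons_le _ _ _ _ _ _
  (fun z => 132 * N ord0 ord0 ^+ 2 + 2 * (\sum_j ex N j * coords z j) ^+ 2 +
    (qform (sub N) (coords z) - \tr (sub N) + c) ^+ 2)).
- exact: mq.
- by move=> t; exact: sqr_ge0.
- apply: measurable_funD; last exact: mq.
  by apply: measurable_funD => //; apply: measurable_funM => //; apply: measurable_funX; exact: mlin.
- move=> z; apply: le_trans (normal_quadratic_centered _ _ _).
  rewrite le_eqVlt; apply/orP; left; apply/eqP.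
  apply: eq_integral => x _; rewrite qform_cons tr_cons; congr ((_ ^+ 2)%:E).
  by ring.
- under eq_integral do rewrite -addrA addrC.
  rewrite integral_EFinD_cst.
  + rewrite integral_EFinD.
    * rewrite integral_EFinZl; [|by apply: measurable_funX; exact: mlin|by move=> z; exact: sqr_ge0|by []].
      apply: (@le_trans _ _ ((2 * (2 * \sum_j ex N j ^+ 2))%:E + (132 * frob2 (sub N) + c ^+ 2)%:E
                + (132 * N ord0 ord0 ^+ 2)%:E)%E).
        apply: leeD2r; apply: leeD; last exact: IH.
        rewrite [leRHS]EFinM; apply: lee_wpmul2l => //; exact: gauss_linear_sq.
      rewrite -!EFinD lee_fin frob2_cons.
      have : \sum_j ex N j ^+ 2 <= 2 * \sum_j (N ord0 (lift ord0 j) ^+ 2 + N (lift ord0 j) ord0 ^+ 2).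
        rewrite mulr_sumr; apply: ler_sum => j _; rewrite /ex.
        by set a := N _ _; set b := N _ _; have := sqr_ge0 (a - b); nra.
      set r := \sum_j (_ + _); have : 0 <= r by apply: sumr_ge0 => j _; rewrite addr_ge0 ?sqr_ge0.
      by lra.
    * by apply: measurable_funM => //; apply: measurable_funX; exact: mlin.
    * exact: mq.
    * by move=> z; rewrite mulr_ge0 ?sqr_ge0.
    * by move=> z; exact: sqr_ge0.
  + apply: measurable_funD; last exact: mq.
    by apply: measurable_funM => //; apply: measurable_funX; exact: mlin.
  + by move=> z; apply: addr_ge0 (sqr_ge0 _); rewrite mulr_ge0 ?sqr_ge0.
  + by rewrite mulr_ge0 ?sqr_ge0.
Qed.

Lemma sqrtV_le_expR (m : R) : `|m| <= 1 / 16 ->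
  (Num.sqrt (1 - 2 * m))^-1 <= expR (m + 4 * m ^+ 2).
Proof.
rewrite ler_norml => /andP[m1 m2]; apply: sqrtV_le; [lra|exact: expR_ge0|].
rewrite -expRM_natl; apply: (@le_trans _ _ ((1 + 2 * (m + 4 * m ^+ 2)) * (1 - 2 * m))).
  by have := sqr_ge0 m; nra.
by apply: ler_wpM2r; [lra|exact: expR_ge1Dx].
Qed.

(* Integrating out the first coordinate turns the quadratic form of [N] into
   that of a Schur complement, whose Frobenius norm is not larger. *)
Lemma gauss_qform_mgf p (N : 'M[R]_p) : frob2 N <= 1 / 256 ->
  (\int[gauss p]_z (expR (qform N (coords z)))%:E <= (expR (\tr N + 4 * frob2 N))%:E)%E.
Proof.
have mq q (M : 'M[R]_q) : measurable_fun setT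
    (fun z : q.-tuple RT => expR (qform M (coords z))).
  by apply: measurableT_comp => //; exact: measurable_qform.
elim: p N => [N _|p IH N hN].
  apply: integral_le_cst => [|z|z]; [exact: mq|exact: expR_ge0|].
  by rewrite /qform /frob2 /mxtrace !big_ord0 mulr0 add0r.
set m := N ord0 ord0; pose k := 1 - 2 * m.
pose r := \sum_j (N ord0 (lift ord0 j) ^+ 2 + N (lift ord0 j) ord0 ^+ 2).
pose f := frob2 (sub N).
pose B := \sum_j ex N j ^+ 2.
have r0 : 0 <= r by apply: sumr_ge0 => j _; rewrite addr_ge0 ?sqr_ge0.
have f0 : 0 <= f by exact: frob2_ge0.
have B0 : 0 <= B by apply: sumr_ge0 => j _; exact: sqr_ge0.
have Br : B <= 2 * r.
  rewrite /B /r mulr_sumr; apply: ler_sum => j _; rewrite /ex.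
  by set a := N _ _; set b := N _ _; have := sqr_ge0 (a - b); nra.
have hN' := hN; rewrite frob2_cons -/m -/r -/f in hN.
have m16 : `|m| <= 1 / 16.
  have mm : m ^+ 2 <= 1 / 256 by lra.
  by rewrite ler_norml; apply/andP; split; nra.
have := m16; rewrite ler_norml => /andP[m1 m2].
have k0 : 0 < k by rewrite /k; lra.
pose c := (2 * k)^-1.
have c0 : 0 < c by rewrite invr_gt0 mulr_gt0.
have c1 : c <= 4 / 7 by rewrite /c -[_ / _]invrK lef_pV2 ?posrE ?invf_div ?mulr_gt0//; rewrite /k; lra.
pose N' : 'M[R]_p := \matrix_(i, j) (sub N i j + c * (ex N i * ex N j)).
have qN' z : qform N' (coords z) = (\sum_j ex N j * coords z j) ^+ 2 * c + qform (sub N) (coords z).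
  rewrite expr2 big_distrlr/= mulr_suml -big_split/=; apply: eq_bigr => i _.
  rewrite mulr_suml -big_split/=; apply: eq_bigr => j _.
  by rewrite /N' mxE; ring.
have trN' : \tr N' = \tr (sub N) + c * B.
  rewrite /mxtrace /B mulr_sumr -big_split/=; apply: eq_bigr => i _.
  by rewrite /N' [LHS]mxE; ring.
have BB : \sum_i \sum_j (ex N i * ex N j) ^+ 2 = B ^+ 2.
  rewrite expr2 big_distrlr/=; apply: eq_bigr => i _; apply: eq_bigr => j _.
  by rewrite exprMn.
(* The squared Frobenius norm loses the [r] of the first row and column and regains at most a
   quarter of it. Four times the rest, 3 r, pays for the growth [c * B] <= 8/7 r of the trace. The
   case B = 0 is apart because the weight 16 B is a divisor. *)
have frobN' : frob2 N' <= f + r / 4.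
  have [B00|Bn0] := eqVneq B 0.
    have ex0 i j : ex N i * ex N j = 0.
      apply/eqP; have : \sum_i \sum_j (ex N i * ex N j) ^+ 2 == 0 by rewrite BB B00 expr0n.
      rewrite psumr_eq0; last by move=> *; apply: sumr_ge0 => *; exact: sqr_ge0.
      move=> /allP/(_ i (mem_index_enum _))/=; rewrite psumr_eq0; last by move=> *; exact: sqr_ge0.
      by move=> /allP/(_ j (mem_index_enum _))/=; rewrite sqrf_eq0.
    rewrite (_ : frob2 N' = f); first by lra.
    by apply: eq_bigr => i _; apply: eq_bigr => j _; rewrite /N' mxE ex0 mulr0 addr0.
  have Bp : 0 < B by rewrite lt_def Bn0.
  (* weighted AM-GM for the cross term, with weight [16 B] *)
  pose w := 16 * B.
  have : frob2 N' <= \sum_i \sum_j (sub N i j ^+ 2 * (1 + c * w)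
      + (ex N i * ex N j) ^+ 2 * (c / w + c ^+ 2)).
    apply: ler_sum => i _; apply: ler_sum => j _; rewrite /N' mxE.
    set a := sub N i j; set e := ex N i * ex N j.
    rewrite -subr_ge0 [X in _ <= X](_ : _ = c / w * (w * a - e) ^+ 2).
      by rewrite mulr_ge0 ?sqr_ge0// divr_ge0 ?ltW// mulr_gt0.
    by field; rewrite /w mulf_neq0.
  under eq_bigr do rewrite big_split -!mulr_suml/=.
  rewrite big_split -!mulr_suml/= -/(frob2 _) -/f BB.
  move/le_trans; apply.
  rewrite (_ : B ^+ 2 * (c / w + c ^+ 2) = B * c / 16 + (c * B) ^+ 2); last first.
    by rewrite /w; field.
  have f1 : f <= 1 / 256 by have := sqr_ge0 m; lra.
  have r1 : r <= 1 / 256 by have := sqr_ge0 m; lra.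
  have cB : c * B <= 8 / 7 * r.
    by apply: (@le_trans _ _ (4 / 7 * (2 * r))); [apply: ler_pM => //; exact: ltW|lra].
  have cB0 : 0 <= c * B by rewrite mulr_ge0// ltW.
  rewrite /w; nra.
have hN1 : frob2 N' <= 1 / 256 by have := sqr_ge0 m; lra.
apply: (@integral_iid_cons_le _ _ _ _ _ _
  (fun z => expR (m + 4 * m ^+ 2) * expR (qform N' (coords z)))).
- exact: mq.
- by move=> t; exact: expR_ge0.
- by apply: measurable_funM => //; exact: mq.
- move=> z; under eq_integral do rewrite qform_cons expRD EFinM.
  rewrite ge0_integralZr//; last first.
  + apply/measurable_EFinP; apply: measurableT_comp => //.
    by apply: measurable_funD; apply: measurable_funM => //; exact: measurable_funX.
  rewrite -/m normal_mgf_quadratic; last by lra.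
  rewrite -EFinM lee_fin -mulrA -[in leLHS]expRD qN' -/k /c.
  by apply: ler_wpM2r; [exact: expR_ge0|exact: sqrtV_le_expR].
- rewrite integral_EFinZl; [|exact: mq|by move=> z; exact: expR_ge0|exact: expR_ge0].
  apply: (@le_trans _ _ ((expR (m + 4 * m ^+ 2))%:E * (expR (\tr N' + 4 * frob2 N'))%:E)%E).
    by apply: lee_wpmul2l; [rewrite lee_fin expR_ge0|exact: IH].
  rewrite -EFinM -expRD lee_fin ler_expR tr_cons trN' frob2_cons -/m -/r -/f.
  have cB : c * B <= 8 / 7 * r.
    by apply: (@le_trans _ _ (4 / 7 * (2 * r))); [apply: ler_pM => //; exact: ltW|lra].
  by lra.
Qed.

End quadratic_forms.

(** * The U-statistic and its Hoeffding decomposition *)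

Section gaussian_vector.
Context {R : realType} (p : nat) (S : 'M[R]_p) (hS : psd S).
Notation gauss := (iid_law (normal_prob (0 : R) 1) p).
Let A := cov_root S.

Lemma cov_root_sum i k : \sum_a A i a * A k a = S i k.
Proof.
rewrite -[in RHS](cov_rootP hS) mxE; apply: eq_bigr => a _.
by rewrite mxE.
Qed.

Lemma psd_sym i j : S i j = S j i.
Proof. by case: hS => sS _; rewrite -[in LHS]sS mxE. Qed.

(** For symmetric S this is tr(N^T S N S), the squared Frobenius norm of A^T N A for any root A of
    S. It plays the role of the variance of [qform N] under N(0, S). *)
Definition quartic (N : 'M[R]_p) : R :=
  \sum_i \sum_j \sum_k \sum_l N i j * N k l * (S i k * S j l).

Lemma exchange_big3 (I J : finType) (F : I -> I -> J -> R) :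
  \sum_a \sum_b \sum_i F a b i = \sum_i \sum_a \sum_b F a b i.
Proof.
under eq_bigr do rewrite exchange_big.
by rewrite exchange_big.
Qed.

Lemma trmulmxE (N : 'M[R]_p) (a b : 'I_p) :
  (A^T *m N *m A) a b = \sum_i \sum_j N i j * (A i a * A j b).
Proof.
rewrite mxE exchange_big/=; apply: eq_bigr => j _; rewrite mxE mulr_suml.
by apply: eq_bigr => i _; rewrite mxE; ring.
Qed.

Lemma frob2_cov_root (N : 'M[R]_p) : frob2 (A^T *m N *m A) = quartic N.
Proof.
rewrite /frob2; under eq_bigr => a _ do under eq_bigr => b _ do
  rewrite trmulmxE expr2 big_distrlr/=.
rewrite exchange_big3; apply: eq_bigr => i _.
transitivity (\sum_a \sum_b \sum_j \sum_k \sum_l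
    N i j * (A i a * A j b) * (N k l * (A k a * A l b))).
  apply: eq_bigr => a _; apply: eq_bigr => b _.
  under eq_bigr do rewrite mulr_suml.
  rewrite exchange_big/=; apply: eq_bigr => j _; apply: eq_bigr => k _.
  by rewrite mulr_sumr.
rewrite exchange_big3; apply: eq_bigr => j _.
rewrite exchange_big3; apply: eq_bigr => k _.
rewrite exchange_big3; apply: eq_bigr => l _.
rewrite -!cov_root_sum big_distrlr/= mulr_sumr; apply: eq_bigr => a _.
by rewrite mulr_sumr; apply: eq_bigr => b _; ring.
Qed.

(** The mean of [qform N] under N(0, S). *)
Definition cov_trace (N : 'M[R]_p) : R := \sum_i \sum_j N i j * S i j.

Lemma tr_cov_root (N : 'M[R]_p) : \tr (A^T *m N *m A) = cov_trace N.
Proof.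
rewrite /mxtrace; under eq_bigr do rewrite trmulmxE.
rewrite exchange_big/=; apply: eq_bigr => i _.
rewrite exchange_big/=; apply: eq_bigr => j _.
by rewrite -cov_root_sum mulr_sumr.
Qed.

Lemma qform_mul_tuple (N : 'M[R]_p) (z : p.-tuple (measurableTypeR R)) :
  qform N (tnth (mul_tuple A z)) = qform (A^T *m N *m A) (coords z).
Proof.
transitivity (\sum_i \sum_j \sum_a \sum_b N i j * (A i a * A j b) * (coords z a * coords z b)).
  apply: eq_bigr => i _; apply: eq_bigr => j _.
  rewrite !tnth_mktuple big_distrlr/= mulr_sumr; apply: eq_bigr => a _.
  by rewrite mulr_sumr; apply: eq_bigr => b _; rewrite /coords; ring.
rewrite exchange_big3; apply: eq_bigr => a _.
rewrite exchange_big3; apply: eq_bigr => b _.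
rewrite trmulmxE mulr_suml; apply: eq_bigr => i _.
by rewrite mulr_suml.
Qed.

Lemma measurable_qform_tnth (N : 'M[R]_p) :
  measurable_fun setT (fun x : p.-tuple R => qform N (tnth x)).
Proof.
apply: measurable_sum => i; apply: measurable_sum => j.
by apply: measurable_funM => //; apply: measurable_funM; exact: measurable_tnth.
Qed.

Lemma integral_gaussian_law (f : p.-tuple R -> R) : measurable_fun setT f ->
  (forall x, 0 <= f x) ->
  (\int[gaussian_law S]_x (f x)%:E = \int[gauss]_z (f (mul_tuple A z))%:E)%E.
Proof.
move=> mf f0; rewrite /gaussian_law ge0_integral_distribution//.
exact/measurable_EFinP.
Qed.

Lemma gaussian_qform_centered (N : 'M[R]_p) (c : R) :
  (\int[gaussian_law S]_x ((qform N (tnth x) - cov_trace N + c) ^+ 2)%:E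
     <= (132 * quartic N + c ^+ 2)%:E)%E.
Proof.
rewrite integral_gaussian_law.
- rewrite -frob2_cov_root -tr_cov_root; under eq_integral do rewrite qform_mul_tuple.
  exact: gauss_qform_centered.
- apply: measurable_funX; apply: measurable_funD => //; apply: measurable_funB => //.
  exact: measurable_qform_tnth.
- by move=> x; exact: sqr_ge0.
Qed.

Lemma gaussian_qform_mgf (N : 'M[R]_p) : quartic N <= 1 / 256 ->
  (\int[gaussian_law S]_x (expR (qform N (tnth x)))%:E
     <= (expR (cov_trace N + 4 * quartic N))%:E)%E.
Proof.
rewrite -frob2_cov_root -tr_cov_root => hN; rewrite integral_gaussian_law.
- under eq_integral do rewrite qform_mul_tuple.
  exact: gauss_qform_mgf.
- by apply: measurableT_comp => //; exact: measurable_qform_tnth.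
- by move=> x; exact: expR_ge0.
Qed.

Section weighted.
Variable W : 'M[R]_p.

Definition cross (i j : 'I_p) (x : p.-tuple R) : R := tnth x i * tnth x j - S i j.

Lemma measurable_cross i j : measurable_fun setT (cross i j).
Proof.
by apply: measurable_funB => //; apply: measurable_funM; exact: measurable_tnth.
Qed.

Lemma qform_cross (N : 'M[R]_p) (x : p.-tuple R) :
  qform N (tnth x) - cov_trace N = \sum_i \sum_j N i j * cross i j x.
Proof.
rewrite /qform /cov_trace -sumrB; apply: eq_bigr => i _.
by rewrite -sumrB; apply: eq_bigr => j _; rewrite /cross mulrBr.
Qed.

(* The degenerate part of [pkernel]. *)
Definition kernel0 (x y : p.-tuple R) : R :=
  \sum_i \sum_j W i j * (cross i j x * cross i j y).

Lemma kernel0C x y : kernel0 x y = kernel0 y x.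
Proof.
by apply: eq_bigr => i _; apply: eq_bigr => j _; rewrite (mulrC (cross i j x)).
Qed.

Lemma measurable_kernel0 d (T : measurableType d) (f g : T -> p.-tuple R) :
  measurable_fun setT f -> measurable_fun setT g ->
  measurable_fun setT (fun t => kernel0 (f t) (g t)).
Proof.
move=> mf mg; apply: measurable_sum => i; apply: measurable_sum => j.
apply: measurable_funM => //; apply: measurable_funM;
  by apply: measurableT_comp => //; exact: measurable_cross.
Qed.

(** Matrix of the quadratic form in a new observation that its interaction with the observations in
    [t] defines. *)
Definition past (n : nat) (t : n.-tuple (p.-tuple R)) : 'M[R]_p :=
  \matrix_(i, j) (W i j * \sum_(l < n) cross i j (tnth t l)).

Lemma kernel0_past n (x : p.-tuple R) (t : n.-tuple (p.-tuple R)) :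
  \sum_(l < n) kernel0 x (tnth t l) = qform (past t) (tnth x) - cov_trace (past t).
Proof.
rewrite qform_cross exchange_big/=; apply: eq_bigr => i _.
rewrite exchange_big/=; apply: eq_bigr => j _.
by rewrite mxE mulr_sumr mulr_suml; apply: eq_bigr => l _; ring.
Qed.

Definition ustat n (t : n.-tuple (p.-tuple R)) : R :=
  \sum_(k < n) \sum_(l < n | k != l) kernel0 (tnth t k) (tnth t l).

Lemma measurable_ustat n : measurable_fun setT (@ustat n).
Proof.
apply: measurable_sum => k; under eq_fun do rewrite big_mkcond; apply: measurable_sum => l.
by case: (k != l) => //; apply: measurable_kernel0; exact: measurable_tnth.
Qed.

(** Governs the degenerate part: the mean of [quartic] at the matrix of the past is at most a
    constant times this quantity per past observation. *)
Definition Gam : R :=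
  \sum_i \sum_j \sum_k \sum_l W i j * W k l * (S i k ^+ 2 * S j l ^+ 2).

Lemma gam_sum : \sum_a \sum_b quartic (\matrix_(i, j) (W i j * (A i a * A j b))) = Gam.
Proof.
rewrite exchange_big3; apply: eq_bigr => i _.
rewrite exchange_big3; apply: eq_bigr => j _.
rewrite exchange_big3; apply: eq_bigr => k _.
rewrite exchange_big3; apply: eq_bigr => l _.
transitivity (W i j * W k l * (S i k * S j l) *
    (\sum_a \sum_b A i a * A k a * (A j b * A l b))).
  rewrite mulr_sumr; apply: eq_bigr => a _.
  by rewrite mulr_sumr; apply: eq_bigr => b _; rewrite !mxE; ring.
by rewrite -big_distrlr/= !cov_root_sum; ring.
Qed.

Lemma measurable_past n (i j : 'I_p) : measurable_fun setT (fun t : n.-tuple (p.-tuple R) => past t i j).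
Proof.
under eq_fun do rewrite mxE.
by apply: measurable_funM => //; apply: measurable_sum_tnth; exact: measurable_cross.
Qed.

(** Each entry of A^T (past) A is a sum over the sample of i.i.d. centred quadratic forms, so its
    second moment is linear in n; by [gam_sum] the entries add up to [Gam]. *)
Lemma quartic_past n (t : n.-tuple (p.-tuple R)) : quartic (past t) =
  \sum_a \sum_b (\sum_(l < n) \sum_i \sum_j
     (\matrix_(i, j) (W i j * (A i a * A j b)) : 'M[R]_p) i j * cross i j (tnth t l)) ^+ 2.
Proof.
rewrite -frob2_cov_root; apply: eq_bigr => a _; apply: eq_bigr => b _; congr (_ ^+ 2).
rewrite trmulmxE [RHS]exchange_big/=; apply: eq_bigr => i _.
rewrite [RHS]exchange_big/=; apply: eq_bigr => j _.
rewrite !mxE -mulrA mulr_suml mulr_sumr.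
by apply: eq_bigr => l _; ring.
Qed.

Lemma measurable_quartic_past n :
  measurable_fun setT (fun t : n.-tuple (p.-tuple R) => quartic (past t)).
Proof.
do 4 (apply: measurable_sum => ?).
by apply: measurable_funM => //; apply: measurable_funM; exact: measurable_past.
Qed.

Lemma quartic_ge0 (N : 'M[R]_p) : 0 <= quartic N.
Proof. by rewrite -frob2_cov_root frob2_ge0. Qed.

Lemma integral_quartic_past n :
  (\int[sample_law n S]_t (quartic (@past n t))%:E <= (132 * n%:R * Gam)%:E)%E.
Proof.
have mf (N : 'M[R]_p) : measurable_fun setT (fun x : p.-tuple R => \sum_i \sum_j N i j * cross i j x).
  do 2 (apply: measurable_sum => ?).
  by apply: measurable_funM => //; exact: measurable_cross.
under eq_integral do rewrite quartic_past.
rewrite -gam_sum mulr_sumr.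
apply: integral_sum_le => [a|a t|a].
- by apply: measurable_sum => b; apply: measurable_funX; exact: (measurable_sum_tnth (mf _)).
- by apply: sumr_ge0 => b _; exact: sqr_ge0.
rewrite mulr_sumr; apply: integral_sum_le => [b|b t|b].
- by apply: measurable_funX; exact: (measurable_sum_tnth (mf _)).
- exact: sqr_ge0.
set N : 'M[R]_p := \matrix_(i, j) _.
have /= := @sq_sum_iid_le _ _ _ (gaussian_law S) n (fun x => \sum_i \sum_j N i j * cross i j x)
  (132 * quartic N) 0 (mf N) _.
rewrite expr0n addr0 mulrCA mulrA; under eq_integral do rewrite addr0.
apply => c; under eq_integral do rewrite -qform_cross.
exact: gaussian_qform_centered.
Qed.

Lemma pair_sum_cons n (h : p.-tuple R -> p.-tuple R -> R) (x : p.-tuple R)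
    (t : n.-tuple (p.-tuple R)) : (forall x y, h x y = h y x) ->
  \sum_(k < n.+1) \sum_(l < n.+1 | k != l)
      h (tnth [tuple of x :: t] k) (tnth [tuple of x :: t] l) =
  2 * (\sum_(l < n) h x (tnth t l)) +
  \sum_(k < n) \sum_(l < n | k != l) h (tnth t k) (tnth t l).
Proof.
move=> hC; rewrite big_ord_recl [X in X + _ = _]big_mkcond big_ord_recl eqxx /= add0r.
rewrite mulr_natl mulr2n -addrA; congr (_ + _).
  by apply: eq_bigr => l _; rewrite tnth0 tnthS.
rewrite -big_split/=; apply: eq_bigr => k _.
rewrite big_mkcond big_ord_recl/= tnth0 tnthS hC; congr (_ + _).
rewrite [RHS]big_mkcond; apply: eq_bigr => l _.
by rewrite (inj_eq lift_inj) tnthS.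
Qed.

Lemma Gam_ge0 : 0 <= Gam.
Proof. by rewrite -gam_sum; do 2 (apply: sumr_ge0 => ? _); exact: quartic_ge0. Qed.

Lemma quarticZ (a : R) (N : 'M[R]_p) : quartic (a *: N) = a ^+ 2 * quartic N.
Proof.
rewrite /quartic mulr_sumr; apply: eq_bigr => i _.
rewrite mulr_sumr; apply: eq_bigr => j _; rewrite mulr_sumr; apply: eq_bigr => k _.
by rewrite mulr_sumr; apply: eq_bigr => l _; rewrite !mxE; ring.
Qed.

Lemma qform_traceZ (a : R) (N : 'M[R]_p) x :
  qform (a *: N) x - cov_trace (a *: N) = a * (qform N x - cov_trace N).
Proof.
rewrite /qform /cov_trace -!sumrB mulr_sumr; apply: eq_bigr => i _.
rewrite -!sumrB mulr_sumr; apply: eq_bigr => j _.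
by rewrite !mxE; ring.
Qed.

(** A new observation adds twice a centred quadratic form, of conditional second moment at most 132
    * 4 = 528 times [quartic (past t)]. The mean of the latter is at most 132 m [Gam] after m
    observations, and the sum of 132 m over m < n is at most 66 n^2. *)
Lemma ustat_sq n (c : R) :
  (\int[sample_law n S]_t ((@ustat n t + c) ^+ 2)%:E
     <= (528 * 66 * n%:R ^+ 2 * Gam + c ^+ 2)%:E)%E.
Proof.
have mU m : measurable_fun setT (fun t : m.-tuple (p.-tuple R) => (ustat t + c) ^+ 2).
  by apply: measurable_funX; apply: measurable_funD => //; exact: measurable_ustat.
elim: n => [|n IH].
  apply: integral_le_cst => [|t|t]; [exact: mU|exact: sqr_ge0|].
  by rewrite /ustat big_ord0 expr0n mulr0 mul0r !add0r.
rewrite /sample_law; apply: (@integral_iid_cons_le _ _ _ (gaussian_law S) n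
  (fun t => (ustat t + c) ^+ 2)
  (fun t => (ustat t + c) ^+ 2 + 528 * quartic (past t))).
- exact: mU.
- by move=> t; exact: sqr_ge0.
- apply: measurable_funD; first exact: mU.
  by apply: measurable_funM => //; exact: measurable_quartic_past.
- move=> t; apply: (@le_trans _ _ (132 * quartic (2 *: past t) + (ustat t + c) ^+ 2)%:E); last first.
    by rewrite lee_fin quarticZ; lra.
  apply: le_trans (gaussian_qform_centered _ _); rewrite le_eqVlt; apply/orP; left; apply/eqP.
  apply: eq_integral => x _; congr ((_ ^+ 2)%:E).
  by rewrite /ustat pair_sum_cons ?kernel0_past ?qform_traceZ ?addrA//; exact: kernel0C.
- rewrite integral_EFinD.
  + apply: (@le_trans _ _ ((528 * 66 * n%:R ^+ 2 * Gam + c ^+ 2)%:E + (528 * (132 * n%:R * Gam))%:E)%E).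
      apply: leeD; first exact: IH.
      rewrite (@integral_EFinZl _ _ _ (sample_law n S) (fun t => quartic (past t)) 528 (@measurable_quartic_past n) (fun t => quartic_ge0 _) (ler0n _ _)).
      rewrite [leRHS]EFinM; apply: lee_wpmul2l; [exact: (ler0n _ _)|exact: integral_quartic_past].
    rewrite -EFinD lee_fin -nat1r; have := Gam_ge0.
    by have : 0 <= n%:R :> R by []; set g := Gam; set m := n%:R; nra.
  + exact: mU.
  + by apply: measurable_funM => //; exact: measurable_quartic_past.
  + by move=> t; exact: sqr_ge0.
  + by move=> t; exact: (mulr_ge0 (ler0n _ _) (quartic_ge0 _)).
Qed.

Definition pkernel (x y : p.-tuple R) : R :=
  \sum_i \sum_j W i j * (tnth x i * tnth x j * (tnth y i * tnth y j)).

Definition fstat n (t : n.-tuple (p.-tuple R)) : R :=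
  \sum_(k < n) \sum_(l < n | k != l) pkernel (tnth t k) (tnth t l).

Definition signal : R := \sum_i \sum_j W i j * S i j ^+ 2.

Definition wS : 'M[R]_p := \matrix_(i, j) (W i j * S i j).

(** Write x_i x_j as [cross i j x] plus S_ij in both arguments and expand: [signal] is the mean of
    the kernel, and [wS] is the matrix of its first-order projection. *)
Lemma kernel_hoeffding x y : pkernel x y = kernel0 x y +
  (qform wS (tnth x) - cov_trace wS + (qform wS (tnth y) - cov_trace wS)) + signal.
Proof.
rewrite !qform_cross -!big_split/=; apply: eq_bigr => i _.
rewrite -!big_split/=; apply: eq_bigr => j _.
by rewrite mxE /cross; ring.
Qed.

Lemma fstat_hoeffding n (t : n.-tuple (p.-tuple R)) :
  fstat t - n%:R * (n%:R - 1) * signal = ustat t +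
    2 * (n%:R - 1) * \sum_(k < n) (qform wS (tnth (tnth t k)) - cov_trace wS).
Proof.
pose g k := qform wS (tnth (tnth t k)) - cov_trace wS.
have E1 (f : 'I_n -> R) k : \sum_(l < n | k != l) f l = \sum_l f l - f k.
  by rewrite [in RHS](bigD1 k)//= addrC addrK; apply: eq_bigl => l; rewrite eq_sym.
have -> : fstat t = ustat t + \sum_(k < n) \sum_(l < n | k != l) (g k + g l) +
   \sum_(k < n) \sum_(l < n | k != l) signal.
  rewrite -!big_split/=; apply: eq_bigr => k _.
  by rewrite -!big_split/=; apply: eq_bigr => l _; exact: kernel_hoeffding.
have -> : \sum_(k < n) \sum_(l < n | k != l) signal = n%:R * (n%:R - 1) * signal.
  under eq_bigr do rewrite E1 sumr_const card_ord -mulr_natl.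
  by rewrite sumr_const card_ord -mulr_natl; ring.
have E2 (f : 'I_n -> R) : \sum_k \sum_(l | k != l) (f k + f l) = 2 * (n%:R - 1) * \sum_k f k.
  under eq_bigr do rewrite E1 big_split/= sumr_const card_ord.
  rewrite sumrB !big_split/= sumrMnl sumr_const card_ord -(mulr_natl (\sum_k f k) n).
  by ring.
rewrite E2.
by ring.
Qed.

Lemma measurable_fstat n : measurable_fun setT (@fstat n).
Proof.
apply: measurable_sum => k; under eq_fun do rewrite big_mkcond; apply: measurable_sum => l.
case: (k != l) => //; do 2 (apply: measurable_sum => ?); apply: measurable_funM => //.
by apply: measurable_funM; apply: measurable_funM;
  apply: (measurableT_comp (measurable_tnth _)) => //; exact: measurable_tnth.
Qed.

(** The degenerate and the linear part are separated by (x + y)^2 <= 2 x^2 + 2 y^2, without using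
    their orthogonality. The two occurrences of 1056 are 2 * 528 and 8 * 132. *)
Lemma fstat_variance n : (0 < n)%N ->
  (\int[sample_law n S]_t ((@fstat n t - n%:R * (n%:R - 1) * signal) ^+ 2)%:E
     <= (1056 * 66 * n%:R ^+ 2 * Gam + 1056 * n%:R ^+ 3 * quartic wS)%:E)%E.
Proof.
move=> n0; pose Q (t : n.-tuple (p.-tuple R)) := \sum_(k < n) (qform wS (tnth (tnth t k)) - cov_trace wS).
have mQ : measurable_fun setT Q.
  apply: (@measurable_sum_tnth _ _ _ n (fun x => qform wS (tnth x) - cov_trace wS)).
  by apply: measurable_funB => //; exact: measurable_qform_tnth.
have mq : measurable_fun setT (fun x : p.-tuple R => qform wS (tnth x) - cov_trace wS).
  by apply: measurable_funB => //; exact: measurable_qform_tnth.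
apply: (@le_trans _ _ (\int[sample_law n S]_t (2 * ustat t ^+ 2 + 8 * n%:R ^+ 2 * Q t ^+ 2)%:E)%E).
  apply: integral_le_mono.
  - by apply: measurable_funX; apply: measurable_funB => //; exact: measurable_fstat.
  - by apply: measurable_funD; apply: measurable_funM => //; apply: measurable_funX => //; exact: measurable_ustat.
  - by move=> t; exact: sqr_ge0.
  - move=> t; rewrite fstat_hoeffding -/(Q t).
    have n1 : 1 <= n%:R :> R by rewrite ler1n.
    apply: (@le_trans _ _ (2 * ustat t ^+ 2 + 8 * (n%:R - 1) ^+ 2 * Q t ^+ 2)).
      rewrite -subr_ge0 [X in _ <= X](_ : _ = (ustat t - 2 * (n%:R - 1) * Q t) ^+ 2); last by ring.
      exact: sqr_ge0.
    rewrite lerD2l; apply: ler_wpM2r; first exact: sqr_ge0.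
    by set m := n%:R in n1 *; nra.
rewrite integral_EFinD.
- rewrite EFinD; apply: leeD.
  + rewrite integral_EFinZl; [|by apply: measurable_funX; exact: measurable_ustat|by move=> t; exact: sqr_ge0|by []].
    rewrite (_ : 1056 * 66 * n%:R ^+ 2 * Gam = 2 * (528 * 66 * n%:R ^+ 2 * Gam)); last by ring.
    rewrite [leRHS]EFinM; apply: lee_wpmul2l => //.
    have := @ustat_sq n 0; rewrite expr0n addr0; apply: le_trans.
    by under eq_integral do rewrite -[ustat _]addr0.
  + rewrite integral_EFinZl; [|by apply: measurable_funX|by move=> t; exact: sqr_ge0|by rewrite mulr_ge0 ?sqr_ge0].
    rewrite (_ : 1056 * n%:R ^+ 3 * quartic wS = 8 * n%:R ^+ 2 * (n%:R * (132 * quartic wS))); last by ring.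
    rewrite [leRHS]EFinM; apply: lee_wpmul2l; first by rewrite lee_fin mulr_ge0 ?sqr_ge0.
    have /= := @sq_sum_iid_le _ _ _ (gaussian_law S) n _ (132 * quartic wS) 0 mq (@gaussian_qform_centered wS).
    rewrite expr0n addr0; apply: le_trans.
    by under eq_integral do rewrite -[Q _]addr0.
- by apply: measurable_funM => //; apply: measurable_funX; exact: measurable_ustat.
- by apply: measurable_funM => //; exact: measurable_funX.
- by move=> t; rewrite mulr_ge0 ?sqr_ge0.
- by move=> t; rewrite mulr_ge0 ?sqr_ge0// mulr_ge0 ?sqr_ge0.
Qed.

End weighted.
End gaussian_vector.

(** * Variance bounds from covariance decay *)

Section covariance_bounds.
Context {R : realType} (p : nat).
Implicit Types i j k l : 'I_p.

Lemma dist_sym i j : dist i j = dist j i :> R.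
Proof. by rewrite /dist distrC. Qed.

Lemma dist_ge0 i j : 0 <= dist i j :> R.
Proof. exact: normr_ge0. Qed.

Lemma dist_self i : dist i i = 0 :> R.
Proof. by rewrite /dist subrr normr0. Qed.

Lemma dist_ge1 i j : i != j -> 1 <= dist i j :> R.
Proof.
rewrite /dist neq_ltn => /orP[] ij.
  by rewrite distrC -(natrB _ (ltnW ij)) normr_nat ler1n subn_gt0.
by rewrite -(natrB _ (ltnW ij)) normr_nat ler1n subn_gt0.
Qed.

Lemma count_dist_le i (t : R) : 0 <= t ->
  \sum_j (dist i j <= t)%R%:R <= 2 * t + 1.
Proof.
move=> t0; pose n := Num.truncn t.
have nt : n%:R <= t by rewrite truncn_le.
rewrite -natr_sum -(@big_mkcond _ _ addn _ _ (fun j => dist i j <= t) (fun=> 1%N))/= sum1_card.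
apply: (@le_trans _ _ (2 * n + 1)%N%:R); last by rewrite natrD natrM lerD2r ler_wpM2l.
rewrite ler_nat.
have inP j : (dist i j <= t) -> (i <= j + n)%N /\ (j <= i + n)%N.
  have tn : t < n.+1%:R by exact: truncnS_gt.
  rewrite /dist => /le_lt_trans/(_ tn); rewrite ltr_norml => /andP[h1 h2]; split.
    by rewrite -ltnS -addnS -(ltr_nat R) natrD; lra.
  by rewrite -ltnS -addnS -(ltr_nat R) natrD; lra.
rewrite addn1 -[leqRHS]card_ord.
(* The shift j - i + n maps the neighbours of [i] injectively into 2 n + 1 values. *)
rewrite -(@card_in_imset _ _ (fun j : 'I_p => inord (j + n - i) : 'I_(2 * n).+1) [pred j | dist i j <= t]).
  exact: max_card.
move=> j j' /inP[h1 h2] /inP[h3 h4] /(congr1 val) /=.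
rewrite !inordK; [|by rewrite ltnS leq_subLR mul2n -addnn addnA leq_add2r|by rewrite ltnS leq_subLR mul2n -addnn addnA leq_add2r].
move=> e; apply/val_inj/eqP; rewrite /= -(eqn_add2r n); apply/eqP.
by rewrite -(subnK h1) -(subnK h3) e.
Qed.

Variables (S : 'M[R]_p).
Hypothesis symS : forall i j, S i j = S j i.
Hypothesis diagS : forall i, S i i = 1.
Hypothesis leS1 : forall i j, S i j ^+ 2 <= 1.
Hypothesis decayS : \sum_i \sum_j S i j ^+ 2 * dist i j ^+ 2 <= 2 * p%:R.
(** The weights are at most [wb] and vanish outside a band of width [T]; [kap] then bounds the row
    sums of squared weights up to a factor 3. *)
Variables (W : 'M[R]_p) (wb T kap : R).
Hypothesis symW : forall i j, W i j = W j i.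
Hypothesis W_ge0 : forall i j, 0 <= W i j.
Hypothesis W_le : forall i j, W i j <= wb * (dist i j <= T)%R%:R.
Hypothesis T_ge1 : 1 <= T.
Hypothesis wb_ge0 : 0 <= wb.
Hypothesis wbT : wb ^+ 2 * T <= kap.

(** The diagonal gives p. Off it the distance d is at least 1, so 2 d + 1 <= 3 d^2 and the decay
    assumption gives 6 p. *)
Lemma sum_cov_sq_dist : \sum_i \sum_j S i j ^+ 2 * (2 * dist i j + 1) <= 7 * p%:R.
Proof.
apply: (@le_trans _ _ (\sum_i (1 + \sum_j 3 * (S i j ^+ 2 * dist i j ^+ 2)))).
  apply: ler_sum => i _; rewrite (bigD1 i)//= dist_self diagS expr1n mul1r mulr0 add0r.
  rewrite lerD2l [leRHS](bigD1 i)//= dist_self expr0n mulr0 mulr0 add0r.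
  apply: ler_sum => j ji; rewrite mulrCA; apply: ler_wpM2l; first exact: sqr_ge0.
  have : 1 <= dist i j :> R by apply: dist_ge1; rewrite eq_sym.
  by nra.
rewrite big_split/= sumr_const card_ord; under eq_bigr do rewrite -mulr_sumr.
by rewrite -mulr_sumr; move: decayS; lra.
Qed.

(** Of the two squared covariances only the one between the more distant indices is kept, the other
    being at most 1. If it is S_ik^2, then j has at most 3 T choices near i, and l at most 2
    dist(i,k) + 1 choices near j; [sum_cov_sq_dist] sums the result to 21 T p. The opposite case is
    symmetric. *)
Lemma Gam_le : Gam S W <= 42 * kap * p%:R.
Proof.
pose near i j : R := (dist i j <= T)%R%:R.
pose X i j k l : R := near i j * (dist j l <= dist i k :> R)%:R * S i k ^+ 2.
have b01 (b : bool) : 0 <= (b%:R : R) <= 1 by case: b; rewrite ?lexx ler01.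
have nearC i j : near i j = near j i by rewrite /near dist_sym.
have sumX : \sum_i \sum_k \sum_j \sum_l X i j k l <= 21 * T * p%:R.
  apply: (@le_trans _ _ (\sum_i \sum_k (3 * T) * (S i k ^+ 2 * (2 * dist i k + 1)))).
    apply: ler_sum => i _; apply: ler_sum => k _.
    apply: (@le_trans _ _ (\sum_j near i j * ((2 * dist i k + 1) * S i k ^+ 2))).
      apply: ler_sum => j _; rewrite -mulr_suml -mulr_sumr -mulrA; apply: ler_wpM2l.
        by case/andP: (b01 (dist i j <= T)%R).
      apply: ler_wpM2r; [exact: sqr_ge0|exact/count_dist_le/dist_ge0].
    rewrite -mulr_suml (mulrC (S i k ^+ 2)); apply: ler_wpM2r.
      by rewrite mulr_ge0 ?sqr_ge0// addr_ge0// mulr_ge0// dist_ge0.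
    have T1 := T_ge1; have T0 : 0 <= T by lra.
    by apply: le_trans (count_dist_le i T0) _; lra.
  under eq_bigr do rewrite -mulr_sumr.
  rewrite -mulr_sumr (_ : 21 * T * p%:R = 3 * T * (7 * p%:R)); last by ring.
  by have T1 := T_ge1; apply: ler_wpM2l; [lra|exact: sum_cov_sq_dist].
apply: (@le_trans _ _ (\sum_i \sum_j \sum_k \sum_l (wb ^+ 2 * X i j k l + wb ^+ 2 * X j i l k))).
  apply: ler_sum => i _; apply: ler_sum => j _; apply: ler_sum => k _; apply: ler_sum => l _.
  rewrite -mulrDr; have h1 : W i j * W k l <= wb ^+ 2 * near i j.
    rewrite expr2 mulrAC; apply: ler_pM; [exact: W_ge0|exact: W_ge0|exact: W_le|].
    apply: le_trans (W_le k l) _; rewrite -[leRHS]mulr1; apply: ler_wpM2l => //.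
    by case/andP: (b01 (dist k l <= T)%R).
  apply: le_trans (ler_wpM2r _ h1) _; first by rewrite mulr_ge0 ?sqr_ge0.
  rewrite -mulrA; apply: ler_wpM2l; first exact: sqr_ge0.
  rewrite /X (nearC j i) -!mulrA -mulrDr; apply: ler_wpM2l; first by case/andP: (b01 (dist i j <= T)%R).
  have [s1 s2 s3 s4] : [/\ 0 <= S i k ^+ 2, 0 <= S j l ^+ 2, S i k ^+ 2 <= 1 & S j l ^+ 2 <= 1].
    by split; rewrite ?sqr_ge0.
  have [h|h] := leP (dist j l : R) (dist i k).
    by rewrite mul1r; have := b01 (dist i k <= dist j l :> R)%R; move=> /andP[? ?]; nra.
  by rewrite mul0r add0r (ltW h) mul1r; nra.
under eq_bigr do under eq_bigr do under eq_bigr do rewrite big_split/=.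
under eq_bigr do under eq_bigr do rewrite big_split/=.
under eq_bigr do rewrite big_split/=.
rewrite big_split/=.
have E1 : \sum_i \sum_j \sum_k \sum_l wb ^+ 2 * X i j k l <= wb ^+ 2 * (21 * T * p%:R).
  under eq_bigr => i _ do under eq_bigr => j _ do under eq_bigr => k _ do rewrite -mulr_sumr.
  under eq_bigr => i _ do under eq_bigr => j _ do rewrite -mulr_sumr.
  under eq_bigr => i _ do rewrite -mulr_sumr exchange_big/=.
  by rewrite -mulr_sumr; apply: ler_wpM2l; [exact: sqr_ge0|exact: sumX].
have E2 : \sum_i \sum_j \sum_k \sum_l wb ^+ 2 * X j i l k <= wb ^+ 2 * (21 * T * p%:R).
  apply: le_trans E1; rewrite le_eqVlt; apply/orP; left; apply/eqP.
  rewrite exchange_big/=; apply: eq_bigr => i _; apply: eq_bigr => j _.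
  by rewrite exchange_big.
have p0 : 0 <= p%:R :> R by [].
have : wb ^+ 2 * T * p%:R <= kap * p%:R by apply: ler_wpM2r.
by move: E1 E2; set a := wb ^+ 2; lra.
Qed.

(** For M = wS, the trace of (M S)^2 is at most the squared Frobenius norm of M S. Split S at
    distance r: by Cauchy-Schwarz the near part costs (2 r + 1)^2 <= 9 r^2, and by decay the far
    part costs 2 p / r^2, each times the squared norm of M. The latter is at most [wb] times the
    signal. *)
Lemma quartic_wS_le : (0 < p)%N ->
  quartic S (wS S W) <= 22 * wb * Num.sqrt p%:R * signal S W.
Proof.
move=> p0; set M := wS S W.
have symM i j : M i j = M j i by rewrite !mxE symW symS.
pose G := \sum_j \sum_k (\sum_i M j i * S i k) ^+ 2.
(* The cut-off r = p^(1/4) balances r^2 against p / r^2, both of which become sqrt p. *)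
pose q : R := Num.sqrt p%:R; pose r : R := Num.sqrt q.
have p1 : 1 <= p%:R :> R by rewrite ler1n.
have q1 : 1 <= q by rewrite /q -[leLHS]sqrtr1 ler_wsqrtr.
have r1 : 1 <= r by rewrite /r -[leLHS]sqrtr1 ler_wsqrtr.
have r2 : r ^+ 2 = q by rewrite sqr_sqrtr//; lra.
have q2 : q ^+ 2 = p%:R by rewrite sqr_sqrtr//; lra.
have step1 : quartic S M <= G.
  have E : quartic S M = \sum_j \sum_k (\sum_i M j i * S i k) * (\sum_l M k l * S l j).
    rewrite /quartic exchange_big/=; apply: eq_bigr => j _.
    rewrite exchange_big/=; apply: eq_bigr => k _.
    rewrite big_distrlr/=; apply: eq_bigr => i _; apply: eq_bigr => l _.
    by rewrite (symM j i) (symS l j); ring.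
  have E' : G = \sum_j \sum_k (\sum_l M k l * S l j) ^+ 2 by rewrite /G exchange_big.
  suff : 2 * quartic S M <= G + G by lra.
  rewrite {2}E' E /G mulr_sumr -big_split/=; apply: ler_sum => j _.
  rewrite mulr_sumr -big_split/=; apply: ler_sum => k _.
  by set a := \sum_i _; set b := \sum_l _; have := sqr_ge0 (a - b); nra.
have frM : frob2 M <= wb * signal S W.
  rewrite /frob2 /signal mulr_sumr; apply: ler_sum => i _.
  rewrite mulr_sumr; apply: ler_sum => j _; rewrite mxE exprMn mulrA.
  apply: ler_wpM2r; first exact: sqr_ge0.
  rewrite expr2; apply: ler_wpM2r => //; apply: le_trans (W_le i j) _.
  by apply: ler_piMr => //; case: (dist i j <= T)%R; rewrite ?lexx ?ler01.
pose nr (i k : 'I_p) : R := (dist i k <= r)%R%:R.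
have nr2 i k : nr i k * nr i k = nr i k by rewrite /nr; case: (dist i k <= r)%R; rewrite ?mulr1 ?mulr0.
have nr01 i k : 0 <= nr i k by rewrite /nr; case: (dist i k <= r)%R.
have near : \sum_j \sum_k (\sum_i M j i * (nr i k * S i k)) ^+ 2 <= 9 * q * frob2 M.
  rewrite /frob2 mulr_sumr; apply: ler_sum => j _.
  apply: (@le_trans _ _ (\sum_k (\sum_i M j i ^+ 2 * nr i k) * (2 * r + 1))).
    apply: ler_sum => k _.
    rewrite (eq_bigr (fun i => (M j i * nr i k) * (nr i k * S i k))); last first.
      by move=> i _; rewrite -mulrA (mulrA (nr i k)) nr2.
    apply: le_trans (cauchy_schwarz_sum _ _) _; apply: ler_pM.
    - by apply: sumr_ge0 => i _; exact: sqr_ge0.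
    - by apply: sumr_ge0 => i _; exact: sqr_ge0.
    - by apply: ler_sum => i _; rewrite exprMn [nr i k ^+ 2]expr2 nr2.
    - have r0 : 0 <= r by lra.
      apply: le_trans (count_dist_le k r0); apply: ler_sum => i _.
      rewrite exprMn [nr i k ^+ 2]expr2 nr2 dist_sym.
      exact: (ler_piMr (nr01 i k) (leS1 i k)).
  rewrite -mulr_suml exchange_big/= mulr_suml mulr_sumr; apply: ler_sum => i _.
  have r0 : 0 <= r by lra.
  rewrite -mulr_sumr -mulrA (mulrC _ (M j i ^+ 2)); apply: ler_wpM2l; first exact: sqr_ge0.
  apply: (@le_trans _ _ ((2 * r + 1) * (2 * r + 1))).
    by apply: ler_wpM2r; [lra|exact: count_dist_le].
  by rewrite -r2; nra.
have far : \sum_j \sum_k (\sum_i M j i * ((1 - nr i k) * S i k)) ^+ 2 <= 2 * q * frob2 M.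
  rewrite /frob2 mulr_sumr; apply: ler_sum => j _.
  apply: (@le_trans _ _ (\sum_k (\sum_i M j i ^+ 2) * (\sum_i ((1 - nr i k) * S i k) ^+ 2))).
    by apply: ler_sum => k _; exact: cauchy_schwarz_sum.
  rewrite -mulr_sumr mulrC; apply: ler_wpM2r; first by apply: sumr_ge0 => i _; exact: sqr_ge0.
  rewrite exchange_big/=; have q0 : 0 < q by lra.
  rewrite -(ler_pM2r q0) (_ : 2 * q * q = 2 * p%:R); last by rewrite -q2; ring.
  apply: le_trans decayS; rewrite mulr_suml; apply: ler_sum => i _.
  rewrite mulr_suml; apply: ler_sum => k _; rewrite exprMn mulrAC mulrC.
  apply: ler_wpM2l; first exact: sqr_ge0.
  rewrite /nr; have [h|h] := leP (dist i k : R) r; first by rewrite subrr expr0n mul0r sqr_ge0.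
  rewrite subr0 expr1n mul1r -r2; have r0 : 0 <= r by lra.
  by nra.
apply: le_trans step1 _; apply: (@le_trans _ _ (22 * q * frob2 M)).
  suff : G <= 2 * \sum_j \sum_k (\sum_i M j i * (nr i k * S i k)) ^+ 2 +
      2 * \sum_j \sum_k (\sum_i M j i * ((1 - nr i k) * S i k)) ^+ 2.
    by move: near far; set a := q * frob2 M; rewrite -!mulrA -/a; lra.
  rewrite !mulr_sumr -big_split/=; apply: ler_sum => j _.
  rewrite !mulr_sumr -big_split/=; apply: ler_sum => k _.
  have -> : \sum_i M j i * S i k = \sum_i M j i * (nr i k * S i k) +
      \sum_i M j i * ((1 - nr i k) * S i k).
    by rewrite -big_split/=; apply: eq_bigr => i _; ring.
  by set a := \sum_i _; set b := \sum_i _; have := sqr_ge0 (a - b); nra.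
rewrite (_ : 22 * wb * _ * _ = 22 * q * (wb * signal S W)); last by rewrite /q; ring.
by apply: ler_wpM2l => //; lra.
Qed.

End covariance_bounds.

Lemma chebyshev_ratio (R : realFieldType) (A1 A2 N th g q G Q : R) : 0 <= A1 -> 0 <= A2 -> 0 < N -> 0 < th ->
  g <= G -> q <= Q * th ->
  (A1 * N ^+ 2 * g + A2 * N ^+ 3 * q) / (N ^+ 4 * th ^+ 2 / 16) <=
  16 * (A1 * G / (N * th) ^+ 2 + A2 * Q / (N * th)).
Proof.
move=> A10 A20 N0 th0 gG qQ.
apply: (@le_trans _ _ ((A1 * N ^+ 2 * G + A2 * N ^+ 3 * (Q * th)) / (N ^+ 4 * th ^+ 2 / 16))).
  apply: ler_wpM2r.
    by rewrite invr_ge0 divr_ge0// mulr_ge0 ?exprn_ge0 ?ltW.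
  by apply: lerD; apply: ler_wpM2l => //; apply: mulr_ge0 => //; apply: exprn_ge0; exact: ltW.
rewrite le_eqVlt; apply/orP; left; apply/eqP; field.
by rewrite !gt_eqF.
Qed.

Lemma measurable_set_ltr d (T : measurableType d) (R : realType) (f g : T -> R) :
  measurable_fun setT f -> measurable_fun setT g -> measurable [set x | (f x < g x)%R].
Proof.
move=> mf mg; have := measurable_fun_ltr mf mg measurableT (Y := [set true]) I.
by rewrite setTI.
Qed.

(** * Chebyshev's inequality below the mean *)

Section lower_tail.
Context {R : realType} (p : nat) (S : 'M[R]_p) (hS : psd S).
Hypothesis diagS : forall i, S i i = 1.

(** Cauchy-Schwarz for two rows of the root, which have norm 1. *)
Lemma cov_sq_le1 i j : S i j ^+ 2 <= 1.
Proof.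
rewrite -(cov_root_sum hS i j); apply: le_trans (cauchy_schwarz_sum _ _) _.
rewrite (eq_bigr (fun a => cov_root S i a * cov_root S i a))//.
rewrite (eq_bigr (fun a => cov_root S j a * cov_root S j a) (F1 := fun a => cov_root S j a ^+ 2))//.
by rewrite !(cov_root_sum hS) !diagS mulr1.
Qed.

Hypothesis decayS : \sum_i \sum_j S i j ^+ 2 * dist i j ^+ 2 <= 2 * p%:R.
Variables (W : 'M[R]_p) (wb T kap : R).
Hypothesis symW : forall i j, W i j = W j i.
Hypothesis W_ge0 : forall i j, 0 <= W i j.
Hypothesis W_le : forall i j, W i j <= wb * (dist i j <= T)%R%:R.
Hypothesis T_ge1 : 1 <= T.
Hypothesis wb_ge0 : 0 <= wb.
Hypothesis wbT : wb ^+ 2 * T <= kap.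

Lemma fstat_lower_tail n : (0 < p)%N -> (1 < n)%N -> 0 < signal S W ->
  (sample_law n S [set t | (fstat W t <= n%:R * (n%:R - 1) / 2 * signal S W)%R] <=
   (16 * (1056 * 66 * (42 * kap * p%:R) / (n%:R * signal S W) ^+ 2 +
     1056 * (22 * wb * Num.sqrt p%:R) / (n%:R * signal S W)))%:E)%E.
Proof.
move=> p0 n1 th0; set th := signal S W in th0 *; set N : R := n%:R.
have N2 : 2 <= N by rewrite /N ler_nat.
have N0 : 0 < N by lra.
have hG := @Gam_le _ _ _ diagS cov_sq_le1 decayS _ _ _ _ W_ge0 W_le T_ge1 wb_ge0 wbT.
have hq := quartic_wS_le (psd_sym hS) cov_sq_le1 decayS symW W_ge0 W_le wb_ge0 p0.
have hV := fstat_variance hS W (ltnW n1); rewrite -/th -/N in hq hV.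
have mF : measurable_fun setT (fun t : n.-tuple (p.-tuple R) => (fstat W t - N * (N - 1) * th) ^+ 2).
  by apply: measurable_funX; apply: measurable_funB => //; exact: measurable_fstat.
(* Falling to half the mean N (N - 1) th is a deviation by at least N^2 th / 4, since N >= 2. *)
pose a : R := N ^+ 4 * th ^+ 2 / 16.
have a0 : 0 < a by rewrite divr_gt0// mulr_gt0// exprn_gt0//; lra.
have := markov_real mF (fun t => sqr_ge0 _) a0 hV.
have sub : [set t | (fstat W t <= N * (N - 1) / 2 * th)%R] `<=`
    [set t : n.-tuple (p.-tuple R) | (a <= (fstat W t - N * (N - 1) * th) ^+ 2)%R].
  move=> t /= ht; have h2 : N ^+ 2 * th / 4 <= N * (N - 1) * th - fstat W t.
    apply: (@le_trans _ _ (N * (N - 1) * th - N * (N - 1) / 2 * th)); last by lra.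
    rewrite -subr_ge0 [X in _ <= X](_ : _ = N * (N - 2) / 4 * th); last by field.
    by rewrite mulr_ge0// ?divr_ge0// ?mulr_ge0//; lra.
  have h1 : 0 <= N ^+ 2 * th / 4 by rewrite divr_ge0// mulr_ge0 ?sqr_ge0// ltW.
  rewrite /a (_ : N ^+ 4 * th ^+ 2 / 16 = (N ^+ 2 * th / 4) ^+ 2); last by field.
  rewrite -[X in _ <= X]sqrrN opprB; set x := _ - fstat W t in h2 *; nra.
move=> h; apply: le_trans (le_trans _ h) _.
  apply: le_measure => //; rewrite inE.
    rewrite -[X in measurable X]setTI; apply: measurable_fun_le => //.
    exact: measurable_fstat.
  by rewrite -[X in measurable X]setTI; apply: measurable_fun_le.
rewrite lee_fin; exact: (chebyshev_ratio (mulr_ge0 (ler0n _ _) (ler0n _ _)) (ler0n _ _) N0 th0 hG hq).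
Qed.

End lower_tail.

(** * The exponential supermartingale and the null hypothesis *)

Section supermartingale.
Context {R : realType} (p : nat) (S : 'M[R]_p) (hS : psd S).
Variable W : 'M[R]_p.

(* [cons_tuple] adds the new observation in front, so the filtration is indexed
   backwards: the past of observation [k] consists of the observations [l > k]. *)
Definition later n (k : 'I_n) (t : n.-tuple (p.-tuple R)) : 'M[R]_p :=
  \matrix_(i, j) (W i j * \sum_(l < n | (k < l)%N) cross S i j (tnth t l)).

Lemma later_cons0 n x (t : n.-tuple (p.-tuple R)) :
  later ord0 [tuple of x :: t] = past S W t.
Proof.
apply/matrixP => i j; rewrite !mxE big_mkcond big_ord_recl/= add0r.
by congr (_ * _); apply: eq_bigr => l _; rewrite tnthS.
Qed.

Lemma later_consS n (k : 'I_n) x (t : n.-tuple (p.-tuple R)) :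
  later (lift ord0 k) [tuple of x :: t] = later k t.
Proof.
apply/matrixP => i j; rewrite !mxE big_mkcond big_ord_recl/= add0r.
congr (_ * _); rewrite [RHS]big_mkcond; apply: eq_bigr => l _.
by rewrite tnthS.
Qed.

Variable s : R.
(** Says that the exponential moment bound applies to the matrix [2 * s *: later k t], whose
    [quartic] is the left-hand side. Where it fails, the process is set to 0, which keeps it a
    supermartingale. *)
Let small n (t : n.-tuple (p.-tuple R)) (k : 'I_n) : R :=
  if 4 * s ^+ 2 * quartic S (later k t) <= 1 / 256 then 1 else 0.

(** An observation enters the exponent through the quadratic form of [2 * s *: later k t]. The
    compensator 16 s^2 is the constant 4 of the exponential moment bound times (2 s)^2. *)
Definition supermart n (t : n.-tuple (p.-tuple R)) : R :=
  expR (s * ustat S W t - 16 * s ^+ 2 * \sum_k quartic S (later k t)) *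
  \prod_k small t k.

Lemma measurable_quartic_later n (k : 'I_n) :
  measurable_fun setT (fun t : n.-tuple (p.-tuple R) => quartic S (later k t)).
Proof.
have m i j : measurable_fun setT (fun t : n.-tuple (p.-tuple R) => later k t i j).
  under eq_fun do rewrite mxE big_mkcond.
  apply: measurable_funM => //; apply: measurable_sum => l.
  case: (k < l)%N => //; apply: measurableT_comp; first exact: measurable_cross.
  exact: measurable_tnth.
do 4 (apply: measurable_sum => ?).
by apply: measurable_funM => //; apply: measurable_funM.
Qed.

Lemma measurable_supermart n : measurable_fun setT (@supermart n).
Proof.
apply: measurable_funM.
  apply: measurableT_comp => //; apply: measurable_funB.
    by apply: measurable_funM => //; exact: measurable_ustat.
  by apply: measurable_funM => //; apply: measurable_sum => k; exact: measurable_quartic_later.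
apply: measurable_prod => k _; apply: measurable_fun_ifT => //.
apply: measurable_fun_ler => //; apply: measurable_funM => //.
exact: measurable_quartic_later.
Qed.

Lemma supermart_ge0 n (t : n.-tuple (p.-tuple R)) : 0 <= supermart t.
Proof.
by rewrite mulr_ge0 ?expR_ge0// prodr_ge0// => k _; rewrite /small; case: ifP.
Qed.

Lemma supermart_le1 n : (\int[sample_law n S]_t (@supermart n t)%:E <= 1%:E)%E.
Proof.
rewrite /sample_law; elim: n => [|n IH].
  apply: integral_le_cst => [|t|t]; [exact: measurable_supermart|exact: supermart_ge0|].
  by rewrite /supermart /ustat !big_ord0 !mulr0 subr0 expR0 mulr1.
apply: (@integral_iid_cons_le _ _ _ (gaussian_law S) n (@supermart n.+1) (@supermart n)).
- exact: measurable_supermart.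
- by move=> t; exact: supermart_ge0.
- exact: measurable_supermart.
- move=> t; set b := quartic S (past S W t).
  have E x : supermart [tuple of x :: t] =
     (supermart t * (if 4 * s ^+ 2 * b <= 1 / 256 then 1 else 0)
        * expR (- (2 * s) * cov_trace S (past S W t) - 16 * s ^+ 2 * b)) *
     expR (qform (2 * s *: past S W t) (tnth x)).
    rewrite /supermart /small !big_ord_recl !later_cons0 -/b.
    have -> : \sum_(i < n) quartic S (later (lift ord0 i) [tuple of x :: t]) =
        \sum_(i < n) quartic S (later i t) by apply: eq_bigr => i _; rewrite later_consS.
    have -> : \prod_(i < n) (if 4 * s ^+ 2 * quartic S (later (lift ord0 i) [tuple of x :: t]) <= 1 / 256
        then 1 else 0) = \prod_(i < n) (if 4 * s ^+ 2 * quartic S (later i t) <= 1 / 256 then 1 else 0) :> R.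
      by apply: eq_bigr => i _; rewrite later_consS.
    rewrite /ustat pair_sum_cons; last exact: kernel0C.
    rewrite kernel0_past -/(ustat S W t).
    set pr := \prod_(i < n) _; set sm := \sum_(i < n) _.
    set c := if _ then _ else _.
    have -> : qform (2 * s *: past S W t) (tnth x) = 2 * s * qform (past S W t) (tnth x).
      rewrite /qform mulr_sumr; apply: eq_bigr => i _; rewrite mulr_sumr.
      by apply: eq_bigr => j _; rewrite mxE; ring.
    rewrite [RHS](_ : _ = (expR (s * ustat S W t - 16 * s ^+ 2 * sm) *
      (expR (- (2 * s) * cov_trace S (past S W t) - 16 * s ^+ 2 * b) *
       expR (2 * s * qform (past S W t) (tnth x)))) * (c * pr)); last by ring.
    by rewrite -!expRD; congr (expR _ * _); ring.
  under eq_integral do rewrite E.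
  set m := _ * _ * expR _.
  have m0 : 0 <= m.
    by rewrite mulr_ge0 ?expR_ge0// mulr_ge0 ?supermart_ge0//; case: ifP.
  rewrite integral_EFinZl; [|by apply: measurableT_comp => //; exact: measurable_qform_tnth|by move=> x; exact: expR_ge0|exact: m0].
  have [hb|hb] := boolP (4 * s ^+ 2 * b <= 1 / 256); last first.
    by rewrite /m (negbTE hb) mulr0 mul0r mul0e lee_fin supermart_ge0.
  have q : quartic S (2 * s *: past S W t) = 4 * s ^+ 2 * b.
    by rewrite quarticZ -/b; ring.
  have hq : quartic S (2 * s *: past S W t) <= 1 / 256 by rewrite q.
  apply: (@le_trans _ _ (m%:E * (expR (cov_trace S (2 * s *: past S W t) + 4 * (4 * s ^+ 2 * b)))%:E)%E).
    by apply: lee_wpmul2l; [rewrite lee_fin|rewrite -q; exact: gaussian_qform_mgf].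
  rewrite -EFinM lee_fin /m hb mulr1 -[X in X <= _]mulrA -expRD.
  have -> : cov_trace S (2 * s *: past S W t) = 2 * s * cov_trace S (past S W t).
    rewrite /cov_trace mulr_sumr; apply: eq_bigr => i _; rewrite mulr_sumr.
    by apply: eq_bigr => j _; rewrite mxE; ring.
  rewrite (_ : _ + _ = 0) ?expR0 ?mulr1//; by ring.
- exact: IH.
Qed.

(** Off [Bad] all indicators equal 1, and where the statistic exceeds [u] the exponent is at least s
    u - 16 s^2 V, so Markov's inequality applies to the supermartingale. *)
Lemma ustat_upper_tail n (u V : R) (Bad : set (n.-tuple (p.-tuple R))) :
  0 < s -> measurable Bad ->
  (forall t, ~ Bad t -> \sum_k quartic S (later k t) <= V) ->
  (forall t, ~ Bad t -> forall k, 4 * s ^+ 2 * quartic S (later k t) <= 1 / 256) ->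
  (sample_law n S [set t | (u < ustat S W t)%R] <=
   (expR (- s * u + 16 * s ^+ 2 * V))%:E + sample_law n S Bad)%E.
Proof.
move=> s0 mB hV hb; pose a := expR (s * u - 16 * s ^+ 2 * V).
have a0 : 0 < a by exact: expR_gt0.
have := markov_real (@measurable_supermart n) (@supermart_ge0 n) a0 (@supermart_le1 n).
set A := [set t | _] => hA.
have mA : measurable A by rewrite -[X in measurable X]setTI; apply: measurable_fun_le => //; exact: measurable_supermart.
have mU : measurable [set t : n.-tuple (p.-tuple R) | (u < ustat S W t)%R].
  exact: (measurable_set_ltr (measurable_cst u) (@measurable_ustat _ _ S W n)).
have sub : [set t | (u < ustat S W t)%R] `<=` A `|` Bad.
  move=> t /= ut; have [?|nB] := pselect (Bad t); [by right|left].
  rewrite /A /= /supermart [X in _ * X]big1 ?mulr1; last by move=> k _; rewrite /small (hb _ nB k).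
  rewrite /a ler_expR; have := hV _ nB; set X := \sum_k _ => hX.
  have := sqr_ge0 s; have : s * u <= s * ustat S W t by rewrite ler_pM2l// ltW.
  by nra.
apply: le_trans (le_measure _ _ _ sub) _; rewrite ?inE//; first exact: measurableU.
apply: le_trans (measureU2 _ mA mB) _; apply: leeD2r; apply: le_trans hA _.
by rewrite lee_fin div1r /a -expRN ler_expR; lra.
Qed.

End supermartingale.

(** * The conditional variances under the null *)

Section null_hypothesis.
Context {R : realType} (p : nat).
Notation Id := (1%:M : 'M[R]_p).

Lemma psd_id : psd Id.
Proof.
split; first exact: trmx1.
move=> x; rewrite mulmx1 mxE; apply: sumr_ge0 => i _.
by rewrite mxE -expr2 sqr_ge0.
Qed.

Lemma quartic_id (N : 'M[R]_p) : quartic Id N = frob2 N.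
Proof.
apply: eq_bigr => i _; apply: eq_bigr => j _.
rewrite (bigD1 i)//= (bigD1 j)//= !mxE !eqxx !mulr1 big1; last first.
  by move=> l lj; rewrite !mxE (eq_sym j) (negbTE lj) !mulr0.
rewrite addr0 big1 ?addr0 ?expr2// => k ki; rewrite big1// => l _.
by rewrite !mxE (eq_sym i) (negbTE ki) mul0r mulr0.
Qed.

Lemma diag_id i : Id i i = 1. Proof. by rewrite mxE eqxx. Qed.

Lemma id_sq_le1 i j : Id i j ^+ 2 <= 1.
Proof. by rewrite mxE; case: (_ == _); rewrite ?expr1n ?expr0n. Qed.

Lemma decay_id : \sum_i \sum_j Id i j ^+ 2 * dist i j ^+ 2 <= 2 * p%:R.
Proof.
rewrite big1 ?mulr_ge0// => i _; rewrite big1// => j _; rewrite mxE.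
have [->|_] := eqVneq; first by rewrite dist_self expr0n mulr0.
by rewrite expr0n mul0r.
Qed.

(** Square root of the bound 64^4 * 4 on the eighth moment of a coordinate. *)
Definition c8 : R := 64 ^+ 2 * 2.

Lemma gaussian_eighth_moment (i : 'I_p) :
  (\int[gaussian_law Id]_x (tnth x i ^+ 8)%:E <= (c8 ^+ 2)%:E)%E.
Proof.
(* The scale 1/16 is the largest that the exponential moment bound admits. With y = x^2 / 64 the
   inequality y^4 <= exp(4 y) reads x^8 <= 64^4 exp(x^2 / 16). *)
pose N : 'M[R]_p := (1 / 16) *: delta_mx i i.
have NE k l : N k l = 1 / 16 * ((k == i) && (l == i))%:R by rewrite !mxE.
have sumN (F : 'I_p -> 'I_p -> R) : (forall k l, k != i -> F k l = 0) ->
    (forall k l, l != i -> F k l = 0) -> \sum_k \sum_l F k l = F i i.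
  move=> h1 h2; rewrite (bigD1 i)//= (bigD1 i)//= big1; last by move=> l; exact: h2.
  by rewrite addr0 big1 ?addr0// => k ki; rewrite big1// => l _; exact: h1.
have qN (x : 'I_p -> R) : qform N x = x i ^+ 2 / 16.
  rewrite /qform sumN.
  - by rewrite NE eqxx mulr1; field.
  - by move=> k l ki; rewrite NE (negbTE ki) mulr0 mul0r.
  - by move=> k l ki; rewrite NE (negbTE ki) andbF mulr0 mul0r.
have fN : quartic Id N = 1 / 256.
  rewrite quartic_id /frob2 sumN.
  - by rewrite NE eqxx mulr1; field.
  - by move=> k l ki; rewrite NE (negbTE ki) mulr0 expr0n.
  - by move=> k l ki; rewrite NE (negbTE ki) andbF mulr0 expr0n.
have tN : cov_trace Id N = 1 / 16.
  rewrite /cov_trace sumN.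
  - by rewrite NE !mxE eqxx !mulr1.
  - by move=> k l ki; rewrite NE (negbTE ki) mulr0 mul0r.
  - by move=> k l ki; rewrite NE (negbTE ki) andbF mulr0 mul0r.
have mx : measurable_fun setT (fun x : p.-tuple R => tnth x i) by exact: measurable_tnth.
have me : measurable_fun setT (fun x : p.-tuple R => expR (qform N (tnth x))).
  by apply: measurableT_comp => //; exact: measurable_qform_tnth.
apply: (@le_trans _ _ (\int[gaussian_law Id]_x (64 ^+ 4 * expR (qform N (tnth x)))%:E)%E).
  apply: integral_le_mono.
  - exact: measurable_funX.
  - exact: measurable_funM.
  - by move=> x; rewrite (_ : 8 = 4 * 2)%N// exprM sqr_ge0.
  - move=> x; rewrite qN (_ : tnth x i ^+ 2 / 16 = 4%:R * (tnth x i ^+ 2 / 64)); last by field.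
    rewrite expRM_natl (_ : tnth x i ^+ 8 = 64 ^+ 4 * (tnth x i ^+ 2 / 64) ^+ 4); last by field.
    apply: ler_wpM2l; first by rewrite exprn_ge0.
    have h : 0 <= tnth x i ^+ 2 / 64 by rewrite divr_ge0 ?sqr_ge0.
    rewrite ler_pXn2r// ?nnegrE ?expR_ge0//.
    by apply: le_trans (expR_ge1Dx _); rewrite lerDr.
rewrite integral_EFinZl; [|exact: me|by move=> x; exact: expR_ge0|by rewrite exprn_ge0].
rewrite (_ : c8 ^+ 2 = 64 ^+ 4 * 4); last by rewrite /c8; ring.
rewrite [leRHS]EFinM; apply: lee_wpmul2l; first by rewrite lee_fin exprn_ge0.
have hN : quartic Id N <= 1 / 256 by rewrite fN.
apply: le_trans (gaussian_qform_mgf psd_id hN) _.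
rewrite fN tN lee_fin.
have := expR_ge1Dx (- (1 / 16 + 4 * (1 / 256)) : R); rewrite expRN.
set e := expR _ => h; have e0 : 0 < e by exact: expR_gt0.
have h2 : 1 / 2 <= e^-1 by apply: le_trans h; lra.
have : e * (1 / 2) <= 1 by rewrite -[leRHS](mulfV (lt0r_neq0 e0)) ler_pM2l.
by lra.
Qed.

Variables (W : 'M[R]_p) (wb T kap : R).
Hypothesis symW : forall i j, W i j = W j i.
Hypothesis W_ge0 : forall i j, 0 <= W i j.
Hypothesis W_le : forall i j, W i j <= wb * (dist i j <= T)%R%:R.
Hypothesis W_diag : forall i, W i i = 0.
Hypothesis T_ge1 : 1 <= T.
Hypothesis wb_ge0 : 0 <= wb.
Hypothesis wbT : wb ^+ 2 * T <= kap.
Hypothesis kap_gt0 : 0 < kap.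
Hypothesis p_gt0 : (0 < p)%N.

Definition sqw : 'M[R]_p := \matrix_(i, j) (W i j ^+ 2).

Lemma sqw_le i j : sqw i j <= wb ^+ 2 * (dist i j <= T)%R%:R.
Proof.
rewrite mxE; have := W_le i j; have := W_ge0 i j.
by case: (_ <= T)%R; rewrite ?mulr1 ?mulr0 => ? ?; nra.
Qed.

Lemma sqw_ge0 i j : 0 <= sqw i j.
Proof. by rewrite mxE sqr_ge0. Qed.

(** The squared weights satisfy the band condition with [wb ^+ 2] for [wb], and wb^4 T <= kap wb^2:
    the gain of wb^2 is what makes the off-diagonal part of the conditional variances small. *)
Lemma Gam_sqw : Gam Id sqw <= 42 * (kap * wb ^+ 2) * p%:R.
Proof.
apply: (Gam_le diag_id id_sq_le1 decay_id sqw_ge0 sqw_le T_ge1 (sqr_ge0 wb)).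
by rewrite -exprM mulrC (_ : 2 * 2 = 2 + 2)%N// exprD mulrA ler_wpM2r ?sqr_ge0// mulrC.
Qed.

Lemma sqw_row i : \sum_j sqw i j <= 3 * kap.
Proof.
have T0 : 0 <= T by move: T_ge1; lra.
apply: (@le_trans _ _ (wb ^+ 2 * (2 * T + 1))).
  apply: (@le_trans _ _ (\sum_j wb ^+ 2 * (dist i j <= T)%R%:R)).
    by apply: ler_sum => j _; exact: sqw_le.
  rewrite -mulr_sumr; apply: ler_wpM2l; first exact: sqr_ge0.
  exact: count_dist_le.
have := sqr_ge0 wb; move: wbT T_ge1; set w := wb ^+ 2 => h1 h2 h3.
by nra.
Qed.

Definition qdiag (x : p.-tuple R) : R := kernel0 Id sqw x x.

Lemma measurable_qdiag : measurable_fun setT qdiag.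
Proof. by apply: measurable_kernel0. Qed.

Lemma qdiag_ge0 x : 0 <= qdiag x.
Proof.
do 2 (apply: sumr_ge0 => ? _).
by rewrite mulr_ge0 ?sqw_ge0// -expr2 sqr_ge0.
Qed.

(** By 2 a^2 b^2 <= a^4 + b^4 and the row sums of the squared weights, [qdiag] is at most 3 [kap]
    times the sum of fourth powers; Cauchy-Schwarz then brings in the eighth powers. *)
Lemma qdiag_sq_le x : qdiag x ^+ 2 <= 9 * kap ^+ 2 * p%:R * \sum_i tnth x i ^+ 8.
Proof.
have h : qdiag x <= 3 * kap * \sum_i tnth x i ^+ 4.
  apply: (@le_trans _ _ (\sum_i \sum_j (sqw i j * (tnth x i ^+ 4 / 2) + sqw i j * (tnth x j ^+ 4 / 2)))).
    apply: ler_sum => i _; apply: ler_sum => j _; rewrite -mulrDr.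
    have [<-|ij] := eqVneq i j; first by rewrite mxE W_diag expr0n !mul0r.
    apply: ler_wpM2l; first exact: sqw_ge0.
    rewrite /cross mxE (negbTE ij) subr0.
    set a := tnth x i; set b := tnth x j; have := sqr_ge0 (a ^+ 2 - b ^+ 2).
    by rewrite (_ : (_ - _) ^+ 2 = a ^+ 4 + b ^+ 4 - 2 * (a * b * (a * b))); [lra|ring].
  under eq_bigr do rewrite big_split/=.
  rewrite big_split/= [X in _ + X]exchange_big/= -big_split/= mulr_sumr.
  apply: ler_sum => i _; rewrite -!mulr_suml.
  have -> : \sum_j sqw j i = \sum_j sqw i j by apply: eq_bigr => j _; rewrite !mxE symW.
  have := sqw_row i; set s := \sum_j _; have : 0 <= tnth x i ^+ 4 by rewrite (_ : 4 = 2 * 2)%N// exprM sqr_ge0.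
  set y := tnth x i ^+ 4 => y0 hs.
  rewrite (_ : s * (y / 2) + s * (y / 2) = s * y); last by field.
  exact: ler_wpM2r.
have h0 : 0 <= \sum_i tnth x i ^+ 4.
  by apply: sumr_ge0 => i _; rewrite (_ : 4 = 2 * 2)%N// exprM sqr_ge0.
apply: (@le_trans _ _ ((3 * kap * \sum_i tnth x i ^+ 4) ^+ 2)).
  by rewrite ler_pXn2r// nnegrE ?qdiag_ge0// !mulr_ge0// ltW.
rewrite exprMn (_ : (3 * kap) ^+ 2 = 9 * kap ^+ 2); last by ring.
rewrite -mulrA; apply: ler_wpM2l; first by rewrite mulr_ge0 ?sqr_ge0.
have := cauchy_schwarz_sum (fun _ : 'I_p => 1) (fun i => tnth x i ^+ 4).
under eq_bigr do rewrite mul1r; under [X in _ -> _ <= _ * X]eq_bigr do rewrite (_ : 8 = 4 * 2)%N// exprM.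
by rewrite expr1n sumr_const card_ord.
Qed.

(** Bounds the root mean square of [qdiag], hence also its mean. *)
Definition qmax : R := 3 * kap * p%:R * c8.

Lemma qmax_gt0 : 0 < qmax.
Proof. by rewrite /qmax /c8 !mulr_gt0// ?exprn_gt0// ltr0n. Qed.

Lemma integral_qdiag_sq : (\int[gaussian_law Id]_x (qdiag x ^+ 2)%:E <= (qmax ^+ 2)%:E)%E.
Proof.
have m8 (i : 'I_p) : measurable_fun setT (fun x : p.-tuple R => tnth x i ^+ 8).
  by apply: measurable_funX; exact: measurable_tnth.
have p8 (i : 'I_p) (x : p.-tuple R) : 0 <= tnth x i ^+ 8.
  by rewrite (_ : 8 = 4 * 2)%N// exprM sqr_ge0.
have mS : measurable_fun setT (fun x : p.-tuple R => \sum_i tnth x i ^+ 8).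
  exact: measurable_sum.
apply: (@le_trans _ _ (\int[gaussian_law Id]_x (9 * kap ^+ 2 * p%:R * \sum_i tnth x i ^+ 8)%:E)%E).
  apply: integral_le_mono.
  - by apply: measurable_funX; exact: measurable_qdiag.
  - exact: measurable_funM.
  - by move=> x; exact: sqr_ge0.
  - exact: qdiag_sq_le.
have c0 : 0 <= 9 * kap ^+ 2 * p%:R by apply: mulr_ge0 => //; rewrite mulr_ge0 ?sqr_ge0.
rewrite integral_EFinZl; [|exact: mS|by move=> x; apply: sumr_ge0 => i _; exact: p8|exact: c0].
rewrite (_ : qmax ^+ 2 = 9 * kap ^+ 2 * p%:R * \sum_(i < p) c8 ^+ 2); last first.
  by rewrite sumr_const card_ord -mulr_natl /qmax; ring.
rewrite [leRHS]EFinM; apply: lee_wpmul2l; first by rewrite lee_fin.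
apply: integral_sum_le => [i|i x|i]; [exact: m8|exact: p8|exact: gaussian_eighth_moment].
Qed.

Lemma integrable_qdiag : (gaussian_law Id).-integrable setT (EFin \o qdiag).
Proof.
apply/integrableP; split; first by apply/measurable_EFinP; exact: measurable_qdiag.
change (\int[gaussian_law Id]_x (`|qdiag x|)%:E < +oo)%E.
apply: (@le_lt_trans _ _ (\int[gaussian_law Id]_x (qdiag x ^+ 2 + 1)%:E)%E).
  apply: integral_le_mono.
  - by apply: measurableT_comp => //; exact: measurable_qdiag.
  - by apply: measurable_funD => //; apply: measurable_funX; exact: measurable_qdiag.
  - by move=> x; exact: normr_ge0.
  - by move=> x; rewrite ger0_norm ?qdiag_ge0//; have := sqr_ge0 (qdiag x - 1); have := qdiag_ge0 x; nra.
rewrite integral_EFinD_cst//; [|by apply: measurable_funX; exact: measurable_qdiag|by move=> x; exact: sqr_ge0].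
by apply: (@le_lt_trans _ _ ((qmax ^+ 2)%:E + 1%:E)%E); [apply: leeD2r; exact: integral_qdiag_sq|rewrite -EFinD ltry].
Qed.

Definition qmean : R := fine (\int[gaussian_law Id]_x (qdiag x)%:E)%E.

Lemma qmeanE : (\int[gaussian_law Id]_x (qdiag x)%:E = qmean%:E)%E.
Proof. by rewrite fineK//; exact: integrable_fin_num integrable_qdiag. Qed.

(** The upper bound integrates x <= x^2 / (2 q) + q / 2 at q = [qmax]. *)
Lemma qmean_le : 0 <= qmean <= qmax.
Proof.
apply/andP; split.
  by rewrite -lee_fin -qmeanE; apply: integral_ge0 => x _; rewrite lee_fin qdiag_ge0.
have q0 := qmax_gt0.
rewrite -lee_fin -qmeanE; apply: (@le_trans _ _ (\int[gaussian_law Id]_x ((2 * qmax)^-1 * qdiag x ^+ 2 + qmax / 2)%:E)%E).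
  apply: integral_le_mono.
  - exact: measurable_qdiag.
  - by apply: measurable_funD => //; apply: measurable_funM => //; apply: measurable_funX; exact: measurable_qdiag.
  - exact: qdiag_ge0.
  - move=> x; rewrite -subr_ge0 [X in _ <= X](_ : _ = (2 * qmax)^-1 * (qdiag x - qmax) ^+ 2); last first.
      by field; rewrite gt_eqF.
    by rewrite mulr_ge0 ?sqr_ge0// invr_ge0 mulr_ge0// ltW.
have i0 : 0 <= (2 * qmax)^-1 by rewrite invr_ge0 mulr_ge0// ltW.
have mq2 : measurable_fun setT (fun x => qdiag x ^+ 2) by apply: measurable_funX; exact: measurable_qdiag.
rewrite integral_EFinD_cst; [|exact: measurable_funM|by move=> x; rewrite mulr_ge0 ?sqr_ge0|by rewrite divr_ge0// ltW].
rewrite integral_EFinZl//; last by move=> x; exact: sqr_ge0.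
apply: (@le_trans _ _ ((2 * qmax)^-1%:E * (qmax ^+ 2)%:E + (qmax / 2)%:E)%E).
  by apply: leeD2r; apply: lee_wpmul2l; [rewrite lee_fin|exact: integral_qdiag_sq].
rewrite -EFinM -EFinD lee_fin le_eqVlt; apply/orP; left; apply/eqP.
by field; rewrite gt_eqF.
Qed.

Lemma qdiag_centered c :
  (\int[gaussian_law Id]_x ((qdiag x - qmean + c) ^+ 2)%:E <= (4 * qmax ^+ 2 + c ^+ 2)%:E)%E.
Proof.
have mq : measurable_fun setT (fun x => qdiag x - qmean).
  by apply: measurable_funB => //; exact: measurable_qdiag.
have mq2 : measurable_fun setT (fun x => qdiag x ^+ 2) by apply: measurable_funX; exact: measurable_qdiag.
apply: centered_sq_le => //.
  under eq_integral do rewrite EFinB.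
  rewrite integralB//; [|exact: integrable_qdiag|exact: finite_measure_integrable_cst].
  by rewrite qmeanE integral_cst//= [X in (_ - _ * X)%E]probability_setT mule1 -EFinB subrr.
have /andP[q0 q1] := qmean_le.
apply: (@le_trans _ _ (\int[gaussian_law Id]_x (2 * qdiag x ^+ 2 + 2 * qmax ^+ 2)%:E)%E).
  apply: integral_le_mono.
  - exact: measurable_funX.
  - by apply: measurable_funD => //; exact: measurable_funM.
  - by move=> x; exact: sqr_ge0.
  - by move=> x; have := sqr_ge0 (qdiag x + qmean); nra.
rewrite integral_EFinD_cst; [|exact: measurable_funM|by move=> x; rewrite mulr_ge0 ?sqr_ge0|by rewrite mulr_ge0 ?sqr_ge0].
rewrite integral_EFinZl//; last by move=> x; exact: sqr_ge0.
rewrite (_ : 4 * qmax ^+ 2 = 2 * qmax ^+ 2 + 2 * qmax ^+ 2); last by ring.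
rewrite [leRHS]EFinD; apply: leeD2r; rewrite [leRHS]EFinM; apply: lee_wpmul2l => //.
exact: integral_qdiag_sq.
Qed.

Definition asum n (t : n.-tuple (p.-tuple R)) : R := \sum_(l < n) qdiag (tnth t l).

Lemma measurable_asum n : measurable_fun setT (@asum n).
Proof. exact: (measurable_sum_tnth measurable_qdiag). Qed.

(** The mean is at most n [qmax], so this is a deviation by at least n [qmax], against a variance of
    at most 4 n [qmax]^2. *)
Lemma asum_upper_tail n : (0 < n)%N ->
  (sample_law n Id [set t | (2 * n%:R * qmax <= asum t)%R] <= (4 / n%:R)%:E)%E.
Proof.
move=> n0; have q0 := qmax_gt0; have /andP[m0 m1] := qmean_le.
have N0 : 0 < n%:R :> R by rewrite ltr0n.
have mq : measurable_fun setT (fun x => qdiag x - qmean).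
  by apply: measurable_funB => //; exact: measurable_qdiag.
pose f (t : n.-tuple (p.-tuple R)) : R := \sum_(k < n) (qdiag (tnth t k) - qmean).
have mf : measurable_fun setT f by exact: (measurable_sum_tnth mq).
have fE t : f t = asum t - n%:R * qmean.
  by rewrite /f /asum sumrB sumr_const card_ord mulr_natl.
have If : (\int[sample_law n Id]_t (f t ^+ 2)%:E <= (n%:R * (4 * qmax ^+ 2))%:E)%E.
  have := @sq_sum_iid_le _ _ _ (gaussian_law Id) n _ (4 * qmax ^+ 2) 0 mq qdiag_centered.
  rewrite expr0n addr0; apply: le_trans.
  by under eq_integral do rewrite -[f _]addr0.
have a0 : 0 < (n%:R * qmax) ^+ 2 by rewrite exprn_gt0// mulr_gt0.
have := markov_real (measurable_funX 2 mf) (fun t => sqr_ge0 _) a0 If.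
rewrite (_ : n%:R * (4 * qmax ^+ 2) / (n%:R * qmax) ^+ 2 = 4 / n%:R); last first.
  by field; rewrite !gt_eqF.
apply: le_trans; apply: le_measure; rewrite ?inE.
- by rewrite -[X in measurable X]setTI; apply: measurable_fun_le => //; exact: measurable_asum.
- by rewrite -[X in measurable X]setTI; apply: measurable_fun_le => //; exact: measurable_funX.
- move=> t /= h; rewrite fE !expr2.
  have h0 : 0 <= n%:R * qmax by rewrite mulr_ge0// ltW.
  by apply: ler_pM => //; have := ler_wpM2l (ltW N0) m1; lra.
Qed.

Definition later_ustat n (k : 'I_n) (t : n.-tuple (p.-tuple R)) : R :=
  \sum_(l < n | (k < l)%N) \sum_(l' < n | (k < l')%N && (l != l'))
    kernel0 Id sqw (tnth t l) (tnth t l').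

Lemma later_ustat_cons0 n x (t : n.-tuple (p.-tuple R)) :
  later_ustat ord0 [tuple of x :: t] = ustat Id sqw t.
Proof.
rewrite /later_ustat big_mkcond big_ord_recl/= add0r; apply: eq_bigr => l _.
rewrite big_mkcond big_ord_recl/= add0r [RHS]big_mkcond; apply: eq_bigr => l' _.
by rewrite (inj_eq lift_inj) !tnthS.
Qed.

Lemma later_ustat_consS n (k : 'I_n) x (t : n.-tuple (p.-tuple R)) :
  later_ustat (lift ord0 k) [tuple of x :: t] = later_ustat k t.
Proof.
rewrite /later_ustat big_mkcond big_ord_recl/= add0r [RHS]big_mkcond; apply: eq_bigr => l _.
rewrite !ltnS; case: (k < l)%N => //.
rewrite big_mkcond big_ord_recl/= add0r [RHS]big_mkcond; apply: eq_bigr => l' _.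
by rewrite !ltnS (inj_eq lift_inj) !tnthS.
Qed.

(** At the identity, [quartic] is the squared Frobenius norm. Expanding the square of each entry
    gives a double sum over later observations with kernel [kernel0 Id sqw]; its diagonal is the sum
    of [qdiag]. *)
Lemma quartic_later n (k : 'I_n) (t : n.-tuple (p.-tuple R)) :
  quartic Id (later Id W k t) = \sum_(l < n | (k < l)%N) qdiag (tnth t l) + later_ustat k t.
Proof.
rewrite quartic_id -big_split/=.
transitivity (\sum_(l < n | (k < l)%N) \sum_(l' < n | (k < l')%N)
   kernel0 Id sqw (tnth t l) (tnth t l')).
  rewrite /kernel0; under [RHS]eq_bigr do rewrite exchange_big/=.
  rewrite [RHS]exchange_big/=; apply: eq_bigr => i _.
  under [RHS]eq_bigr do rewrite exchange_big/=.
  rewrite [RHS]exchange_big/=; apply: eq_bigr => j _.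
  rewrite mxE exprMn expr2 [in X in _ * X]expr2 big_distrlr/= mulr_sumr; apply: eq_bigr => l _.
  by rewrite mulr_sumr; apply: eq_bigr => l' _; rewrite mxE expr2.
apply: eq_bigr => l kl; rewrite (bigD1 l)//=; congr (_ + _).
by apply: eq_bigl => l'; rewrite eq_sym.
Qed.

(** A bound on this sum of squares controls both the largest off-diagonal part over k and, by
    Cauchy-Schwarz, their sum. *)
Definition osum n (t : n.-tuple (p.-tuple R)) : R := \sum_(k < n) later_ustat k t ^+ 2.

Lemma measurable_later_ustat n (k : 'I_n) : measurable_fun setT (@later_ustat n k).
Proof.
rewrite /later_ustat; under eq_fun do rewrite big_mkcond; apply: measurable_sum => l.
case: (k < l)%N => //; under eq_fun do rewrite big_mkcond; apply: measurable_sum => l'.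
by case: (_ && _) => //; apply: measurable_kernel0; exact: measurable_tnth.
Qed.

Lemma measurable_osum n : measurable_fun setT (@osum n).
Proof.
by apply: measurable_sum => k; apply: measurable_funX; exact: measurable_later_ustat.
Qed.

Lemma osum_ge0 n (t : n.-tuple (p.-tuple R)) : 0 <= osum t.
Proof. by apply: sumr_ge0 => k _; exact: sqr_ge0. Qed.

Lemma integral_osum n : (\int[sample_law n Id]_t (@osum n t)%:E <=
  (528 * 66 * n%:R ^+ 3 * Gam Id sqw)%:E)%E.
Proof.
have G0 := Gam_ge0 psd_id sqw.
rewrite /sample_law; elim: n => [|n IH].
  apply: integral_le_cst => [|t|t]; [exact: measurable_osum|exact: osum_ge0|].
  by rewrite /osum big_ord0 expr0n mulr0 mul0r.
have mU : measurable_fun setT (fun t : n.-tuple (p.-tuple R) => ustat Id sqw t ^+ 2).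
  by apply: measurable_funX; exact: measurable_ustat.
apply: (@integral_iid_cons_le _ _ _ (gaussian_law Id) n (@osum n.+1)
  (fun t => ustat Id sqw t ^+ 2 + osum t)).
- exact: measurable_osum.
- exact: osum_ge0.
- by apply: measurable_funD => //; exact: measurable_osum.
- move=> t; apply: integral_le_cst.
  + by apply: measurable_cons_fst; exact: measurable_osum.
  + by move=> x; exact: osum_ge0.
  + move=> x; rewrite /osum big_ord_recl later_ustat_cons0 lerD2l.
    by apply: ler_sum => k _; rewrite later_ustat_consS.
- rewrite integral_EFinD; [|exact: mU|exact: measurable_osum|by move=> t; exact: sqr_ge0|exact: osum_ge0].
  have := ustat_sq psd_id sqw n 0; rewrite expr0n addr0.
  under eq_integral do rewrite addr0.
  rewrite /sample_law => hU; apply: le_trans (leeD hU IH) _.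
  rewrite -EFinD lee_fin -mulrDl; apply: ler_wpM2r => //.
  rewrite -mulrDr; apply: ler_wpM2l; first exact: (mulr_ge0 (ler0n _ _) (ler0n _ _)).
  rewrite -nat1r; have : 0 <= n%:R :> R by [].
  by set m := n%:R; nra.
Qed.

Definition cO : R := 528 * 66 * 42.

Lemma cO_ge0 : 0 <= cO.
Proof. exact: (mulr_ge0 (mulr_ge0 (ler0n _ _) (ler0n _ _)) (ler0n _ _)). Qed.

Lemma osum_upper_tail n : (0 < n)%N ->
  (sample_law n Id [set t | (n%:R ^+ 3 * p%:R ^+ 2 <= osum t)%R] <= (cO * kap * wb ^+ 2)%:E)%E.
Proof.
move=> n0; have N0 : 0 < n%:R :> R by rewrite ltr0n.
have P0 : 0 < p%:R :> R by rewrite ltr0n.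
have a0 : 0 < n%:R ^+ 3 * p%:R ^+ 2 :> R by rewrite mulr_gt0// exprn_gt0.
apply: le_trans (markov_real (@measurable_osum n) (@osum_ge0 n) a0 (integral_osum n)) _.
rewrite lee_fin ler_pdivrMr//.
have K0 : 0 <= 528 * 66 :> R by exact: (mulr_ge0 (ler0n _ _) (ler0n _ _)).
rewrite /cO; move: (528 * 66 : R) K0 => K K0.
apply: (@le_trans _ _ (K * n%:R ^+ 3 * (42 * (kap * wb ^+ 2) * p%:R))).
  by apply: ler_wpM2l Gam_sqw; apply: mulr_ge0 => //; rewrite exprn_ge0 ?ltW.
rewrite -subr_ge0 [X in _ <= X](_ : _ = K * 42 * kap * wb ^+ 2 * n%:R ^+ 3 * p%:R * (p%:R - 1)); last first.
  by ring.
apply: mulr_ge0; last by rewrite subr_ge0 ler1n.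
apply: mulr_ge0; last exact: ltW.
apply: mulr_ge0; last by rewrite exprn_ge0 ?ltW.
apply: mulr_ge0; last exact: sqr_ge0.
by apply: mulr_ge0; [exact: mulr_ge0|exact: ltW].
Qed.

Definition K1 : R := 6 * kap * c8.

(** The exponential parameter is s = rh / (n sqrt p). Off the bad event the conditional variances
    are at most K1 n p + n^(3/2) p each, and V = (K1 + 1) n^2 p in total, so s^2 V = rh^2 (K1 + 1).
    The assumption on [rh] makes each of them admissible: 4 rh^2 (K1 + 1) / sqrt n <= 1/256, where
    1024 = 4 * 256. *)
Lemma null_upper_tail n (rh u : R) : (0 < n)%N -> 0 < rh ->
  1024 * rh ^+ 2 * (K1 + 1) <= Num.sqrt n%:R ->
  (sample_law n Id [set t | (u < ustat Id W t)%R] <=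
   (expR (- (rh * u / (n%:R * Num.sqrt p%:R)) + 16 * rh ^+ 2 * (K1 + 1))
     + 4 / n%:R + cO * kap * wb ^+ 2)%:E)%E.
Proof.
move=> n0 rh0 hrh.
have [N1 P1] : 1 <= n%:R :> R /\ 1 <= p%:R :> R by rewrite !ler1n.
set N : R := n%:R in N1 hrh *; set P : R := p%:R in P1 *.
pose r := Num.sqrt N; pose z := Num.sqrt P.
have r2 : r ^+ 2 = N by rewrite sqr_sqrtr//; lra.
have z2 : z ^+ 2 = P by rewrite sqr_sqrtr//; lra.
have r1 : 1 <= r by rewrite /r -[leLHS]sqrtr1 ler_wsqrtr.
have z1 : 1 <= z by rewrite /z -[leLHS]sqrtr1 ler_wsqrtr.
have k1 : 0 <= K1 by rewrite /K1 /c8 !mulr_ge0 ?exprn_ge0// ltW.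
pose s := rh / (N * z).
have Nz0 : 0 < N * z by rewrite mulr_gt0//; lra.
have s0 : 0 < s by exact: divr_gt0.
have s2 : s ^+ 2 * (N ^+ 2 * P) = rh ^+ 2.
  by rewrite /s -z2; field; rewrite !gt_eqF//; lra.
pose V := (K1 + 1) * (N ^+ 2 * P).
pose Bad := [set t : n.-tuple (p.-tuple R) | (2 * n%:R * qmax <= asum t)%R] `|`
   [set t | (n%:R ^+ 3 * p%:R ^+ 2 <= osum t)%R].
have mB1 : measurable [set t : n.-tuple (p.-tuple R) | (2 * n%:R * qmax <= asum t)%R].
  by rewrite -[X in measurable X]setTI; apply: measurable_fun_le => //; exact: measurable_asum.
have mB2 : measurable [set t : n.-tuple (p.-tuple R) | (n%:R ^+ 3 * p%:R ^+ 2 <= osum t)%R].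
  by rewrite -[X in measurable X]setTI; apply: measurable_fun_le => //; exact: measurable_osum.
have later_le (t : n.-tuple (p.-tuple R)) (k : 'I_n) : 2 * N * qmax >= asum t -> quartic Id (later Id W k t) <= K1 * (N * P) + `|later_ustat k t|.
  move=> ha; rewrite quartic_later; apply: lerD (ler_norm _).
  apply: (@le_trans _ _ (asum t)).
    by rewrite /asum [leRHS](bigID (fun l : 'I_n => (k < l)%N))/= lerDl sumr_ge0// => l _; exact: qdiag_ge0.
  by apply: le_trans ha _; rewrite /qmax /K1 -/P; rewrite le_eqVlt; apply/orP; left; apply/eqP; ring.
have o_le (t : n.-tuple (p.-tuple R)) : osum t <= N ^+ 3 * P ^+ 2 -> forall k : 'I_n, `|later_ustat k t| <= N * r * P.
  move=> ho k; rewrite -(@ler_pXn2r _ 2)// ?nnegrE//; last by rewrite !mulr_ge0//; lra.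
  rewrite real_normK ?num_real// (_ : (N * r * P) ^+ 2 = N ^+ 3 * P ^+ 2); last by rewrite -r2; ring.
  apply: le_trans ho; rewrite /osum (bigD1 k)//= lerDl.
  by apply: sumr_ge0 => l _; exact: sqr_ge0.
have osum_le (t : n.-tuple (p.-tuple R)) : osum t <= N ^+ 3 * P ^+ 2 -> \sum_(k < n) `|later_ustat k t| <= N ^+ 2 * P.
  move=> ho; rewrite -(@ler_pXn2r _ 2)// ?nnegrE ?sumr_ge0//; last by rewrite !mulr_ge0//; lra.
  have := cauchy_schwarz_sum (fun _ : 'I_n => 1) (fun k => `|later_ustat k t|).
  under eq_bigr do rewrite mul1r; move/le_trans; apply.
  rewrite expr1n sumr_const card_ord -/N.
  under eq_bigr do rewrite real_normK ?num_real//.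
  rewrite -/(osum t) (_ : (N ^+ 2 * P) ^+ 2 = N * (N ^+ 3 * P ^+ 2)); last by ring.
  by apply: ler_wpM2l => //; lra.
have hV t : ~ Bad t -> \sum_k quartic Id (later Id W k t) <= V.
  move=> /not_orP[/negP]; rewrite -ltNge => /ltW ha /negP; rewrite -ltNge => /ltW ho.
  apply: (@le_trans _ _ (\sum_(k < n) (K1 * (N * P) + `|later_ustat k t|))).
    by apply: ler_sum => k _; exact: later_le.
  rewrite big_split/= sumr_const card_ord -mulr_natl -/N.
  by have := osum_le t ho; rewrite /V; lra.
have hb t : ~ Bad t -> forall k, 4 * s ^+ 2 * quartic Id (later Id W k t) <= 1 / 256.
  move=> /not_orP[/negP]; rewrite -ltNge => /ltW ha /negP; rewrite -ltNge => /ltW ho k.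
  apply: (@le_trans _ _ (4 * s ^+ 2 * (K1 * (N * P) + N * r * P))).
    apply: ler_wpM2l; first by rewrite mulr_ge0 ?sqr_ge0.
    by apply: le_trans (later_le t k ha) _; rewrite lerD2l; exact: o_le.
  apply: (@le_trans _ _ (4 * s ^+ 2 * ((K1 + 1) * (N * P * r)))).
    apply: ler_wpM2l; first by rewrite mulr_ge0 ?sqr_ge0.
    have NP0 : 0 <= N * P by rewrite mulr_ge0//; lra.
    rewrite (_ : K1 * (N * P) + N * r * P = (N * P) * (K1 + r)); last by ring.
    rewrite (_ : (K1 + 1) * (N * P * r) = (N * P) * ((K1 + 1) * r)); last by ring.
    by apply: ler_wpM2l => //; nra.
  have r0 : 0 < r by lra.
  rewrite -(ler_pM2r r0) (_ : _ * r = 4 * (K1 + 1) * (s ^+ 2 * (r ^+ 2 * N * P))); last by ring.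
  by rewrite r2 -expr2 s2; move: hrh; rewrite -/r; lra.
have mBad : measurable Bad by exact: measurableU.
apply: le_trans (ustat_upper_tail psd_id u s0 mBad hV hb) _.
rewrite -addrA EFinD; apply: leeD.
  rewrite lee_fin ler_expR (_ : 16 * s ^+ 2 * V = 16 * rh ^+ 2 * (K1 + 1)); last by rewrite /V -s2; ring.
  rewrite lerD2r le_eqVlt; apply/orP; left; apply/eqP; rewrite /s -/z.
  by field; rewrite !gt_eqF//; lra.
rewrite EFinD; apply: le_trans (measureU2 _ mB1 mB2) _; apply: leeD.
  exact: asum_upper_tail.
exact: osum_upper_tail.
Qed.

End null_hypothesis.

Lemma sum_sym_diag0 (R : realType) p (f : 'I_p -> 'I_p -> R) :
  (forall i j, f i j = f j i) -> (forall i, f i i = 0) ->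
  \sum_i \sum_j f i j = 2 * \sum_(i < p) \sum_(j < p | (i < j)%N) f i j.
Proof.
move=> fC f0; have E (i : 'I_p) : \sum_j f i j = \sum_(j < p | (i < j)%N) f i j + \sum_(j < p | (j < i)%N) f i j.
  rewrite (bigID (fun j : 'I_p => (i < j)%N))/=; congr (_ + _).
  rewrite (bigD1 i) ?ltnn//= f0 add0r; apply: eq_bigl => j.
  by rewrite -leqNgt ltn_neqAle -(inj_eq val_inj) andbC.
under eq_bigr do rewrite E.
rewrite big_split/= mulr_natl mulr2n; congr (_ + _).
under eq_bigr do rewrite big_mkcond.
rewrite exchange_big/=; apply: eq_bigr => i _; rewrite [RHS]big_mkcond.
by apply: eq_bigr => j _; rewrite fC.
Qed.

(** * The optimal weights *)

Section weights.
Context {R : realType} (n p : nat) (a : R).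
Hypothesis a_gt1 : 1 < a.
Notation r := (@rate R n p).
Hypothesis r_gt0 : 0 < r.
Hypothesis r_le1 : r <= 1.

(** The common scale: [rate] = xi^(4 a + 1), [psi] = xi^(2 a), [T_] is of order xi^-2 and the
    largest weight of order xi. *)
Definition xi : R := r `^ (1 / (4 * a + 1)).
Notation g := (@C_T R a 1).

Let a0 : 0 < a. Proof. by move: a_gt1; lra. Qed.
Let aN0 : a != 0. Proof. by rewrite gt_eqF. Qed.
Let a4N0 : 4 * a + 1 != 0. Proof. by rewrite gt_eqF//; move: a_gt1; lra. Qed.

Lemma xi_gt0 : 0 < xi. Proof. exact: powR_gt0. Qed.

Lemma xi_le1 : xi <= 1.
Proof.
rewrite /xi -[leRHS](powRr0 r); apply: ger_powR; first by rewrite r_gt0.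
by rewrite divr_ge0//; move: a_gt1; lra.
Qed.

Lemma psi_xi : psi n p a = xi `^ (2 * a).
Proof. by rewrite /psi /xi -powRrM; congr (_ `^ _); field. Qed.

Lemma psi_neg : psi n p a `^ (- (1 / a)) = (xi ^+ 2)^-1.
Proof.
rewrite psi_xi -powRrM (_ : 2 * a * _ = - 2%:R); last by field.
by rewrite powRN powR_mulrn// ltW// xi_gt0.
Qed.

Lemma xi_pow : xi `^ (4 * a + 1) = r.
Proof. by rewrite /xi -powRrM mulrC mulrA mulr1 divff// powRr1// ltW. Qed.

Lemma lambda_xi : lambda_ n p a 1 = C_lambda a 1 * (r * xi).
Proof.
rewrite /lambda_; congr (_ * _); rewrite psi_xi -powRrM.
rewrite (_ : 2 * a * _ = (4 * a + 1) + 1); last by field.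
rewrite powRD; last by rewrite (gt_eqF xi_gt0) implybT.
by rewrite xi_pow powRr1// ltW// xi_gt0.
Qed.

Lemma b_rate : b_ n p a 1 = Num.sqrt (C_b a 1) * r.
Proof.
rewrite /b_; congr (_ * _); rewrite psi_xi -powRrM.
rewrite (_ : 2 * a * _ = 4 * a + 1); first exact: xi_pow.
by field.
Qed.

Lemma C_T_ge1 : 1 <= g.
Proof.
rewrite /C_T mulr1 -[leLHS](powRr0 (4 * a + 1)); apply: ler_powR; first by move: a_gt1; lra.
by rewrite divr_ge0//; move: a_gt1; lra.
Qed.

Lemma C_T_le : g <= 4 * a + 1.
Proof.
rewrite /C_T mulr1; apply: (@le_trans _ _ ((4 * a + 1) `^ 1)).
  by apply: ler_powR; [|rewrite ler_pdivrMr]; move: a_gt1; lra.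
by rewrite powRr1//; move: a_gt1; lra.
Qed.

Lemma C_lambdaE : C_lambda a 1 = (2 * a + 1) / (2 * a) / g.
Proof. by rewrite /C_lambda powRN. Qed.

Lemma C_bE : C_b a 1 = (2 * a + 1) / ((4 * a + 1) * g).
Proof.
rewrite /C_b powR1 mulr1 powRD; last by rewrite a4N0 implybT.
rewrite powRr1; last by move: a_gt1; lra.
by rewrite /C_T mulr1.
Qed.

Lemma C_lambda_ge : 1 / (4 * a + 1) <= C_lambda a 1.
Proof.
rewrite C_lambdaE; have g1 := C_T_ge1; have g0 : 0 < g by lra.
apply: (@le_trans _ _ (1 / g)).
  rewrite !div1r lef_pV2 ?posrE//; [exact: C_T_le|by move: a_gt1; lra].
apply: ler_wpM2r; first by rewrite invr_ge0 ltW.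
by rewrite ler_pdivlMr; move: a_gt1; lra.
Qed.

Lemma C_b_gt0 : 0 < C_b a 1.
Proof.
have g1 := C_T_ge1; rewrite C_bE divr_gt0 ?mulr_gt0//; move: a_gt1; lra.
Qed.

Lemma C_b_le1 : C_b a 1 <= 1.
Proof.
have g1 := C_T_ge1; rewrite C_bE ler_pdivrMr; last by rewrite mulr_gt0//; move: a_gt1; lra.
by rewrite mul1r; move: a_gt1 => h; nra.
Qed.

Definition wbar : R := lambda_ n p a 1 / b_ n p a 1.

Lemma wbarE : wbar = C_lambda a 1 * xi / Num.sqrt (C_b a 1).
Proof.
rewrite /wbar lambda_xi b_rate; have s0 : 0 < Num.sqrt (C_b a 1) by rewrite sqrtr_gt0 C_b_gt0.
by field; rewrite !gt_eqF.
Qed.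

Lemma C_lambda_gt0 : 0 < C_lambda a 1.
Proof. by apply: lt_le_trans C_lambda_ge; rewrite divr_gt0//; move: a_gt1; lra. Qed.

Lemma wbar_gt0 : 0 < wbar.
Proof.
rewrite wbarE; apply: divr_gt0; last by rewrite sqrtr_gt0 C_b_gt0.
by apply: mulr_gt0; [exact: C_lambda_gt0|exact: xi_gt0].
Qed.

(** [C_T] and [xi] cancel, leaving (2 a + 1) (4 a + 1) / (4 a^2), which decreases in a and equals
    15/4 at a = 1. This is the [kap] of the variance bounds. *)
Lemma wbar_sq : wbar ^+ 2 * (g / xi ^+ 2) <= 15 / 4.
Proof.
have g1 := C_T_ge1; have x0 := xi_gt0.
rewrite wbarE exprMn exprVn sqr_sqrtr ?(ltW C_b_gt0)// C_bE C_lambdaE.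
rewrite [leLHS](_ : _ = (2 * a + 1) * (4 * a + 1) / (4 * a ^+ 2)); last first.
  by field; rewrite aN0 a4N0 !gt_eqF//; move: a_gt1; lra.
rewrite ler_pdivrMr; last by rewrite mulr_gt0 ?exprn_gt0.
by move: a_gt1 => h; nra.
Qed.

Lemma wbar_sq_le : wbar ^+ 2 <= 15 / 4 * xi ^+ 2.
Proof.
have g1 := C_T_ge1; have x0 := xi_gt0; have := wbar_sq.
rewrite mulrA ler_pdivrMr ?exprn_gt0//; have := sqr_ge0 wbar; set w := wbar ^+ 2.
by move=> w0 h; apply: le_trans h; rewrite ler_peMr.
Qed.

Lemma T_bounds : [/\ 1 <= T_ n p a 1, T_ n p a 1 <= g / xi ^+ 2 & 1 <= 2 * xi ^+ 2 * T_ n p a 1].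
Proof.
have g1 := C_T_ge1; have x0 := xi_gt0; have x1 := xi_le1.
have x2 : 0 < xi ^+ 2 by rewrite exprn_gt0.
have x21 : xi ^+ 2 <= 1 by rewrite expr_le1// ltW.
rewrite /T_ psi_neg; set y := g / xi ^+ 2.
have y1 : 1 <= y by rewrite /y ler_pdivlMr// mul1r; lra.
have fl : (Num.floor y)%:~R <= y by exact: floor_le.
have fu : y < (Num.floor y)%:~R + 1 by rewrite -[X in _ + X]/(1%:~R) -intrD floorD1_gt.
have f1 : 1 <= (Num.floor y)%:~R :> R by rewrite -[leLHS]/(1%:~R) ler_int floor_ge_int.
split => //; rewrite mulrAC.
have y2 : y <= 2 * (Num.floor y)%:~R by lra.
apply: (@le_trans _ _ (y * xi ^+ 2)); first by rewrite /y divfK ?gt_eqF.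
by apply: ler_wpM2r => //; exact: ltW.
Qed.

(** On the diagonal [wstar] equals lambda / b, so it must be cleared: the statistic sums over i < j
    only. With zero diagonal, the full and the degenerate kernel coincide under the null. *)
Definition wmat : 'M[R]_p := \matrix_(i, j) (if i == j then 0 else wstar n a 1 i j).

Lemma wstar_sym (i j : 'I_p) : wstar n a 1 i j = wstar n a 1 j i :> R.
Proof. by rewrite /wstar dist_sym. Qed.

Lemma wmat_sym i j : wmat i j = wmat j i.
Proof. by rewrite !mxE eq_sym wstar_sym. Qed.

Lemma wmat_diag i : wmat i i = 0.
Proof. by rewrite mxE eqxx. Qed.

Lemma wmat_ge0 i j : 0 <= wmat i j.
Proof.
rewrite mxE; case: ifP => // _; rewrite /wstar mulr_ge0 ?(ltW wbar_gt0)//.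
Qed.

Lemma powR_ge1 (x e : R) : 0 <= e -> 1 <= x -> 1 <= x `^ e.
Proof. by move=> e0 x1; rewrite -[leLHS](powRr0 x); exact: ler_powR. Qed.

Lemma wmat_le i j : wmat i j <= wbar * (dist i j <= T_ n p a 1)%R%:R.
Proof.
have [T1 _ _] := T_bounds; have w0 := wbar_gt0; rewrite mxE; case: ifP => [_|_].
  by rewrite mulr_ge0// ltW.
rewrite /wstar -/wbar; apply: ler_wpM2l; first exact: ltW.
have [h|h] := leP (dist i j) (T_ n p a 1).
  by rewrite ge_max ler01 andbT gerDl oppr_le0 powR_ge0.
rewrite ge_max lexx andbT subr_le0; apply: powR_ge1; first by rewrite mulr_ge0// ltW.
by rewrite ler_pdivlMr ?mul1r ?ltW//; lra.
Qed.

(** Inside the band a smaller exponent makes the lower bound smaller, and outside it the bound is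
    nonpositive. The truncation loss can thus be charged to the smoothness a' of the alternative,
    although the test uses a >= a'. *)
Lemma wmat_ge (a' : R) i j : 0 <= a' -> a' <= a -> i != j ->
  wbar * (1 - (dist i j / T_ n p a 1) `^ (2 * a')) <= wmat i j.
Proof.
move=> a'0 a'a ij; have [T1 _ _] := T_bounds; have w0 := wbar_gt0; rewrite mxE (negbTE ij).
rewrite /wstar -/wbar; apply: ler_wpM2l; first exact: ltW.
have T0 : 0 < T_ n p a 1 by lra.
have d1 := @dist_ge1 R _ _ _ ij.
rewrite le_max; have [h|h] := leP (dist i j) (T_ n p a 1).
  apply/orP; left; rewrite lerD2l lerN2; apply: ger_powR.
    by rewrite divr_gt0 ?ler_pdivrMr ?mul1r//; lra.
  by lra.
apply/orP; right; rewrite subr_le0; apply: powR_ge1; first by rewrite mulr_ge0.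
by rewrite ler_pdivlMr ?mul1r ?ltW.
Qed.

Lemma kernel_wmat (x y : p.-tuple R) : pkernel wmat x y =
  2 * \sum_(i < p) \sum_(j < p | (i < j)%N)
    wstar n a 1 i j * tnth x i * tnth x j * tnth y i * tnth y j.
Proof.
rewrite /pkernel sum_sym_diag0.
- congr (_ * _); apply: eq_bigr => i _; apply: eq_bigr => j ij; rewrite mxE.
  by rewrite -(inj_eq val_inj) (ltn_eqF ij); ring.
- by move=> i j; rewrite wmat_sym; ring.
- by move=> i; rewrite wmat_diag mul0r.
Qed.

Lemma Dhat_fstat (X : n.-tuple (p.-tuple R)) :
  Dhat a 1 X = (n%:R * (n%:R - 1) * p%:R)^-1 / 2 * fstat wmat X.
Proof.
rewrite /Dhat /fstat -[RHS]mulrA; congr (_ * _).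
have -> : \sum_(k < n) \sum_(l < n | k != l) pkernel wmat (tnth X k) (tnth X l) =
  2 * \sum_(k < n) \sum_(l < n | k != l) \sum_(i < p) \sum_(j < p | (i < j)%N)
    wstar n a 1 i j * tnth (tnth X k) i * tnth (tnth X k) j * tnth (tnth X l) i * tnth (tnth X l) j.
  rewrite mulr_sumr; apply: eq_bigr => k _; rewrite mulr_sumr; apply: eq_bigr => l _.
  exact: kernel_wmat.
by rewrite mulrA mulVf ?mul1r.
Qed.

Lemma measurable_Dhat : measurable_fun setT (fun X : n.-tuple (p.-tuple R) => Dhat a 1 X).
Proof.
under eq_fun do rewrite Dhat_fstat.
by apply: measurable_funM => //; exact: measurable_fstat.
Qed.

Lemma ustat_id_fstat (X : n.-tuple (p.-tuple R)) : ustat 1%:M wmat X = fstat wmat X.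
Proof.
apply: eq_bigr => k _; apply: eq_bigr => l _; apply: eq_bigr => i _; apply: eq_bigr => j _.
rewrite /cross; have [<-|ij] := eqVneq i j; first by rewrite wmat_diag !mul0r.
have -> : (1%:M : 'M[R]_p) i j = 0 by rewrite mxE (negbTE ij).
by rewrite !subr0.
Qed.

End weights.

(** Used with z = sqrt p, h = [rho] and m = n times the signal: the two Chebyshev terms are then of
    order h^-2 and h^-1. *)
Lemma type2_ratio (R : realFieldType) (A1 A2 k w z h b m : R) :
  0 <= A1 -> 0 <= A2 -> 0 <= k -> 0 < z -> 1 <= h -> 0 < b -> 0 <= w -> w <= 2 ->
  b * (z * h) <= m ->
  16 * (A1 * (42 * k * z ^+ 2) / m ^+ 2 + A2 * (22 * w * z) / m) <=
  16 * (A1 * (42 * k) / b ^+ 2 + A2 * 44 / b) / h.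
Proof.
move=> A10 A20 k0 z0 h1 b0 w0 w2 hm.
have h0 : 0 < h by lra.
have q0 : 0 < b * (z * h) by apply: mulr_gt0 => //; exact: mulr_gt0.
have m0 : 0 < m by exact: lt_le_trans hm.
rewrite -[leRHS]mulrA; apply: ler_wpM2l => //; rewrite [leRHS](mulrDl (A1 * (42 * k) / b ^+ 2)); apply: lerD.
  apply: (@le_trans _ _ (A1 * (42 * k * z ^+ 2) / (b * (z * h)) ^+ 2)).
    apply: ler_wpM2l.
      apply: mulr_ge0 => //; apply: mulr_ge0; last exact: sqr_ge0.
      exact: mulr_ge0.
    rewrite lef_pV2 ?posrE ?exprn_gt0//.
    by rewrite !expr2; apply: ler_pM => //; exact: ltW.
  rewrite [leLHS](_ : _ = A1 * (42 * k) / b ^+ 2 / h * h^-1); last by field; rewrite !gt_eqF.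
  apply: ler_piMr; last by rewrite invf_le1.
  apply: divr_ge0; last exact: ltW.
  by apply: divr_ge0; [apply: mulr_ge0 => //; exact: mulr_ge0|exact: sqr_ge0].
apply: (@le_trans _ _ (A2 * (22 * 2 * z) / (b * (z * h)))).
  apply: ler_pM.
  - apply: mulr_ge0 => //; apply: mulr_ge0; last exact: ltW.
    exact: mulr_ge0.
  - by rewrite invr_ge0 ltW.
  - by apply: ler_wpM2l => //; apply: ler_wpM2r; [exact: ltW|exact: ler_wpM2l].
  - by rewrite lef_pV2 ?posrE.
by rewrite le_eqVlt; apply/orP; left; apply/eqP; field; rewrite !gt_eqF.
Qed.

(** * Error bounds of a single test *)

Section finite_sample.
Context {R : realType} (n p : nat) (al au : R).
Hypothesis al_gt1 : 1 < al.
Hypothesis al_le_au : al <= au.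
Hypothesis n_gt1 : (1 < n)%N.
Hypothesis p_gt0 : (0 < p)%N.
Notation rh := (@rho R n p).
Notation r := (@rate R n p).
Hypothesis rh_ge1 : 1 <= rh.
Hypothesis r_le1 : r <= 1.

Let N2 : 2 <= n%:R :> R. Proof. by rewrite ler_nat. Qed.
Let P1 : 1 <= p%:R :> R. Proof. by rewrite ler1n. Qed.
Let z1 : 1 <= Num.sqrt p%:R :> R.
Proof. by rewrite -[leLHS]sqrtr1 ler_wsqrtr. Qed.
Let z2 : Num.sqrt p%:R ^+ 2 = p%:R :> R.
Proof. by rewrite sqr_sqrtr. Qed.

Lemma rate_gt0 : 0 < r.
Proof. by rewrite /rate divr_gt0 ?mulr_gt0//; move: rh_ge1 N2 z1; lra. Qed.

Lemma rate_scale : n%:R * Num.sqrt p%:R * r = rh.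
Proof.
rewrite /rate mulrC divfK//.
have [h1 h2] : 0 < n%:R :> R /\ 0 < Num.sqrt p%:R :> R by move: N2 z1; lra.
by rewrite gt_eqF// mulr_gt0.
Qed.

Let kap : R := 15 / 4.

Lemma wmat_kap a : 1 < a -> wbar n p a ^+ 2 * T_ n p a 1 <= kap.
Proof.
move=> a1; have [_ T2 _] := T_bounds a1 rate_gt0 r_le1.
apply: le_trans (wbar_sq a1 rate_gt0).
by apply: ler_wpM2l => //; exact: sqr_ge0.
Qed.

Lemma xi_sq_le a : 1 < a -> a <= au -> xi n p a ^+ 2 <= r `^ (2 / (4 * au + 1)).
Proof.
move=> a1 aau; rewrite /xi -powR_mulrn ?powR_ge0// -powRrM.
apply: ger_powR; first by rewrite rate_gt0.
rewrite mul1r [leRHS]mulrC; apply: ler_wpM2l => //.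
by rewrite lef_pV2 ?posrE; lra.
Qed.

Lemma type1_bound a (Cs : R) : 1 < a -> a <= au ->
  16 * (K1 kap + 1) + 2 <= Cs / (4 * au + 1) ->
  1024 * rh ^+ 2 * (K1 kap + 1) <= Num.sqrt n%:R ->
  (sample_law n (1%:M : 'M[R]_p) [set X | (Cs * threshold n p a 1 < Dhat a 1 X)%R] <=
   (expR (- (2 * rh ^+ 2)) + 4 / n%:R + cO * kap * (kap * r `^ (2 / (4 * au + 1))))%:E)%E.
Proof.
have hrh1 := rh_ge1; have hN2 := N2; have hP1 := P1; have hz1 := z1; have hal := al_gt1; have hau := al_le_au.
move=> a1 aau hCs hrh; have r0 := rate_gt0.
have [T1 _ _] := T_bounds a1 r0 r_le1.
have w0 := wbar_gt0 a1 r0.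
(* The threshold in units of the unnormalised statistic: 2 n (n - 1) p Cs C_lambda rate, with n sqrt
   p rate replaced by [rho]. *)
pose u : R := 2 * (n%:R - 1) * Num.sqrt p%:R * rh * Cs * C_lambda a 1.
have hK : 0 <= K1 kap by rewrite /K1 /c8 /kap !mulr_ge0 ?exprn_ge0.
have Cs0 : 0 <= Cs.
  have : 0 <= Cs / (4 * au + 1) by lra.
  by rewrite pmulr_lge0// invr_gt0; lra.
have rh0 : 0 < rh by lra.
have kap0 : 0 < kap by rewrite /kap; lra.
have eqS : [set X : n.-tuple (p.-tuple R) | (Cs * threshold n p a 1 < Dhat a 1 X)%R] =
    [set X | (u < ustat (1%:M : 'M[R]_p) (wmat n p a) X)%R].
  apply/funext => X /=; rewrite ustat_id_fstat Dhat_fstat -invfM [X in _ < X]mulrC; congr is_true.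
  rewrite ltr_pdivlMr; last by rewrite !mulr_gt0//; lra.
  by congr (_ < _); rewrite /u /threshold -rate_scale -[in LHS]z2; ring.
rewrite eqS.
have hN := (null_upper_tail (@wmat_sym R n p a) (wmat_ge0 a1 r0) (wmat_le a1 r0 r_le1) (@wmat_diag _ n p a)
  T1 (wmat_kap a1) kap0 p_gt0 u (ltnW n_gt1) rh0 hrh).
apply: (le_trans hN).
rewrite lee_fin; apply: lerD; last first.
  apply: ler_wpM2l; first by apply: mulr_ge0; [exact: cO_ge0|rewrite /kap; lra].
  apply: le_trans (wbar_sq_le a1 r0) _; apply: ler_wpM2l; first by rewrite /kap; lra.
  exact: xi_sq_le.
rewrite lerD2r ler_expR.
have n0 : 0 < n%:R :> R by lra.
have sz0 : 0 < Num.sqrt p%:R :> R by lra.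
have -> : rh * u / (n%:R * Num.sqrt p%:R) = rh ^+ 2 * (2 * (n%:R - 1) / n%:R) * (Cs * C_lambda a 1).
  by rewrite /u; field; rewrite !gt_eqF.
have h1 : 1 <= 2 * (n%:R - 1) / n%:R :> R by rewrite ler_pdivlMr//; lra.
(* The term 16 (K1 + 1) absorbs the compensator; the remaining 2 is the exponent -2 rho^2. *)
have h2 : 16 * (K1 kap + 1) + 2 <= Cs * C_lambda a 1.
  apply: le_trans hCs _; apply: ler_wpM2l => //; apply: le_trans (C_lambda_ge a1).
  by rewrite div1r lef_pV2 ?posrE; lra.
have rh2 : 0 < rh ^+ 2 by rewrite exprn_gt0.
have h3 : rh ^+ 2 * (16 * (K1 kap + 1) + 2) <= rh ^+ 2 * (2 * (n%:R - 1) / n%:R) * (Cs * C_lambda a 1).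
  apply: ler_pM => //; [exact: ltW|lra|].
  by rewrite ler_peMr// ltW.
by move: h3; set X := _ * (Cs * _); lra.
Qed.

(** Here 8 / (4 au + 1) bounds n [signal] / (sqrt p [rho]) from below: it is 2 C_lambda Cs^2 with
    C_lambda >= 1 / (4 au + 1) and Cs >= 2. *)
Definition type2_cst : R :=
  16 * (1056 * 66 * (42 * kap) / (8 / (4 * au + 1)) ^+ 2 + 1056 * 44 / (8 / (4 * au + 1))).

Lemma decay_class a' (S : 'M[R]_p) : 1 < a' -> Fclass a' 1 S ->
  \sum_i \sum_j S i j ^+ 2 * dist i j `^ (2 * a') <= 2 * p%:R /\
  \sum_i \sum_j S i j ^+ 2 * dist i j ^+ 2 <= 2 * p%:R.
Proof.
have hrh1 := rh_ge1; have hN2 := N2; have hP1 := P1; have hz1 := z1; have hal := al_gt1; have hau := al_le_au.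
move=> a1 [hS hd hF]; have p0 : 0 < p%:R :> R by lra.
have h1 : \sum_i \sum_j S i j ^+ 2 * dist i j `^ (2 * a') <= 2 * p%:R.
  rewrite sum_sym_diag0.
  - by move: hF; rewrite mulrC ler_pdivrMr// mul1r => hF; rewrite ler_wpM2l.
  - by move=> i j; rewrite dist_sym (psd_sym hS).
  - by move=> i; rewrite dist_self powR0 ?mulr0// gt_eqF//; lra.
split=> //; apply: le_trans h1; apply: ler_sum => i _; apply: ler_sum => j _.
apply: ler_wpM2l; first exact: sqr_ge0.
have [<-|ij] := eqVneq i j; first by rewrite dist_self expr0n powR_ge0.
by rewrite -powR_mulrn ?dist_ge0//; apply: ler_powR; [exact: dist_ge1|lra].
Qed.

(** * The signal of an alternative at a nearby grid point *)

Section type2.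
Variables (a a' Cs C : R) (N : nat) (S : 'M[R]_p).
Hypothesis al_le_a' : al <= a'.
Hypothesis a'_le_a : a' <= a.
Hypothesis a_le_au : a <= au.
Hypothesis N_gt0 : (0 < N)%N.
Hypothesis grid_close : a - a' <= (au - al) / N%:R.
Hypothesis ln_rate : ln r^-1 <= N%:R.
Hypothesis Cs_ge2 : 2 <= Cs.
Hypothesis Cs_ge : 4 `^ au <= Cs.
Hypothesis C_gt : Cs + 1 / C_adapt al au < C.
Hypothesis hS : Qclass a' 1 (C * psi n p a') S.

Let a1 : 1 < a. Proof. by move: al_gt1 al_le_a' a'_le_a; lra. Qed.
Let a'1 : 1 < a'. Proof. by move: al_gt1 al_le_a'; lra. Qed.
Let r0 : 0 < r. Proof. exact: rate_gt0. Qed.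

Definition slack : R := expR (4 * (au - al) / (4 * al + 1)).

Lemma slack_ge1 : 1 <= slack.
Proof.
rewrite /slack -[leLHS]expR0 ler_expR divr_ge0 ?mulr_ge0 ?subr_ge0//.
by move: al_gt1; lra.
Qed.

Lemma C_adapt_slack : 1 / C_adapt al au = slack ^+ 2.
Proof.
rewrite /C_adapt /slack expRN div1r invrK -expRM_natl; congr expR.
by rewrite (_ : 8 = 2 * 4) ?mulrA//; ring.
Qed.

(** The exponents of [rate] on the two sides are 4 a' / (4 a + 1) and 4 a' / (4 a' + 1). Their
    difference times ln (1 / rate) is at most 4 (a - a') N / (4 a + 1), and the mesh of the grid
    gives (a - a') N <= au - al. *)
Lemma xi_psi_le : (xi n p a ^+ 2) `^ (2 * a') <= slack * psi n p a' ^+ 2.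
Proof.
have hrh1 := rh_ge1; have hN2 := N2; have hP1 := P1; have hz1 := z1; have hal := al_gt1; have hau := al_le_au.
have [h1 h2] : 0 < 4 * a + 1 /\ 0 < 4 * a' + 1 by move: a1 a'1; lra.
have x0 := xi_gt0 a r0.
have powE e : r `^ e = expR (e * ln r) by rewrite /powR (gt_eqF r0).
have -> : (xi n p a ^+ 2) `^ (2 * a') = expR (4 * a' / (4 * a + 1) * ln r).
  rewrite -(powR_mulrn 2 (ltW x0)) -powRrM /xi -powRrM powE.
  rewrite (_ : 1 / (4 * a + 1) * (2%:R * (2 * a')) = 4 * a' / (4 * a + 1)); first exact: erefl.
  by field; rewrite gt_eqF.
have -> : psi n p a' ^+ 2 = expR (4 * a' / (4 * a' + 1) * ln r).
  rewrite -(powR_mulrn 2 (powR_ge0 _ _)) /psi -powRrM powE.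
  rewrite (_ : 2 * a' / (4 * a' + 1) * 2%:R = 4 * a' / (4 * a' + 1)); first exact: erefl.
  by field; rewrite gt_eqF.
rewrite /slack -expRD ler_expR -lerBlDr -mulrBl.
have -> : (4 * a' / (4 * a + 1) - 4 * a' / (4 * a' + 1)) * ln r =
    (4 * (a - a') / (4 * a + 1)) * (4 * a' / (4 * a' + 1)) * ln r^-1.
  by rewrite lnV//; field; rewrite !gt_eqF.
have lr0 : 0 <= ln r^-1 by apply: ln_ge0; rewrite invf_ge1.
have q1 : 0 <= 4 * a' / (4 * a' + 1) <= 1.
  by rewrite divr_ge0 ?ler_pdivrMr//=; move: a'1; lra.
have N0 : 0 < N%:R :> R by rewrite ltr0n.
have d0 : 0 <= a - a' by rewrite subr_ge0.
have X0 : 0 <= 4 * (a - a') / (4 * a + 1) by apply: divr_ge0; [exact: mulr_ge0|exact: ltW].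
case/andP: q1 => q0 q1.
apply: (@le_trans _ _ (4 * (a - a') / (4 * a + 1) * N%:R)).
  apply: ler_pM => //; first exact: mulr_ge0.
  exact: ler_piMr.
have : (a - a') * N%:R <= au - al by rewrite -ler_pdivlMr.
move=> h; apply: (@le_trans _ _ (4 * (au - al) / (4 * a + 1))).
  rewrite mulrAC; apply: ler_wpM2r; first by rewrite invr_ge0 ltW.
  by rewrite -mulrA ler_wpM2l.
apply: ler_wpM2l; first by rewrite mulr_ge0// subr_ge0.
by rewrite lef_pV2 ?posrE//; move: al_gt1 al_le_a' a'_le_a; lra.
Qed.

(** The off-diagonal squares sum to at least 2 p C^2 psi^2, and truncation removes at most T^(-2 a')
    times 2 p. As 2 xi^2 T >= 1, that power is at most 4^(a') xi^(4 a') <= Cs slack psi^2. Finally C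
    >= Cs + slack^2 >= Cs + slack gives C^2 - Cs slack >= Cs^2. *)
Lemma signal_ge : 2 * p%:R * wbar n p a * (Cs ^+ 2 * psi n p a' ^+ 2) <= signal S (wmat n p a).
Proof.
have hrh1 := rh_ge1; have hN2 := N2; have hP1 := P1; have hz1 := z1; have hal := al_gt1; have hau := al_le_au.
have [hF hQ] := hS; have [psdS diagS _] := hF.
have [hd _] := decay_class a'1 hF.
have [T1 _ T3] := T_bounds a1 r0 r_le1.
set T := T_ n p a 1 in T1 T3; have T0 : 0 < T by lra.
have w0 := wbar_gt0 a1 r0; set w := wbar n p a in w0 *.
have p0 : 0 < p%:R :> R by lra.
set ps := psi n p a'.
have ps2 : 0 <= ps ^+ 2 by exact: sqr_ge0.
pose off i j : R := if i == j then 0 else S i j ^+ 2.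
have hoff : 2 * p%:R * (C ^+ 2 * ps ^+ 2) <= \sum_i \sum_j off i j.
  rewrite sum_sym_diag0.
  - rewrite -mulrA; apply: ler_wpM2l => //.
    move: hQ; rewrite exprMn [X in _ <= X]mulrC ler_pdivlMr// [X in X <= _]mulrC => /le_trans; apply.
    rewrite le_eqVlt; apply/orP; left; apply/eqP.
    apply: eq_bigr => i _; apply: eq_bigr => j ij.
    by rewrite /off -(inj_eq val_inj) (ltn_eqF ij).
  - by move=> i j; rewrite /off eq_sym (psd_sym psdS).
  - by move=> i; rewrite /off eqxx.
have Te0 : 0 < T `^ (2 * a') by exact: powR_gt0.
have hT : (T `^ (2 * a'))^-1 <= Cs * slack * ps ^+ 2.
  have x0 := xi_gt0 a r0.
  have h : 1 <= (2 * xi n p a ^+ 2 * T) `^ (2 * a') by apply: powR_ge1 => //; move: a'1; lra.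
  have x2 : 0 <= xi n p a ^+ 2 by exact: sqr_ge0.
  have t2 : 0 <= 2 :> R by [].
  rewrite (powRM _ (mulr_ge0 t2 x2) (ltW T0)) (powRM _ t2 x2) in h.
  rewrite -[leLHS]mul1r ler_pdivrMr//; apply: le_trans h _; apply: ler_wpM2r; first exact: ltW.
  rewrite -mulrA; apply: ler_pM; rewrite ?powR_ge0//; last exact: xi_psi_le.
  apply: le_trans Cs_ge; rewrite powRrM powR_mulrn// (_ : 2 ^+ 2 = 4); last by ring.
  by apply: ler_powR; [lra|move: a'_le_a a_le_au; lra].
have low : w * (\sum_i \sum_j off i j - (T `^ (2 * a'))^-1 * \sum_i \sum_j S i j ^+ 2 * dist i j `^ (2 * a'))
    <= signal S (wmat n p a).
  rewrite mulr_sumr -sumrB mulr_sumr; apply: ler_sum => i _.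
  rewrite mulr_sumr -sumrB mulr_sumr; apply: ler_sum => j _.
  have [ij|ij] := boolP (i == j).
    rewrite /off ij (eqP ij) wmat_diag dist_self powR0 ?mulr0 ?subr0 ?mulr0 ?mul0r//.
    by rewrite gt_eqF//; move: a'1; lra.
  rewrite /off (negbTE ij).
  have a'0 : 0 <= a' by move: a'1; lra.
  apply: le_trans (ler_wpM2r (sqr_ge0 _) (wmat_ge a1 r0 r_le1 a'0 a'_le_a ij)).
  rewrite powRM ?dist_ge0 ?invr_ge0 ?(ltW T0)// -/w -/T.
  rewrite -(powR_inv1 (ltW T0)) -powRrM mulN1r powRN.
  by rewrite le_eqVlt; apply/orP; left; apply/eqP; ring.
apply: le_trans low.
rewrite (_ : 2 * p%:R * w * _ = w * (2 * p%:R * (Cs ^+ 2 * ps ^+ 2))); last by ring.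
apply: ler_wpM2l; first exact: ltW.
rewrite lerBrDr; apply: le_trans hoff.
apply: (@le_trans _ _ (2 * p%:R * (Cs ^+ 2 * ps ^+ 2) + Cs * slack * ps ^+ 2 * (2 * p%:R))).
  rewrite lerD2l; apply: ler_pM => //; first by rewrite invr_ge0 ltW.
  by do 2 (apply: sumr_ge0 => ? _); rewrite mulr_ge0 ?sqr_ge0 ?powR_ge0.
rewrite (_ : _ + _ = 2 * p%:R * ((Cs ^+ 2 + Cs * slack) * ps ^+ 2)); last by ring.
apply: ler_wpM2l; first by rewrite mulr_ge0// ltW.
apply: ler_wpM2r => //.
move: C_gt; rewrite C_adapt_slack => hC; have := slack_ge1; move: Cs_ge2.
set e := slack in hC * => h2 e1.
have e2 : e <= e ^+ 2 by nra.
have hCe : Cs + e <= C by lra.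
have : (Cs + e) * (Cs + e) <= C * C by apply: ler_pM => //; lra.
have : 0 <= Cs * e by rewrite mulr_ge0//; lra.
by nra.

Qed.

(** At the grid point, wbar psi^2 = C_lambda xi^(4 a + 1) / sqrt C_b >= C_lambda rate because C_b <=
    1; and psi at a' is at least psi at a. *)
Lemma signal_ge_rate : 2 * p%:R * (C_lambda a 1 * r) * Cs ^+ 2 <= signal S (wmat n p a).
Proof.
have hrh1 := rh_ge1; have hN2 := N2; have hP1 := P1; have hz1 := z1; have hal := al_gt1; have hau := al_le_au.
apply: le_trans signal_ge.
rewrite [leLHS](_ : _ = (2 * p%:R) * ((C_lambda a 1 * r) * Cs ^+ 2)); last by ring.
rewrite [leRHS](_ : _ = (2 * p%:R) * ((wbar n p a * psi n p a' ^+ 2) * Cs ^+ 2)); last by ring.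
apply: ler_wpM2l; first exact: mulr_ge0.
apply: ler_wpM2r; first exact: sqr_ge0.
have x0 := xi_gt0 a r0; have cl0 := C_lambda_gt0 a1; have cb0 := C_b_gt0 a1.
have s0 : 0 < Num.sqrt (C_b a 1) by rewrite sqrtr_gt0.
have s1 : Num.sqrt (C_b a 1) <= 1 by rewrite -[leRHS]sqrtr1 ler_wsqrtr// C_b_le1.
have hpsi : psi n p a <= psi n p a'.
  apply: ger_powR; first by rewrite r0.
  have [h1 h2] : 0 < 4 * a + 1 /\ 0 < 4 * a' + 1 by move: a1 a'1; lra.
  by rewrite ler_pdivrMr// mulrAC ler_pdivlMr//; move: a'_le_a; nra.
have psi0 : 0 <= psi n p a by exact: powR_ge0.
apply: (@le_trans _ _ (wbar n p a * psi n p a ^+ 2)); last first.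
  apply: ler_wpM2l; first exact/ltW/wbar_gt0.
  by rewrite !expr2; apply: ler_pM.
have -> : psi n p a ^+ 2 = xi n p a `^ (4 * a).
  rewrite (psi_xi n p a1) -(powR_mulrn 2 (powR_ge0 _ _)) -powRrM.
  by rewrite (_ : 2 * a * 2%:R = 4 * a)//; ring.
have rE : r = xi n p a * xi n p a `^ (4 * a).
  rewrite -[LHS](xi_pow a1 r0) addrC powRD ?powRr1 ?(ltW x0)//.
  by rewrite (gt_eqF x0) implybT.
rewrite (wbarE a1 r0) [X in C_lambda a 1 * X <= _]rE.
set X := xi n p a `^ (4 * a); have X0 : 0 <= X by exact: powR_ge0.
rewrite [leRHS]mulrAC [leLHS]mulrA ler_pdivlMr//.
have CX : 0 <= C_lambda a 1 * xi n p a * X.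
  by apply: (mulr_ge0 _ X0); exact: (ltW (mulr_gt0 cl0 x0)).
exact: (ler_piMr CX s1).
Qed.

Lemma type2_bound :
  (sample_law n S [set X | (Dhat a 1 X <= Cs * threshold n p a 1)%R] <= (type2_cst / rh)%:E)%E.
Proof.
have hrh1 := rh_ge1; have hN2 := N2; have hP1 := P1; have hz1 := z1; have hal := al_gt1; have hau := al_le_au.
have [hF hQ] := hS; have [psdS diagS _] := hF.
have [_ hd] := decay_class a'1 hF.
have [T1 _ _] := T_bounds a1 r0 r_le1.
have w0 := wbar_gt0 a1 r0.
have cl0 := C_lambda_gt0 a1.
have th := signal_ge_rate; set th0 := signal _ _ in th.
have pp : 0 < p%:R :> R by rewrite ltr0n.
have pr0 : 0 < p%:R * (C_lambda a 1 * r) by apply: mulr_gt0 pp _; exact: mulr_gt0 cl0 r0.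
have thp : 0 < th0.
  apply: lt_le_trans th; rewrite -[X in 0 < X * _]mulrA.
  by apply: mulr_gt0; [exact: mulr_gt0|apply: exprn_gt0; move: Cs_ge2; lra].
have rh0 : 0 < rh by lra.
have z0 : 0 < Num.sqrt p%:R :> R by lra.
apply: (@le_trans _ _ (sample_law n S [set t | (fstat (wmat n p a) t <= n%:R * (n%:R - 1) / 2 * th0)%R])).
  apply: le_measure; rewrite ?inE.
  - rewrite -[X in measurable X]setTI; apply: measurable_fun_le => //.
    exact: measurable_Dhat.
  - by rewrite -[X in measurable X]setTI; apply: measurable_fun_le => //; exact: measurable_fstat.
  - move=> X /=; rewrite Dhat_fstat -invfM mulrC ler_pdivrMr; last by rewrite !mulr_gt0//; lra.
    move/le_trans; apply.
    (* Half the mean exceeds the threshold because Cs^2 >= 2 Cs. *)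
    rewrite /threshold (_ : Cs * _ * _ = n%:R * (n%:R - 1) / 2 * (2 * (p%:R * (C_lambda a 1 * r)) * (2 * Cs))); last first.
      by field.
    apply: ler_wpM2l; first by rewrite divr_ge0// mulr_ge0//; lra.
    apply: le_trans th; rewrite -[X in _ <= X * _]mulrA; apply: ler_wpM2l; first by rewrite mulr_ge0// ltW.
    by rewrite expr2; apply: ler_wpM2r => //; move: Cs_ge2; lra.
have kap0 : 0 < kap by rewrite /kap; lra.
apply: le_trans (fstat_lower_tail psdS diagS hd (@wmat_sym R n p a) (wmat_ge0 a1 r0)
  (wmat_le a1 r0 r_le1) T1 (ltW w0) (wmat_kap a1) p_gt0 n_gt1 thp) _.
rewrite -/th0 lee_fin /type2_cst.
pose b := 8 / (4 * au + 1).
have b0 : 0 < b by rewrite divr_gt0//; move: al_gt1 al_le_au; lra.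
have hnth : b * (Num.sqrt p%:R * rh) <= n%:R * th0.
  apply: (@le_trans _ _ (n%:R * (2 * p%:R * (C_lambda a 1 * r) * Cs ^+ 2))); last first.
    by apply: ler_wpM2l => //.
  rewrite -rate_scale [leLHS](_ : _ = (p%:R * n%:R * r) * b); last by rewrite -[in RHS]z2; ring.
  rewrite [leRHS](_ : _ = (p%:R * n%:R * r) * (2 * C_lambda a 1 * Cs ^+ 2)); last by ring.
  apply: ler_wpM2l; first by rewrite !mulr_ge0// ltW.
  apply: (@le_trans _ _ (2 * (1 / (4 * au + 1)) * 4)).
    by rewrite /b le_eqVlt; apply/orP; left; apply/eqP; field; rewrite gt_eqF//; move: al_gt1 al_le_au; lra.
  apply: ler_pM => //.
  - by rewrite mulr_ge0// divr_ge0//; move: al_gt1 al_le_au; lra.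
  - rewrite ler_wpM2l//; apply: le_trans (C_lambda_ge a1).
    by rewrite !div1r lef_pV2 ?posrE//; move: a1 al_gt1 al_le_au a_le_au; lra.
  - by move: Cs_ge2 => h; nra.
have w2 : wbar n p a <= 2.
  have := wbar_sq_le a1 r0; have x1 := xi_le1 a1 r0 r_le1; have x0 := xi_gt0 a r0.
  by move: (ltW w0); set w := wbar _ _ _; set x := xi _ _ _ in x0 x1 *; nra.
rewrite -{1}z2; exact: (type2_ratio (mulr_ge0 (ler0n _ _) (ler0n _ _)) (ler0n _ _) (ltW kap0) z0 hrh1 b0 (ltW w0) w2 hnth).
Qed.

End type2.
End finite_sample.

(** * The adaptive test *)

Section nonempty.
Context {R : realType} (p : nat).
Hypothesis p_gt1 : (1 < p)%N.

(* A member of every class [Qclass p alpha 1 phi] with [phi ^+ 2 <= 1 / 4], so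
   that the supremum in [gamma] is not that of an empty set (which is [-oo]). *)
Definition paired : 'M[R]_p := \matrix_(i, j) (i./2 == j./2 :> nat)%:R.

Lemma paired_psd : psd paired.
Proof.
split; first by apply/matrixP => i j; rewrite !mxE eq_sym.
pose F : 'M[R]_p := \matrix_(i, b) (i./2 == b :> nat)%:R.
have -> : paired = F *m F^T.
  apply/matrixP => i j; rewrite !mxE.
  have ip : (i./2 < p)%N by apply: leq_ltn_trans (ltn_ord i); rewrite -divn2 leq_div.
  rewrite (bigD1 (Ordinal ip))//= !mxE/= eqxx mul1r eq_sym big1 ?addr0// => b bi.
  rewrite !mxE (_ : (i./2 == b :> nat) = false) ?mul0r//.
  by apply: contraNF bi => /eqP h; apply/eqP/val_inj; rewrite /= h.
move=> x; rewrite mulmxA -mulmxA -trmx_mul mxE; apply: sumr_ge0 => b _.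
by rewrite [_^T b _]mxE -expr2 sqr_ge0.
Qed.

Lemma half_eq_ltn (i j : nat) : i./2 = j./2 -> (i < j)%N -> j = i.+1.
Proof.
move=> h; move: (odd_double_half i) (odd_double_half j); rewrite -h.
move: (odd i) (odd j) (i./2).*2 => bi bj k <- <-.
by case: bi; case: bj; rewrite ?add0n ?add1n ?ltnn// ltnNge leqnSn.
Qed.

(** The nonzero off-diagonal entries equal 1 and sit at distance 1, so the decay sum is at most p
    for every exponent. Every index but possibly the last has a partner, hence the normalised sum is
    at least (p - 1) / (2 p) >= 1/4. *)
Lemma paired_Qclass (a phi : R) : 1 < a -> phi ^+ 2 <= 1 / 4 -> Qclass a 1 phi paired.
Proof.
move=> a1 hphi; have p0 : 0 < p%:R :> R by rewrite ltr0n ltnW.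
have p2 : 2 <= p%:R :> R by rewrite ler_nat.
split.
  split; [exact: paired_psd|by move=> i; rewrite mxE eqxx|].
  rewrite mulrC ler_pdivrMr// mul1r -[X in _ <= X%:R]card_ord -sum1_card natr_sum.
  apply: ler_sum => i _.
  apply: (@le_trans _ _ (\sum_(j < p) (j == i.+1 :> nat)%:R)).
    rewrite [leLHS]big_mkcond; apply: ler_sum => j _; case: ifP => // ij.
    rewrite mxE; have [h|h] := eqVneq (i./2) (j./2); last by rewrite expr0n mul0r.
    have ji := half_eq_ltn h ij.
    have dj : dist i j = 1 :> R by rewrite /dist ji distrC -natrB// subSnn normr1.
    by rewrite dj powR1 ji eqxx expr1n mul1r.
  have [h|h] := ltnP i.+1 p.
    rewrite (bigD1 (Ordinal h))//= eqxx big1 ?addr0// => j jh.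
    by rewrite (_ : (j == i.+1 :> nat) = false)//; apply: contraNF jh => /eqP e; apply/eqP/val_inj.
  rewrite big1 ?ler01// => j _; rewrite (_ : (j == i.+1 :> nat) = false)//.
  by apply/negbTE; rewrite neq_ltn (leq_trans (ltn_ord j) h).
apply: le_trans hphi _; rewrite [leRHS]mulrC ler_pdivlMr//.
pose off (i j : 'I_p) : R := if i == j then 0 else paired i j ^+ 2.
have E : \sum_i \sum_j off i j = 2 * \sum_(i < p) \sum_(j < p | (i < j)%N) paired i j ^+ 2.
  rewrite sum_sym_diag0.
  - congr (_ * _); apply: eq_bigr => i _; apply: eq_bigr => j ij.
    by rewrite /off -(inj_eq val_inj) (ltn_eqF ij).
  - by move=> i j; rewrite /off eq_sym (psd_sym paired_psd).
  - by move=> i; rewrite /off eqxx.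
have off0 i j : 0 <= off i j by rewrite /off; case: ifP => // _; exact: sqr_ge0.
suff : p%:R - 1 <= \sum_i \sum_j off i j by rewrite E; lra.
have -> : p%:R - 1 = \sum_(i < p) (i.+1 < p)%N%:R :> R.
  case: p p_gt1 => // q _; rewrite big_ord_recr/= ltnn addr0.
  rewrite (eq_bigr (fun=> 1)); last by move=> i _; rewrite ltnS ltn_ord.
  by rewrite sumr_const card_ord -natr1 addrK.
apply: ler_sum => i _; case: (boolP (i.+1 < p)%N) => h; last exact: sumr_ge0.
have [j [ji hj]] : exists j : 'I_p, i != j /\ i./2 = j./2.
  case: (boolP (odd i)) => oi.
    have ip : (i.-1 < p)%N by apply: leq_ltn_trans (leq_pred _) (ltn_ord i).
    exists (Ordinal ip); split.
      by rewrite -(inj_eq val_inj)/= gtn_eqF// prednK//; case: (nat_of_ord i) oi.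
    by rewrite /=; case: (nat_of_ord i) oi => //= k; rewrite uphalf_half => /negbTE ->.
  exists (Ordinal h); split; first by rewrite -(inj_eq val_inj)/= ltn_eqF.
  by rewrite /= uphalf_half (negbTE oi).
rewrite (bigD1 j)//= -[leLHS]addr0; apply: lerD; last exact: sumr_ge0.
by rewrite /off (negbTE ji) mxE hj eqxx expr1n.
Qed.

End nonempty.

(** * From single tests to their maximum *)

Section test.
Context {R : realType} (n p : nat) (al au Cs : R).

Let reject (r : nat) : set (n.-tuple (p.-tuple R)) :=
  [set Y | Cs * threshold n p (grid n p al au r) 1 < Dhat (grid n p al au r) 1 Y].

Lemma measurable_reject r : measurable (reject r).
Proof. by apply: measurable_set_ltr => //; exact: measurable_Dhat. Qed.

Lemma measurable_adaptive_test : measurable_fun setT (@adaptive_test R n p al au 1 Cs).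
Proof.
rewrite /adaptive_test; elim: (index_iota _ _) => [|r s IH].
  by under eq_fun do rewrite big_nil; exact: measurable_cst.
under eq_fun do rewrite big_cons.
by apply: measurable_maxr => //; apply: measurable_indic; exact: measurable_reject.
Qed.

Lemma adaptive_test_le (X : n.-tuple (p.-tuple R)) : 0 <= adaptive_test al au 1 Cs X <= 1.
Proof.
rewrite /adaptive_test; apply: (big_ind (fun x : R => 0 <= x <= 1)).
- by rewrite lexx ler01.
- by move=> x y /andP[x0 x1] /andP[y0 y1]; rewrite le_max x0/= ge_max x1 y1.
- by move=> r _; rewrite indicE; case: (_ \in _); rewrite ?lexx ler01.
Qed.

Lemma adaptive_test_le_sum (X : n.-tuple (p.-tuple R)) :
  adaptive_test al au 1 Cs X <= \sum_(r < @grid_size R n p) \1_(reject r.+1) X.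
Proof.
rewrite /adaptive_test big_add1/= big_mkord.
pose M := \big[Num.max/0]_(r < @grid_size R n p) (\1_(reject r.+1) X : R).
pose Q := \sum_(r < @grid_size R n p) (\1_(reject r.+1) X : R).
have : 0 <= M <= Q.
  apply: (big_ind2 (fun x y : R => 0 <= x <= y)).
  - by rewrite lexx.
  - move=> x1 x2 y1 y2 /andP[h1 h2] /andP[h3 h4].
    by rewrite le_max h1/= ge_max; apply/andP; split; lra.
  - by move=> r _; rewrite indicE lexx andbT.
by move=> /andP[_].
Qed.

Lemma adaptive_test_ge (r : nat) (X : n.-tuple (p.-tuple R)) : (0 < r <= @grid_size R n p)%N ->
  \1_(reject r) X <= adaptive_test al au 1 Cs X.
Proof.
move=> rN; rewrite /adaptive_test.
have : r \in index_iota 1 (@grid_size R n p).+1 by rewrite mem_index_iota ltnS.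
elim: (index_iota _ _) => // k s IH; rewrite in_cons big_cons le_max => /orP[/eqP <-|/IH ->].
  by rewrite lexx.
by rewrite orbT.
Qed.

Lemma type1_adaptive (b : R) :
  (forall r, (r < @grid_size R n p)%N -> (sample_law n (1%:M : 'M[R]_p) (reject r.+1) <= b%:E)%E) ->
  ('E_(sample_law n (1%:M : 'M[R]_p))[adaptive_test al au 1 Cs] <= ((@grid_size R n p)%:R * b)%:E)%E.
Proof.
move=> hb; rewrite unlock.
apply: (@le_trans _ _ (\int[sample_law n (1%:M : 'M[R]_p)]_X
    (\sum_(r < @grid_size R n p) \1_(reject r.+1) X)%:E)%E).
  apply: integral_le_mono.
  - exact: measurable_adaptive_test.
  - by apply: measurable_sum => r; apply: measurable_indic; exact: measurable_reject.
  - by move=> X; case/andP: (adaptive_test_le X).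
  - exact: adaptive_test_le_sum.
rewrite [X in X%:E](_ : _ = \sum_(r < @grid_size R n p) b); last first.
  by rewrite sumr_const card_ord mulr_natl.
apply: integral_sum_le => [r|r X|r].
- by apply: measurable_indic; exact: measurable_reject.
- by rewrite indicE.
- by rewrite integral_indic//= ?setIT; [exact: hb|exact: measurable_reject].
Qed.

Lemma type2_adaptive (S : 'M[R]_p) (r : nat) (b : R) : (0 < r <= @grid_size R n p)%N ->
  (sample_law n S [set X | (Dhat (grid n p al au r) 1 X <= Cs * threshold n p (grid n p al au r) 1)%R]
     <= b%:E)%E ->
  ('E_(sample_law n S)[fun X => (1 - adaptive_test al au 1 Cs X)%R] <= b%:E)%E.
Proof.
move=> rN; set A := [set X | _] => hb; rewrite unlock; apply: le_trans hb.
have mA : measurable A.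
  by rewrite -[X in measurable X]setTI; apply: measurable_fun_le => //; exact: measurable_Dhat.
rewrite -[X in (_ <= _ X)%E]setIT -integral_indic//.
apply: integral_le_mono.
- by apply: measurable_funB => //; exact: measurable_adaptive_test.
- exact: measurable_indic.
- by move=> X; case/andP: (adaptive_test_le X); rewrite subr_ge0.
- move=> X; rewrite lerBlDr; have := adaptive_test_ge X rN; rewrite !indicE.
  case: (boolP (X \in A)) => hA; first by have /andP[? _] := adaptive_test_le X; rewrite lerDl.
  rewrite mem_set /=; first by rewrite add0r.
  by move: hA; rewrite notin_setE /A /= /reject /= => /negP; rewrite -ltNge.
Qed.

Lemma type2_ge0 (S : 'M[R]_p) :
  (0 <= 'E_(sample_law n S)[fun X => (1 - adaptive_test al au 1 Cs X)%R])%E.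
Proof.
rewrite unlock; apply: integral_ge0 => X _; rewrite lee_fin subr_ge0.
by case/andP: (adaptive_test_le X).
Qed.

Lemma type1_ge0 : (0 <= 'E_(sample_law n (1%:M : 'M[R]_p))[adaptive_test al au 1 Cs])%E.
Proof.
by rewrite unlock; apply: integral_ge0 => X _; rewrite lee_fin; case/andP: (adaptive_test_le X).
Qed.

Lemma grid_approx (a : R) : al <= a -> a <= au -> (0 < @grid_size R n p)%N ->
  exists r, [/\ (0 < r <= @grid_size R n p)%N, a <= grid n p al au r, grid n p al au r <= au
    & grid n p al au r - a <= (au - al) / (@grid_size R n p)%:R].
Proof.
move=> ala aau N0; set N := @grid_size R n p in N0 *.
have N0' : 0 < N%:R :> R by rewrite ltr0n.
have gN : grid n p al au N = au by rewrite /grid -/N divfK ?gt_eqF// addrC subrK.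
have ex : exists r, (0 < r)%N && (a <= grid n p al au r) by exists N; rewrite N0 gN.
case: (ex_minnP ex) => r /andP[r0 ar] rmin; exists r.
have rN : (r <= N)%N by apply: rmin; rewrite N0 gN.
have d0 : 0 <= (au - al) / N%:R by apply: divr_ge0; [lra|exact: ltW].
split => //; first by rewrite r0.
  rewrite -[leRHS]gN /grid -/N lerD2l; apply: ler_wpM2l => //.
  by rewrite ler_nat.
(* For r = 1 the preceding point is [al], which is not a grid point; there a >= al replaces
   minimality. *)
case: r r0 ar rmin rN => // -[|r] _ ar rmin rN.
  by rewrite /grid -/N mulr1; lra.
have : ~~ (a <= grid n p al au r.+1).
  by apply/negP => h; have := rmin r.+1; rewrite h => /(_ isT); rewrite ltnn.
rewrite -ltNge => h; apply: (@le_trans _ _ (grid n p al au r.+2 - grid n p al au r.+1)); first lra.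
rewrite /grid -/N; set d := _ / _; rewrite le_eqVlt; apply/orP; left; apply/eqP.
by rewrite -(natr1 r.+1); ring.
Qed.

End test.

(** The bound on [C * psi n p al] places [paired] in the class of smoothness [al], which makes the
    supremum nonnegative. *)
Lemma gamma_bound (R : realType) (n p : nat) (al au Cs C : R) :
  1 < al -> al <= au -> (1 < n)%N -> (1 < p)%N ->
  1 <= @rho R n p -> @rate R n p <= 1 -> ln (@rate R n p)^-1 <= (@grid_size R n p)%:R ->
  (0 < @grid_size R n p)%N ->
  2 <= Cs -> 4 `^ au <= Cs -> 16 * (K1 (15 / 4) + 1) + 2 <= Cs / (4 * au + 1) ->
  Cs + 1 / C_adapt al au < C ->
  1024 * rho n p ^+ 2 * (K1 (15 / 4) + 1) <= Num.sqrt n%:R :> R ->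
  (C * psi n p al) ^+ 2 <= 1 / 4 ->
  (0 <= gamma (@adaptive_test R n p al au 1 Cs)
     (\bigcup_(alpha in `[al, au]) @Qclass R p alpha 1 (C * psi n p alpha)) <=
   ((@grid_size R n p)%:R * (expR (- (2 * rho n p ^+ 2)) + 4 / n%:R +
       cO * (15 / 4) * (15 / 4 * rate n p `^ (2 / (4 * au + 1)))) + type2_cst au / rho n p)%:E)%E.
Proof.
move=> al1 alau n1 p1 rh1 r1 lnr N0 Cs2 Cs4 CsK hC hrh hpsi.
set Q := \bigcup_(alpha in _) _; have p0 := ltnW p1.
have N0' : 0 < (@grid_size R n p)%:R :> R by rewrite ltr0n.
have inI (a : R) : `[al, au]%classic a -> al <= a /\ a <= au.
  by rewrite /= in_itv/= => /andP.
have hgrid r : (0 < r <= @grid_size R n p)%N -> 1 < grid n p al au r /\ grid n p al au r <= au.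
  move=> /andP[r0 rN]; have d0 : 0 <= (au - al) / (@grid_size R n p)%:R.
    by apply: divr_ge0; [lra|exact: ltW].
  split; first by rewrite /grid; have : 0 <= (au - al) / (@grid_size R n p)%:R * r%:R; [exact: mulr_ge0|lra].
  have gN : al + (au - al) / (@grid_size R n p)%:R * (@grid_size R n p)%:R = au.
    by rewrite divfK ?gt_eqF// addrC subrK.
  rewrite /grid -[leRHS]gN lerD2l; apply: ler_wpM2l => //.
  by rewrite ler_nat.
have t1 := type1_ge0 n p al au Cs.
apply/andP; split.
  apply: adde_ge0 => //.
  have hS : Q (@paired R p).
    exists al; first by rewrite /= in_itv/= lexx.
    exact: paired_Qclass.
  apply: le_trans (type2_ge0 n al au Cs (@paired R p)) _.
  by apply: ereal_sup_ubound; exists (@paired R p).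
rewrite EFinD; apply: leeD.
  apply: type1_adaptive => r rN; have [g1 g2] := hgrid r.+1 rN.
  exact: (type1_bound al1 alau n1 p0 rh1 r1 g1 g2 CsK hrh).
apply: ub_ereal_sup => _ [S [a /inI[ala aau] hS] <-].
have [r [rN ar rau rclose]] := grid_approx ala aau N0.
apply: (type2_adaptive rN).
exact: (type2_bound al1 alau n1 p0 rh1 r1 ala ar rau N0 rclose lnr Cs2 Cs4 hC hS).
Qed.

(** * Rates in terms of ln (n sqrt p) *)

Section growth.
Context {R : realType} (n p : nat).
Hypothesis n_gt1 : (1 < n)%N.
Hypothesis p_gt1 : (1 < p)%N.
Notation y := (n%:R * Num.sqrt p%:R : R).
Notation L := (ln y).
Hypothesis L_ge : expR 1 <= L.

Let y0 : 0 < y.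
Proof. by rewrite mulr_gt0 ?sqrtr_gt0 ?ltr0n// ltnW. Qed.
Let L1 : 2 <= L.
Proof. by apply: le_trans L_ge; apply: le_trans (expR_ge1Dx _); lra. Qed.
Let yE : y = expR L. Proof. by rewrite lnK. Qed.

Lemma lnL_ge1 : 1 <= ln L.
Proof. by rewrite -[leLHS]expRK; rewrite ler_ln ?posrE ?expR_gt0//; move: L1; lra. Qed.

Lemma rho_sq : @rho R n p ^+ 2 = ln L.
Proof. by rewrite /rho sqr_sqrtr//; apply: le_trans lnL_ge1. Qed.

Lemma rho_ge1 : 1 <= @rho R n p.
Proof. by rewrite /rho -[leLHS]sqrtr1 ler_wsqrtr// lnL_ge1. Qed.

Lemma ln_lt_id (x : R) : 0 < x -> ln x <= x.
Proof. by move=> x0; have := expR_ge1Dx (ln x); rewrite lnK//; lra. Qed.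

Lemma ln_le_sqrt (x : R) : 0 < x -> ln x <= 2 * Num.sqrt x.
Proof.
move=> x0; have s0 : 0 < Num.sqrt x by rewrite sqrtr_gt0.
rewrite -{1}[x](sqr_sqrtr (ltW x0)) lnXn// -[leLHS]mulr_natl; apply: ler_wpM2l => //.
exact: ln_lt_id.
Qed.

Lemma rate_le_expR : @rate R n p <= expR (- (L / 2)).
Proof.
have h1 := rho_ge1; have l1 := L1; have s : @rho R n p <= expR (L / 2).
  rewrite -(ger0_norm (expR_ge0 (L / 2))) -sqrtr_sqr /rho; apply: ler_wsqrtr.
  rewrite -expRM_natl (_ : 2%:R * (L / 2) = L); last by field.
  apply: le_trans (ln_lt_id _) _; first by lra.
  by apply: le_trans (expR_ge1Dx _); rewrite lerDr.
rewrite /rate ler_pdivrMr ?y0// [X in _ <= _ * X]yE -expRD.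
by rewrite (_ : - (L / 2) + L = L / 2)//; field.
Qed.

Lemma rate_pos : 0 < @rate R n p.
Proof. by rewrite /rate divr_gt0//; move: rho_ge1; lra. Qed.

Lemma rate_le1 : @rate R n p <= 1.
Proof.
apply: le_trans rate_le_expR _; rewrite -[leRHS]expR0 ler_expR oppr_le0 divr_ge0//.
by move: L1; lra.
Qed.

(** From rate <= exp(-L / 2) and exp(u) >= u^2 / 2. Decay of order L^-2 suffices, as the number of
    tests is at most 2 L. *)
Lemma rate_powR_le (e : R) : 0 < e -> @rate R n p `^ e <= 8 / (e ^+ 2 * L ^+ 2).
Proof.
move=> e0; have r0 := rate_pos; have l1 := L1; have L0 : 0 < L by lra.
have u0 : 0 < e * (L / 2) by rewrite mulr_gt0// divr_gt0.
rewrite /powR gt_eqF//.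
have h1 : e * ln (@rate R n p) <= - (e * (L / 2)).
  rewrite -mulrN; apply: ler_wpM2l; first exact: ltW.
  by rewrite -[leRHS]expRK; rewrite ler_ln ?posrE ?expR_gt0// rate_le_expR.
apply: (@le_trans _ _ (expR (- (e * (L / 2))))); first by rewrite ler_expR.
rewrite expRN; have := expR_ge1Dxn 1 (ltW u0); rewrite (_ : (2)`!%:R = 2)// => h2.
have h3 : (e * (L / 2)) ^+ 2 / 2 <= expR (e * (L / 2)) by lra.
rewrite (_ : 8 / _ = ((e * (L / 2)) ^+ 2 / 2)^-1); last by field; rewrite !gt_eqF.
by rewrite lef_pV2 ?posrE ?expR_gt0// divr_gt0// exprn_gt0.
Qed.

Lemma grid_size_bounds : [/\ (0 < @grid_size R n p)%N, L <= (@grid_size R n p)%:R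
  & (@grid_size R n p)%:R <= 2 * L].
Proof.
have l1 := L1; have L0 : 0 < L by lra.
have c0 : 0 <= Num.ceil L by rewrite ceil_ge0; lra.
have NE : (@grid_size R n p)%:R = (Num.ceil L)%:~R :> R.
  by rewrite /grid_size natr_absz ger0_norm.
have h1 : L <= (@grid_size R n p)%:R by rewrite NE ceil_ge.
split => //; first by rewrite -(ltr_nat R); lra.
by rewrite NE; have := ceilB1_lt L; rewrite intrB; lra.
Qed.

Lemma ln_rate_inv : ln (@rate R n p)^-1 <= (@grid_size R n p)%:R.
Proof.
have [_ h _] := grid_size_bounds; apply: le_trans h; have h1 := rho_ge1.
rewrite ler_ln ?posrE ?invr_gt0 ?rate_pos//.
by rewrite /rate invf_div ler_pdivrMr; [rewrite ler_peMr// ltW|lra].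
Qed.

Lemma type1_error_le (c e : R) : 0 <= c -> 0 < e ->
  (@grid_size R n p)%:R * (expR (- (2 * rho n p ^+ 2)) + 4 / n%:R + c * rate n p `^ e) <=
  (2 + c * 16 / e ^+ 2) / L + 8 * (L / n%:R).
Proof.
move=> c0 e0; have [_ _ NL] := grid_size_bounds; have l1 := L1; have L0 : 0 < L by lra.
have n0 : 0 < n%:R :> R by rewrite ltr0n ltnW.
have -> : expR (- (2 * @rho R n p ^+ 2)) = (L ^+ 2)^-1.
  by rewrite rho_sq expRN (expRM_natl 2) lnK.
apply: (@le_trans _ _ (2 * L * ((L ^+ 2)^-1 + 4 / n%:R + c * (8 / (e ^+ 2 * L ^+ 2))))).
  apply: ler_pM => //.
    by rewrite !addr_ge0// ?invr_ge0 ?sqr_ge0// ?divr_ge0// mulr_ge0 ?powR_ge0.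
  by rewrite lerD2l; apply: ler_wpM2l => //; exact: rate_powR_le.
rewrite le_eqVlt; apply/orP; left; apply/eqP; field.
by rewrite !gt_eqF.
Qed.

End growth.

(** Each of the terms in 1 / L, 8 L / n and 1 / rho receives eps / 3. The constant 2048 = 2 * 1024
    comes from rho^2 = ln L <= 2 sqrt L, so that a small L / n yields the condition on sqrt n. *)
Lemma gamma_le_eps (R : realType) (n p : nat) (al au Cs C eps : R) :
  let L := ln (n%:R * Num.sqrt p%:R) in
  let c := cO * (15 / 4) * (15 / 4) in
  let e1 := 2 / (4 * au + 1) in let e2 := 2 * al / (4 * al + 1) in
  let x := 3 * type2_cst au / eps in
  1 < al -> al <= au -> (1 < n)%N -> (1 < p)%N ->
  2 <= Cs -> 4 `^ au <= Cs -> 16 * (K1 (15 / 4) + 1) + 2 <= Cs / (4 * au + 1) ->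
  Cs + 1 / C_adapt al au < C -> 0 < eps ->
  expR 1 <= L -> 3 * (2 + c * 16 / e1 ^+ 2) / eps <= L -> expR (x ^+ 2) <= L ->
  16 * `|C| / e2 ^+ 2 <= L -> L / n%:R <= eps / 24 ->
  L / n%:R <= ((2048 * (K1 (15 / 4) + 1)) ^+ 2)^-1 ->
  (0 <= gamma (@adaptive_test R n p al au 1 Cs)
     (\bigcup_(alpha in `[al, au]) @Qclass R p alpha 1 (C * psi n p alpha)) <= eps%:E)%E.
Proof.
have aux (E z l : R) : 0 < E -> 2 <= l -> 16 * z <= l * E -> z * 8 <= 1 / 2 * (E * l ^+ 2).
  move=> E0 l2 h; have : l * E <= E * l ^+ 2 by rewrite mulrC ler_pM2l// expr2 ler_peMr//; lra.
  lra.
move=> L c e1 e2 x al1 alau n2 p2 Cs2 Cs4 CsK hC eps0 l1 l2 l3 l4 h1 h2.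
have K0 : 0 <= K1 (15 / 4) :> R.
  by rewrite /K1 /c8; apply: mulr_ge0; [apply: mulr_ge0|apply: mulr_ge0 => //; exact: exprn_ge0].
have f0 : 0 <= 15 / 4 :> R by exact: (divr_ge0 (ler0n _ _) (ler0n _ _)).
have c0 : 0 <= c := mulr_ge0 (mulr_ge0 cO_ge0 f0) f0.
have e10 : 0 < e1 by apply: divr_gt0 => //; clear -al1 alau; lra.
have e20 : 0 < e2 by apply: divr_gt0; clear -al1; lra.
set D := 2048 * _ in h2; have D0 : 0 < D by clear -K0; rewrite /D; lra.
have D20 : 0 < D ^+ 2 by exact: exprn_gt0.
have n0 : 0 < n%:R :> R by rewrite ltr0n ltnW.
have L2 : 2 <= L by apply: le_trans l1; apply: le_trans (expR_ge1Dx _); lra.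
have L0 : 0 < L by exact: lt_le_trans L2.
have rhE : rho n p ^+ 2 = ln L := rho_sq l1.
have rh1 : 1 <= @rho R n p := rho_ge1 l1.
have [N0 _ _] := grid_size_bounds l1.
have hrh : 1024 * rho n p ^+ 2 * (@K1 R (15 / 4) + 1) <= Num.sqrt n%:R.
  have hD : D ^+ 2 * L <= n%:R.
    by move: h2; rewrite ler_pdivrMr// mulrC ler_pdivlMr// mulrC.
  have sD : D * Num.sqrt L <= Num.sqrt n%:R.
    rewrite -[D](ger0_norm (ltW D0)) -sqrtr_sqr -sqrtrM ?(ltW D20)//.
    exact: ler_wsqrtr.
  apply: le_trans sD; rewrite rhE /D.
  have k0 : 0 <= @K1 R (15 / 4) + 1 by rewrite addr_ge0.
  have := ler_wpM2r k0 (ln_le_sqrt L0); move: (Num.sqrt L) (ln L) => u v h; clear -h; lra.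
have hpsi : (C * psi n p al) ^+ 2 <= 1 / 4.
  have ps0 : 0 <= psi n p al by exact: powR_ge0.
  have ps1 : psi n p al <= 8 / (e2 ^+ 2 * L ^+ 2) := rate_powR_le n2 p2 l1 e20.
  have E0 : 0 < e2 ^+ 2 by exact: exprn_gt0.
  have EL0 : 0 < e2 ^+ 2 * L ^+ 2 by apply: mulr_gt0 => //; exact: exprn_gt0.
  have ps2 : `|C| * psi n p al <= 1 / 2.
    apply: le_trans (ler_wpM2l (normr_ge0 C) ps1) _.
    rewrite mulrA (ler_pdivrMr _ _ EL0).
    by move: l4; rewrite (ler_pdivrMr _ _ E0); exact: aux.
  rewrite -[leLHS](ger0_norm (sqr_ge0 _)) normrX normrM (ger0_norm ps0).
  by rewrite (_ : 1 / 4 = (1 / 2) ^+ 2 :> R); [rewrite lerXn2r// nnegrE ?mulr_ge0|field].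
have bnd := gamma_bound al1 alau n2 p2 rh1 (rate_le1 n2 p2 l1)
  (ln_rate_inv n2 p2 l1) N0 Cs2 Cs4 CsK hC hrh hpsi.
case/andP: bnd => b1 b2; rewrite b1/=; apply: le_trans b2 _; rewrite lee_fin.
have l5 : (2 + c * 16 / e1 ^+ 2) / L <= eps / 3.
  by move: l2; rewrite !ler_pdivrMr// => l2; clear -l2; lra.
have l6 : type2_cst au / rho n p <= eps / 3.
  have rx : x <= rho n p.
    apply: le_trans (ler_norm x) _; rewrite -sqrtr_sqr; apply: ler_wsqrtr.
    by rewrite -[leLHS]expRK ler_ln ?posrE ?expR_gt0.
  move: rx; rewrite /x ler_pdivrMr// => rx.
  by rewrite ler_pdivrMr ?(lt_le_trans _ rh1)//; clear -rx; lra.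
have h3 := type1_error_le n2 p2 l1 c0 e10.
rewrite [cO * _ * _](_ : _ = c * rate n p `^ e1); last by rewrite mulrA.
apply: le_trans (lerD (le_trans h3 (lerD l5 (ler_wpM2l _ h1))) l6) _ => //.
by clear -eps0; lra.
Qed.

Theorem theorem6 (R : realType) (al au : R) (al_gt1 : 1 < al) (al_le_au : al <= au) :
  exists2 C0 : R, 0 < C0 &
  forall Cstar : R, C0 <= Cstar ->
  forall C : R, Cstar + 1 / C_adapt al au < C ->
  forall n p : nat -> nat,
    n m @[m --> \oo] --> \oo ->
    p m @[m --> \oo] --> \oo ->
    (p m)%:R * rate (n m) (p m) `^ (2 / (4 * al + 1)) @[m --> \oo] --> (+oo : set_system R) ->
    ln ((p m)%:R : R) / (n m)%:R @[m --> \oo] --> (0 : R) ->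
  gamma (@adaptive_test R (n m) (p m) al au 1 Cstar)
        (\bigcup_(alpha in `[al, au]) @Qclass R (p m) alpha 1 (C * psi (n m) (p m) alpha))
    @[m --> \oo] --> (0 : \bar R)%E.
Proof.
have K0 : 0 <= K1 (15 / 4) :> R.
  by rewrite /K1 /c8; apply: mulr_ge0; [apply: mulr_ge0|apply: mulr_ge0 => //; exact: exprn_ge0].
have au0 : 0 < 4 * au + 1 by lra.
pose B := 16 * (@K1 R (15 / 4) + 1) + 2.
have B0 : 0 < B by rewrite /B; lra.
have P0 : 0 <= 4 `^ au by exact: powR_ge0.
have M0 : 0 < (4 * au + 1) * B by exact: mulr_gt0.
(* One summand per demand: Cs >= 2 lifts half the mean above the threshold, 4^au absorbs the
   rounding of T, and the last makes the Gaussian tail beat its compensator. *)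
exists (2 + 4 `^ au + (4 * au + 1) * B); first by lra.
move=> Cs hCs C hC n p ninf pinf _ lnp.
have Cs2 : 2 <= Cs by lra.
have Cs4 : 4 `^ au <= Cs by lra.
have CsK : B <= Cs / (4 * au + 1) by rewrite ler_pdivlMr// mulrC; lra.
pose L m : R := ln ((n m)%:R * Num.sqrt (p m)%:R).
have n_ge (x : R) : \forall m \near \oo, x <= (n m)%:R.
  move/cvgnyPge : ninf => /(_ (Num.truncn x).+1); apply: filterS => m h.
  by apply: le_trans (ltW (truncnS_gt x)) _; rewrite ler_nat.
have p_ge2 : \forall m \near \oo, (1 < p m)%N by move/cvgnyPge : pinf => /(_ 2%N).
have n_ge2 : \forall m \near \oo, (1 < n m)%N by move/cvgnyPge : ninf => /(_ 2%N).
have sqrt_ge1 k : (1 < k)%N -> 1 <= Num.sqrt k%:R :> R.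
  by move=> k1; rewrite -[leLHS]sqrtr1 ler_wsqrtr// ler1n ltnW.
have L_ge (M : R) : \forall m \near \oo, M <= L m.
  move: (n_ge (expR M)) p_ge2; apply: filterS2 => m nM p2.
  have n0 : 0 < (n m)%:R :> R by apply: lt_le_trans nM; exact: expR_gt0.
  have s1 := sqrt_ge1 _ p2; rewrite /L -[leLHS]expRK ler_ln ?posrE ?expR_gt0//.
    by apply: le_trans nM _; rewrite ler_peMr// ltW.
  by rewrite mulr_gt0//; lra.
(* L is ln n + (ln p) / 2: the first part over n is at most 2 / sqrt n, the second is controlled by
   ln p = o(n). *)
have Ln_le (d : R) : 0 < d -> \forall m \near \oo, L m / (n m)%:R <= d.
  move=> d0; have d20 : 0 < d / 2 by lra.
  move/cvgrPdist_le : lnp => /(_ _ d20) hln; near=> m.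
  have n2 : (1 < n m)%N by near: m.
  have p2 : (1 < p m)%N by near: m.
  have hn : (4 / d) ^+ 2 <= (n m)%:R by near: m; exact: n_ge.
  have hp : ln (p m)%:R / (n m)%:R <= d / 2.
    have : `|0 - ln (p m)%:R / (n m)%:R| <= d / 2 by near: m; exact: hln.
    by rewrite sub0r normrN; apply: le_trans; exact: ler_norm.
  have n0 : 0 < (n m)%:R :> R by rewrite ltr0n ltnW.
  have p0 : 0 < (p m)%:R :> R by rewrite ltr0n ltnW.
  have s1 := sqrt_ge1 _ p2; have s0 : 0 < Num.sqrt (p m)%:R :> R by lra.
  have r1 := sqrt_ge1 _ n2; have r0 : 0 < Num.sqrt (n m)%:R :> R by lra.
  have lnp2 : ln (p m)%:R = 2 * ln (Num.sqrt (p m)%:R) :> R.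
    by rewrite -{1}[(p m)%:R](sqr_sqrtr (ltW p0)) lnXn// [RHS]mulr_natl.
  have rd : 4 / d <= Num.sqrt (n m)%:R.
    have d4 : 0 <= 4 / d by rewrite divr_ge0// ltW.
    by rewrite -[leLHS](ger0_norm d4) -sqrtr_sqr ler_wsqrtr.
  have h1 : ln (n m)%:R / (n m)%:R <= d / 2.
    rewrite ler_pdivrMr//; apply: le_trans (ln_le_sqrt n0) _.
    rewrite -{2}[(n m)%:R](sqr_sqrtr (ltW n0)).
    have : 4 <= Num.sqrt (n m)%:R * d by rewrite -ler_pdivrMr.
    by set r := Num.sqrt _ in r0 *; nra.
  rewrite /L lnM ?posrE// mulrDl; move: hp; rewrite lnp2.
  rewrite -[2 * _ / _]mulrA; move: h1; set u := _ / _; set v := _ / _; lra.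
have main (eps : R) : 0 < eps -> \forall m \near \oo,
   (0 <= gamma (@adaptive_test R (n m) (p m) al au 1 Cs)
        (\bigcup_(alpha in `[al, au]) @Qclass R (p m) alpha 1 (C * psi (n m) (p m) alpha))
     <= eps%:E)%E.
  have D0 : 0 < ((2048 * (@K1 R (15 / 4) + 1)) ^+ 2)^-1.
    by rewrite invr_gt0; apply: exprn_gt0; clear -K0; lra.
  move=> eps0; near=> m.
  have p2 : (1 < p m)%N by near: m.
  have n2 : (1 < n m)%N by near: m.
  have l1 : expR 1 <= L m by near: m; exact: L_ge.
  have l2 : 3 * (2 + cO * (15 / 4) * (15 / 4) * 16 / (2 / (4 * au + 1)) ^+ 2) / eps <= L m.
    by near: m; exact: L_ge.
  have l3 : expR ((3 * type2_cst au / eps) ^+ 2) <= L m by near: m; exact: L_ge.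
  have l4 : 16 * `|C| / (2 * al / (4 * al + 1)) ^+ 2 <= L m by near: m; exact: L_ge.
  have h1 : L m / (n m)%:R <= eps / 24 by near: m; apply: Ln_le; exact: divr_gt0.
  have h2 : L m / (n m)%:R <= ((2048 * (@K1 R (15 / 4) + 1)) ^+ 2)^-1.
    by near: m; exact: Ln_le.
  exact: (gamma_le_eps al_gt1 al_le_au n2 p2 Cs2 Cs4 CsK hC eps0 l1 l2 l3 l4 h1 h2).
(* The two-sided bound with eps = 1 makes [gamma] eventually finite, so the convergence reduces to
   the reals. *)
apply/fine_cvgP; split.
  have := main 1 ltr01; apply: filterS => m /andP[h1 h2].
  by rewrite fin_numElt (lt_le_trans _ h1)//= (le_lt_trans h2)// ltry.
apply/cvgrPdist_le => eps eps0; have := main _ eps0; apply: filterS => m /=.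
case: (gamma _ _) => [g| |] //=; rewrite ?lee_fin => /andP[h1 h2].
by rewrite sub0r normrN ger0_norm.
Unshelve. all: by end_near.
Qed.
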